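(* Let $k$ and $n$ be positive integers and $x>0$. Then $$\sum_{r=1}^{k}\binom{k}{r}\Bigg[\sum_{\substack{0\le c<a \\ 0\le b<d \\ ad-bc=n}}\frac{\log^{k-r}(cx+d)}{(cx+d)^2}\Phi_r'\left(\frac{ax+b}{cx+d}\right)-\sum_{\ell\mid n}\frac{\log^{k-r}(\ell)}{\ell}\Phi_r'(x)\Bigg]=\sum_{r=1}^{k}\binom{k}{r}\tilde\gamma_{k-r}\Bigg[\sum_{\substack{0\le c<a \\ 0\le b<d \\ ad-bc=n}}\frac{\log^r(ax+b)}{(ax+b)(cx+d)}-\sum_{\ell\mid n}\frac{\log^r(\ell x)}{\ell x}\Bigg],$$ where the sums with conditions $0\le c<a$, $0\le b<d$, $ad-bc=n$ run over integers $a,b,c,d$. In particular, for $n=2$, $$\sum_{r=1}^{k}\binom{k}{r}\bigg[\frac{\log^{k-r}(2)}{2}\left(\frac12\Phi_r'\left(\frac x2\right)+\frac12\Phi_r'\left(\frac{x+1}2\right)-\Phi_r'(x)\right)+\frac{\log^{k-r}(x+1)}{(x+1)^2}\Phi_r'\left(\frac{2x}{x+1}\right)\bigg]$$ $$=\Phi_k'(x)-\Phi_k'(2x)+\sum_{r=1}^{k}\binom{k}{r}\tilde\gamma_{k-r}\left[\frac{\log^r(x+1)}{2(x+1)}+\frac{\log^r(2x)}{2x(x+1)}-\frac{\log^r(x)}{2x}\right].$$ Here $\tilde\gamma_0=1$ and $\tilde\gamma_r=-r\gamma_{r-1}$ for $1\le r\le k$, with $\gamma_j$ the $j$-th Stieltjes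 constant.
   Context: Here $\log^j(t)=(\log t)^j$, with $\log^0(t)=1$ (also for $t=1$). Higher order Herglotz-Zagier function: for a positive integer $k$ and $x\in\mathbb{C}\setminus(-\infty,0]$, $$\Phi_k(x)=\sum_{n=1}^\infty\frac{k\,\psi_{k-1}(nx)-\log^k(nx)}{n},$$ where $\psi_k(x)=\Gamma_k'(x)/\Gamma_k(x)$ is the logarithmic derivative of Dilcher's generalized gamma function $$\Gamma_k(x)=\lim_{N\to\infty}\frac{\exp\left(\frac{\log^{k+1}(N)}{k+1}x\right)\prod_{j=1}^N\exp\left(\frac{\log^{k+1}(j)}{k+1}\right)}{\prod_{j=0}^N\exp\left(\frac{\log^{k+1}(j+x)}{k+1}\right)};$$ equivalently $\psi_k(x)=-\gamma_k(x)$, the negative of the $k$-th generalized Stieltjes constant. $\Phi_k'$ is the derivative of $\Phi_k$. The Stieltjes constants $\gamma_j$ are defined by $\zeta(s)=\frac1{s-1}+\sum_{j\ge0}\frac{(-1)^j\gamma_j}{j!}(s-1)^j$. *)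

(* Defs.v *)
From Stdlib Require Import Reals Lra Lia Psatz ZArith Arith List FinFun.
From Coquelicot Require Import Coquelicot.

Import ListNotations.
Open Scope R_scope.

Definition Cexp (z : C) : C := (exp (Re z) * cos (Im z), exp (Re z) * sin (Im z)).

(* Principal argument by the half-angle formula; only meaningful on the slit
   plane C \ (-oo, 0], where [Cexp_Clog] and [Carg_bound] identify [Clog] as
   the principal branch. *)
Definition Carg (z : C) : R := 2 * atan (Im z / (Cmod z + Re z)).

Definition Clog (z : C) : C := (ln (Cmod z), Carg z).

Definition slit_plane (z : C) : Prop := Im z <> 0 \/ 0 < Re z.

(* Total limit and sum in C, componentwise as in Coquelicot's [C_lim]. *)
Definition CLim_seq (u : nat -> C) : C :=
  (real (Lim_seq (fun N => Re (u N))), real (Lim_seq (fun N => Im (u N)))).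

Definition CSeries (a : nat -> C) : C :=
  (Series (fun n => Re (a n)), Series (fun n => Im (a n))).

Definition Csum {A : Type} (l : list A) (f : A -> C) : C :=
  fold_right Cplus 0 (map f l).

Definition Cprod {A : Type} (l : list A) (f : A -> C) : C :=
  fold_right Cmult 1 (map f l).

(* Dilcher's generalized gamma function. The term N = 0 uses the conventional
   value ln 0 = 0, which does not affect the limit. *)
Definition Gamma_seq (k : nat) (x : C) (N : nat) : C :=
  (Cexp (RtoC (ln (INR N) ^ (k + 1) / INR (k + 1)) * x)
   * Cprod (seq 1 N) (fun j => Cexp (RtoC (ln (INR j) ^ (k + 1) / INR (k + 1))))
   / Cprod (seq 0 (N + 1))
       (fun j => Cexp (Clog (RtoC (INR j) + x) ^ (k + 1) / RtoC (INR (k + 1)))))%C.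

Definition DGamma (k : nat) (x : C) : C := CLim_seq (Gamma_seq k x).

(* [C_derive f z] is the complex derivative whenever it exists
   ([C_derive_correct]). *)
Definition psi (k : nat) (x : C) : C := (C_derive (DGamma k) x / DGamma k x)%C.

(* The sum over n >= 1 is reindexed by n = m + 1; only k >= 1 is meaningful. *)
Definition Phi (k : nat) (x : C) : C :=
  CSeries (fun m =>
    let n := RtoC (INR (m + 1)) in
    ((RtoC (INR k) * psi (k - 1) (n * x) - Clog (n * x) ^ k) / n)%C).

Definition dPhi (k : nat) (x : R) : C := C_derive (Phi k) (RtoC x).

Definition is_riemann_zeta (zeta : C -> C) : Prop :=
  (forall s : C, 1 < Re s ->
     is_series (fun m => Cexp (- s * RtoC (ln (INR (m + 1))))%C) (zeta s))
  /\ (forall s : C, s <> RtoC 1 -> ex_derive zeta s).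

(* The regular part of zeta at 1 is entire, so the Laurent expansion holds for
   every s <> 1; it determines the sequence. *)
Definition is_stieltjes (gamma : nat -> R) : Prop :=
  exists zeta : C -> C,
    is_riemann_zeta zeta /\
    forall s : C, s <> RtoC 1 ->
      is_series
        (fun j => (RtoC ((-1) ^ j * gamma j / INR (fact j)) * (s - 1) ^ j)%C)
        (zeta s - 1 / (s - 1))%C.

Definition gamma_tilde (gamma : nat -> R) (r : nat) : R :=
  match r with
  | O => 1
  | S j => - INR r * gamma j
  end.

Definition zrange (n : nat) : list Z := map Z.of_nat (seq 0 (n + 1)).

(* The integer quadruples (a, b, c, d) with 0 <= c < a, 0 <= b < d and
   ad - bc = n; these conditions force all entries to be at most n, see
   [In_hecke_matrices]. *)
Definition hecke_matrices (n : nat) : list (Z * Z * Z * Z) :=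
  filter
    (fun '(a, b, c, d) =>
       (0 <=? c)%Z && (c <? a)%Z && (0 <=? b)%Z && (b <? d)%Z
       && (a * d - b * c =? Z.of_nat n)%Z)%bool
    (list_prod (list_prod (list_prod (zrange n) (zrange n)) (zrange n)) (zrange n)).

Definition divisors (n : nat) : list nat :=
  filter (fun l => (n mod l =? 0)%nat) (seq 1 n).

Lemma In_zrange (n : nat) (a : Z) : In a (zrange n) <-> (0 <= a <= Z.of_nat n)%Z.
Proof.
unfold zrange; rewrite in_map_iff; split.
- intros [m [<- Hm]]; apply in_seq in Hm; lia.
- intros Ha; exists (Z.to_nat a); split; [lia|]; apply in_seq; lia.
Qed.

Lemma In_hecke_matrices (n : nat) (a b c d : Z) :
  In (a, b, c, d) (hecke_matrices n) <->
  ((0 <= c < a) /\ (0 <= b < d) /\ a * d - b * c = Z.of_nat n)%Z.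
Proof.
unfold hecke_matrices; rewrite filter_In, !in_prod_iff, !In_zrange.
rewrite !Bool.andb_true_iff, !Z.leb_le, !Z.ltb_lt, Z.eqb_eq.
split; [lia|]; intros (Hc & Hb & Hn); repeat split; try lia; nia.
Qed.

Lemma NoDup_zrange (n : nat) : NoDup (zrange n).
Proof.
apply Injective_map_NoDup; [|apply seq_NoDup].
intros i j; apply Nat2Z.inj.
Qed.

Lemma NoDup_hecke_matrices (n : nat) : NoDup (hecke_matrices n).
Proof.
assert (H : forall (A B : Type) (l : list A) (l' : list B),
  NoDup l -> NoDup l' -> NoDup (list_prod l l')).
{ intros A B l l' Hl Hl'; induction Hl as [|x l Hx Hl IH]; simpl; [constructor|].
  apply NoDup_app; [|exact IH|].
  - apply Injective_map_NoDup; [|exact Hl'].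
    intros u v E; now injection E.
  - intros [u v] Hu Hv; apply in_map_iff in Hu; destruct Hu as [w [E _]].
    apply in_prod_iff in Hv; injection E as -> _; tauto. }
apply NoDup_filter; auto using NoDup_zrange.
Qed.

Lemma In_divisors (n l : nat) :
  (0 < n)%nat -> (In l (divisors n) <-> Nat.divide l n).
Proof.
intros Hn; unfold divisors; rewrite filter_In, in_seq, Nat.eqb_eq; split.
- intros [Hl E]; apply Nat.Lcm0.mod_divide; exact E.
- intros D; pose proof (Nat.divide_pos_le _ _ Hn D) as Hl.
  assert (l <> 0%nat) by (intros ->; destruct D as [q D]; lia).
  split; [lia|]; apply Nat.Lcm0.mod_divide; exact D.
Qed.

Lemma NoDup_divisors (n : nat) : NoDup (divisors n).
Proof. apply NoDup_filter, seq_NoDup. Qed.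

Lemma slit_plane_pos (z : C) : slit_plane z -> 0 < Cmod z + Re z.
Proof.
destruct z as [x y]; unfold slit_plane, Cmod, Re, Im; simpl.
replace (x * (x * 1) + y * (y * 1)) with (x ^ 2 + y ^ 2) by ring.
assert (Hs : 0 <= sqrt (x ^ 2 + y ^ 2)) by apply sqrt_pos.
assert (Hq : sqrt (x ^ 2 + y ^ 2) * sqrt (x ^ 2 + y ^ 2) = x ^ 2 + y ^ 2)
  by (apply sqrt_sqrt; nra).
intros [Hy|Hx]; [|lra].
assert (0 < y * y) by nra.
destruct (Rlt_le_dec 0 x); [lra|]; nra.
Qed.

Lemma Carg_bound (z : C) : - PI < Carg z < PI.
Proof.
unfold Carg; generalize (atan_bound (Im z / (Cmod z + Re z))); lra.
Qed.

Lemma Cexp_Clog (z : C) : slit_plane z -> Cexp (Clog z) = z.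
Proof.
intros Hz; generalize (slit_plane_pos z Hz); intros Hp.
assert (Hm : 0 < Cmod z).
{ apply Cmod_gt_0; intros ->; unfold slit_plane in Hz; simpl in Hz; lra. }
assert (Hq : Cmod z * Cmod z = Re z ^ 2 + Im z ^ 2).
{ unfold Cmod, Re, Im; apply sqrt_sqrt; nra. }
unfold Cexp, Clog; simpl; rewrite exp_ln by exact Hm.
unfold Carg; destruct z as [x y]; unfold Re, Im in *; simpl fst in *; simpl snd in *.
set (m := Cmod (x, y)) in *.
set (t := y / (m + x)).
assert (Ht : 1 + t ^ 2 = 2 * m / (m + x)).
{ unfold t; apply Rmult_eq_reg_r with ((m + x) ^ 2); [|nra].
  field_simplify; [|lra|lra]; nra. }
assert (Hu : 0 < 1 + t ^ 2) by nra.
assert (Hi : (1 / sqrt (1 + t ^ 2)) * (1 / sqrt (1 + t ^ 2)) = (m + x) / (2 * m)).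
{ replace ((m + x) / (2 * m)) with (/ (1 + t ^ 2)) by (rewrite Ht; field; lra).
  rewrite <- (sqrt_sqrt (1 + t ^ 2)) at 3 by lra.
  field; apply Rgt_not_eq, sqrt_lt_R0; exact Hu. }
assert (Hc : cos (atan t) = 1 / sqrt (1 + t ^ 2)).
{ rewrite cos_atan; unfold Rsqr; do 3 f_equal; ring. }
assert (Hs : sin (atan t) = t * (1 / sqrt (1 + t ^ 2))).
{ rewrite sin_atan; unfold Rsqr.
  replace (1 + t * t) with (1 + t ^ 2) by ring; unfold Rdiv; ring. }
rewrite cos_2a, sin_2a, Hc, Hs.
set (w := 1 / sqrt (1 + t ^ 2)) in *.
f_equal.
- replace (w * w - t * w * (t * w)) with ((1 - t ^ 2) * (w * w)) by ring.
  rewrite Hi; replace (1 - t ^ 2) with (2 - 2 * m / (m + x)) by lra.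
  field; lra.
- replace (2 * (t * w) * w) with (2 * t * (w * w)) by ring.
  rewrite Hi; unfold t; field; lra.
Qed.

(* Main.v *)
(** With [h = log^k] and [G = - h''], differentiating the definition twice gives
    [Phi_r'(y) = sum_(p >= 1) (sum_(q >= 0) G_r(p y + q) - h_r'(p y))], and the binomial
    theorem for [log(v w) = log v + log w] collapses the sum over [r] on the left-hand side,
    for [u = a x + b] and [v = c x + d], to a regularized sum of [G(p u + q v)] over the
    lattice points of the cone spanned by the rows of the matrix.  The Stieltjes constants
    on the right-hand side are exactly what turns it into the limit, as [X] grows, of
    [sum_(p u + q v <= X) G(p u + q v) - (h(X) - X h'(X)) / (u v)].  This cutoff depends only
    on the lattice vector.  For each lattice of index [n] in [Z^2] the cones of the matrices
    with [0 <= c < a], [0 <= b < d] tile the quadrant, so the sums over all matrices count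
    each vector as often as there are sublattices of index [n] containing it, which is
    [sum_(l | gcd(vector, n)) l].  That is the sum over divisors. *)

Require Import Defs.
From Stdlib Require Import Reals Lra Lia ZArith Arith List Permutation FinFun.
From Coquelicot Require Import Coquelicot.
Import ListNotations.
Open Scope R_scope.

(** * Finite sums and series *)

(** The obstacle is divergence. Since [G(y)] has size [log^(k-1)(y) / y^2], its sum over a
    two-dimensional cone is infinite, so lattice points may not be moved freely from one cone to
    another. The cutoff by the size of the vector leaves finite sums, and the tiling becomes a
    bijection between finite index sets. The term subtracted is the integral of [G] over the
    truncated cone: the parameters [(p, q)] with [p u + q v] near [s] have measure [s ds / (u v)],
    and [h(s) - s h'(s)] is an antiderivative of [s G(s)]. It still diverges, so the sums of
    [1 / (u v)] over matrices and over divisors must agree. This is not computed: the case [k = 1]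
    of the limit itself forces it. The Stieltjes constants are given only by the Laurent expansion
    of zeta. They are reached through real arguments alone, by comparing two expansions of
    [zeta(1 + t) - 1 / t] as [t] decreases to 0. On the positive axis the gamma functions, [psi] and
    [Phi] are real as well, so all of the analysis is real. *)

Definition lsum {A : Type} (l : list A) (f : A -> R) : R :=
  fold_right Rplus 0 (map f l).

Lemma lsum_cons {A : Type} (a : A) (l : list A) (f : A -> R) :
  lsum (a :: l) f = f a + lsum l f.
Proof. reflexivity. Qed.

Lemma lsum_ext {A : Type} (l : list A) (f g : A -> R) :
  (forall a, In a l -> f a = g a) -> lsum l f = lsum l g.
Proof.
unfold lsum; induction l as [|a l IH]; simpl; intros H; [easy|].
rewrite (H a) by auto; f_equal; apply IH; auto.
Qed.

Lemma lsum_app {A : Type} (l l' : list A) (f : A -> R) :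
  lsum (l ++ l') f = lsum l f + lsum l' f.
Proof.
unfold lsum; induction l as [|a l IH]; simpl; [ring|]; rewrite IH; ring.
Qed.

Lemma lsum_map {A B : Type} (g : A -> B) (l : list A) (f : B -> R) :
  lsum (map g l) f = lsum l (fun a => f (g a)).
Proof. unfold lsum; now rewrite map_map. Qed.

Lemma lsum_plus {A : Type} (l : list A) (f g : A -> R) :
  lsum l (fun a => f a + g a) = lsum l f + lsum l g.
Proof. unfold lsum; induction l as [|a l IH]; simpl; [|rewrite IH]; ring. Qed.

Lemma lsum_scal {A : Type} (l : list A) (c : R) (f : A -> R) :
  lsum l (fun a => c * f a) = c * lsum l f.
Proof. unfold lsum; induction l as [|a l IH]; simpl; [|rewrite IH]; ring. Qed.

Lemma lsum_minus {A : Type} (l : list A) (f g : A -> R) :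
  lsum l (fun a => f a - g a) = lsum l f - lsum l g.
Proof. unfold lsum; induction l as [|a l IH]; simpl; [|rewrite IH]; ring. Qed.

Lemma lsum_const {A : Type} (l : list A) (c : R) :
  lsum l (fun _ => c) = INR (length l) * c.
Proof.
induction l as [|a l IH]; [unfold lsum; simpl; ring|].
change (c + lsum l (fun _ => c) = INR (S (length l)) * c).
rewrite IH, S_INR; ring.
Qed.

Lemma lsum_zero {A : Type} (l : list A) (f : A -> R) :
  (forall a, In a l -> f a = 0) -> lsum l f = 0.
Proof.
intros H; rewrite (lsum_ext l f (fun _ => 0)) by exact H.
rewrite lsum_const; ring.
Qed.

Lemma lsum_swap {A B : Type} (l : list A) (l' : list B) (f : A -> B -> R) :
  lsum l (fun a => lsum l' (fun b => f a b))
  = lsum l' (fun b => lsum l (fun a => f a b)).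
Proof.
induction l as [|a l IH].
- symmetry; now apply lsum_zero.
- change (lsum l' (f a) + lsum l (fun a => lsum l' (fun b => f a b))
          = lsum l' (fun b => f a b + lsum l (fun a => f a b))).
  now rewrite IH, lsum_plus.
Qed.

Lemma lsum_prod {A B : Type} (l : list A) (l' : list B) (f : A * B -> R) :
  lsum (list_prod l l') f = lsum l (fun a => lsum l' (fun b => f (a, b))).
Proof.
induction l as [|a l IH]; [easy|].
simpl list_prod; rewrite lsum_app, lsum_map, IH; reflexivity.
Qed.

Lemma lsum_Permutation {A : Type} (l l' : list A) (f : A -> R) :
  Permutation l l' -> lsum l f = lsum l' f.
Proof.
unfold lsum; induction 1; simpl; [easy|now f_equal|ring|congruence].
Qed.

Lemma lsum_le {A : Type} (l : list A) (f g : A -> R) :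
  (forall a, In a l -> f a <= g a) -> lsum l f <= lsum l g.
Proof.
unfold lsum; induction l as [|a l IH]; simpl; intros H; [lra|].
apply Rplus_le_compat; auto.
Qed.

Lemma lsum_Rabs {A : Type} (l : list A) (f : A -> R) :
  Rabs (lsum l f) <= lsum l (fun a => Rabs (f a)).
Proof.
unfold lsum; induction l as [|a l IH]; simpl; [rewrite Rabs_R0; lra|].
eapply Rle_trans; [apply Rabs_triang|]; lra.
Qed.

Lemma lsum_seq_S (m n : nat) (f : nat -> R) :
  lsum (seq m (S n)) f = lsum (seq m n) f + f (m + n)%nat.
Proof. rewrite seq_S, lsum_app; unfold lsum; simpl; ring. Qed.

Lemma lsum_seq_shift (m n j : nat) (f : nat -> R) :
  lsum (seq (m + j) n) f = lsum (seq m n) (fun i => f (i + j)%nat).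
Proof.
induction n as [|n IH]; [easy|]; rewrite !lsum_seq_S, IH.
do 2 f_equal; lia.
Qed.

Lemma lsum_telescope (n : nat) (f : nat -> R) :
  lsum (seq 0 n) (fun i => f (S i) - f i) = f n - f 0%nat.
Proof.
induction n as [|n IH]; [unfold lsum; simpl; ring|].
rewrite lsum_seq_S, IH; cbn beta; rewrite Nat.add_0_l; ring.
Qed.

Lemma lsum_sum_n (n : nat) (f : nat -> R) :
  sum_n f n = lsum (seq 0 (S n)) f.
Proof.
induction n as [|n IH].
- rewrite sum_O; unfold lsum; simpl; ring.
- rewrite sum_Sn, IH, (lsum_seq_S 0 (S n)); reflexivity.
Qed.

Lemma lsum_sum_f_R0 (n : nat) (f : nat -> R) :
  sum_f_R0 f n = lsum (seq 0 (S n)) f.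
Proof. now rewrite <- sum_n_Reals, lsum_sum_n. Qed.

Lemma is_series_lsum (f : nat -> R) (l : R) :
  is_series f l <-> is_lim_seq (fun N => lsum (seq 0 N) f) l.
Proof.
rewrite is_lim_seq_incr_1; split; intros H.
- apply (is_lim_seq_ext (sum_n f)); [|exact H].
  intros n; apply lsum_sum_n.
- apply (is_lim_seq_ext _ (sum_n f)) in H; [exact H|].
  intros n; symmetry; apply lsum_sum_n.
Qed.

Lemma is_lim_seq_lsum {A : Type} (l : list A) (u : A -> nat -> R) (v : A -> R) :
  (forall a, In a l -> is_lim_seq (u a) (v a)) ->
  is_lim_seq (fun n => lsum l (fun a => u a n)) (lsum l v).
Proof.
induction l as [|a l IH]; intros H.
- apply is_lim_seq_const.
- apply (is_lim_seq_plus' (u a) (fun n => lsum l (fun a => u a n)) (v a) (lsum l v)).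
  + apply H; now left.
  + apply IH; intros b Hb; apply H; now right.
Qed.

Lemma is_lim_seq_mult_r (u : nat -> R) (l c : R) :
  is_lim_seq u l -> is_lim_seq (fun n => u n * c) (l * c).
Proof. intros H; apply (is_lim_seq_scal_r u c l H). Qed.

Lemma is_lim_seq_mult_l (u : nat -> R) (l c : R) :
  is_lim_seq u l -> is_lim_seq (fun n => c * u n) (c * l).
Proof. intros H; apply (is_lim_seq_scal_l u c l H). Qed.

Lemma is_series_Rlsum {A : Type} (l : list A) (f : A -> nat -> R) (v : A -> R) :
  (forall a, In a l -> is_series (f a) (v a)) ->
  is_series (fun n => lsum l (fun a => f a n)) (lsum l v).
Proof.
intros H; apply is_series_lsum.
apply (is_lim_seq_ext (fun N => lsum l (fun a => lsum (seq 0 N) (f a)))).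
- intros N; symmetry; apply lsum_swap.
- apply is_lim_seq_lsum; intros a Ha; apply is_series_lsum; auto.
Qed.

Lemma ex_series_dominated (J : nat) (f M : nat -> R) :
  (forall n, (J <= n)%nat -> Rabs (f n) <= M n) -> ex_series M -> ex_series f.
Proof.
intros H HM; apply (ex_series_incr_n f J).
apply (@ex_series_le R_AbsRing R_CompleteNormedModule _ (fun k => M (J + k)%nat)).
- intros n; apply H; lia.
- now apply ex_series_incr_n.
Qed.

Lemma Series_split (N : nat) (f : nat -> R) :
  ex_series f ->
  Series f = lsum (seq 0 N) f + Series (fun k => f (N + k)%nat).
Proof.
intros H; destruct N as [|N].
- unfold lsum; simpl; rewrite Rplus_0_l; reflexivity.
- rewrite (Series_incr_n f (S N)) by (auto; lia); simpl pred.
  now rewrite lsum_sum_f_R0.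
Qed.

Lemma Series_tail (f : nat -> R) :
  ex_series f -> is_lim_seq (fun N => Series (fun k => f (N + k)%nat)) 0.
Proof.
intros H.
apply (is_lim_seq_ext (fun N => Series f - lsum (seq 0 N) f)).
- intros N; rewrite (Series_split N f H); ring.
- replace (Finite 0) with (Finite (Series f - Series f)) by (f_equal; ring).
  apply is_lim_seq_minus'; [apply is_lim_seq_const|].
  now apply is_series_lsum, Series_correct.
Qed.

(** Uniform convergence of the derivatives concerns tails only. Domination is therefore asked for
    from an index [J] on, which suits estimates on powers of the logarithm that hold only for large
    arguments. *)
Lemma is_derive_Series (f f' : nat -> R -> R) (M : nat -> R) (J : nat)
  (x : R) (d : posreal) :
  (forall n y, Rabs (y - x) < d -> is_derive (f n) y (f' n y)) ->
  (forall y, Rabs (y - x) < d -> ex_series (fun n => f n y)) ->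
  (forall n y, (J <= n)%nat -> Rabs (y - x) < d -> Rabs (f' n y) <= M n) ->
  ex_series M ->
  is_derive (fun y => Series (fun n => f n y)) x (Series (fun n => f' n x)).
Proof.
intros Hd Hf HM EM; apply is_derive_Reals.
apply (CVU_derivable (fun N y => lsum (seq 0 N) (fun n => f n y))
  (fun N y => lsum (seq 0 N) (fun n => f' n y)) _
  (fun y => Series (fun n => f' n y)) x d).
- intros eps Heps.
  destruct (proj1 (is_lim_seq_Reals _ _) (Series_tail M EM) eps Heps) as [N0 HN0].
  exists (Nat.max J N0); intros n y Hn Hy; unfold Boule in Hy.
  assert (E : ex_series (fun n => f' n y)).
  { apply (ex_series_dominated J _ M); [|exact EM]; intros; now apply HM. }
  rewrite (Series_split n _ E).
  match goal with |- Rabs (?a + ?b - ?a) < _ => replace (a + b - a) with b by ring end.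
  assert (E' : ex_series (fun k => Rabs (f' (n + k)%nat y))).
  { apply (ex_series_dominated 0 _ (fun k => M (n + k)%nat)).
    - intros m _; rewrite Rabs_Rabsolu; apply HM; [lia|exact Hy].
    - now apply ex_series_incr_n. }
  eapply Rle_lt_trans; [apply (Series_Rabs _ E')|].
  assert (Hle : Series (fun k => Rabs (f' (n + k)%nat y))
                <= Series (fun k => M (n + k)%nat)).
  { apply Series_le; [|now apply ex_series_incr_n].
    intros m; split; [apply Rabs_pos|]; apply HM; [lia|exact Hy]. }
  eapply Rle_lt_trans; [exact Hle|].
  generalize (HN0 n ltac:(lia)); unfold Rdist; rewrite Rminus_0_r.
  apply Rle_lt_trans, RRle_abs.
- intros y Hy; apply is_lim_seq_Reals, is_series_lsum, Series_correct, Hf, Hy.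
- intros n y Hy; unfold Boule in Hy.
  apply is_derive_Reals; induction n as [|n IH].
  + apply (is_derive_ext (fun _ => 0)); [reflexivity|].
    apply @is_derive_const.
  + apply (is_derive_ext (fun y => lsum (seq 0 n) (fun n => f n y) + f n y)).
    { intros t; now rewrite lsum_seq_S. }
    rewrite lsum_seq_S; apply (is_derive_plus (V := R_NormedModule)); auto.
- unfold Boule; replace (x - x) with 0 by ring; rewrite Rabs_R0; apply cond_pos.
Qed.

(** * Derivatives of powers of the logarithm *)

Definition logp (r : nat) (y : R) : R := ln y ^ r.

(** Truncated subtraction in the exponents is harmless, here and in the two derivatives below:
    wherever an exponent is truncated, its coefficient is 0. *)
Definition dlogp (r : nat) (y : R) : R := INR r * ln y ^ (r - 1) / y.

(* Minus the second derivative of [logp r], which is eventually positive and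
   decreasing. *)
Definition glogp (r : nat) (y : R) : R :=
  INR r * (ln y ^ (r - 1) - INR (r - 1) * ln y ^ (r - 2)) / y ^ 2.

Definition dglogp (r : nat) (y : R) : R :=
  - (INR r * (2 * ln y ^ (r - 1) - 3 * INR (r - 1) * ln y ^ (r - 2)
              + INR (r - 1) * INR (r - 2) * ln y ^ (r - 3)) / y ^ 3).

Lemma is_derive_logp (r : nat) (y : R) :
  0 < y -> is_derive (logp r) y (dlogp r y).
Proof.
intros Hy; unfold logp, dlogp; auto_derive; [easy|].
replace (Init.Nat.pred r) with (r - 1)%nat by lia; field; lra.
Qed.

Lemma is_derive_dlogp (r : nat) (y : R) :
  0 < y -> is_derive (dlogp r) y (- glogp r y).
Proof.
intros Hy; unfold dlogp, glogp; auto_derive; [split; [easy|lra]|].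
replace (Init.Nat.pred (r - 1)) with (r - 2)%nat by lia; field; lra.
Qed.

Lemma is_derive_glogp (r : nat) (y : R) :
  0 < y -> is_derive (glogp r) y (dglogp r y).
Proof.
intros Hy; unfold glogp, dglogp; auto_derive; [repeat split; try easy; nra|].
replace (Init.Nat.pred (r - 1)) with (r - 2)%nat by lia.
replace (Init.Nat.pred (r - 2)) with (r - 3)%nat by lia; simpl; field; lra.
Qed.

Lemma is_derive_continuity_pt (f : R -> R) (y l : R) :
  is_derive f y l -> continuity_pt f y.
Proof.
intros H; apply derivable_continuous_pt; exists l; now apply is_derive_Reals.
Qed.

Lemma mean_value (f f' : R -> R) (a b : R) :
  a <= b -> (forall y, a <= y <= b -> is_derive f y (f' y)) ->
  exists c, a <= c <= b /\ f b - f a = f' c * (b - a).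
Proof.
intros Hab H; destruct (MVT_gen f a b f') as [c Hc].
- intros y; rewrite Rmin_left, Rmax_right by lra; intros; apply H; lra.
- intros y; rewrite Rmin_left, Rmax_right by lra; intros.
  eapply is_derive_continuity_pt, H; lra.
- rewrite Rmin_left, Rmax_right in Hc by lra; now exists c.
Qed.

(** Raising [exp z >= z] at [z = ln y / (n + 1)] to the power [n + 1] gives
    [(ln y / (n + 1)) ^ (n + 1) <= y]. *)
Lemma ln_pow_le (n : nat) (y : R) :
  1 < y -> 0 <= ln y ^ n / y <= INR (S n) ^ S n / ln y.
Proof.
intros Hy.
assert (HL : 0 < ln y) by (rewrite <- ln_1; apply ln_increasing; lra).
assert (Hn : 0 < INR (S n)) by (apply lt_0_INR; lia).
assert (He : (ln y / INR (S n)) ^ S n <= y).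
{ apply Rle_trans with (exp (ln y / INR (S n)) ^ S n).
  - apply pow_incr; split; [apply Rlt_le, Rdiv_lt_0_compat; lra|].
    generalize (exp_ineq1_le (ln y / INR (S n))); lra.
  - apply Req_le; rewrite <- Rpower_pow by apply exp_pos; unfold Rpower.
    rewrite ln_exp; replace (INR (S n) * (ln y / INR (S n))) with (ln y)
      by (field; lra).
    apply exp_ln; lra. }
split.
- apply Rmult_le_pos; [apply pow_le; lra|apply Rlt_le, Rinv_0_lt_compat; lra].
- apply Rmult_le_reg_r with y; [lra|].
  replace (ln y ^ n / y * y) with (ln y ^ n) by (field; lra).
  apply Rmult_le_reg_r with (ln y); [lra|].
  replace (INR (S n) ^ S n / ln y * y * ln y) with (INR (S n) ^ S n * y)
    by (field; lra).
  replace (ln y ^ n * ln y) with (ln y ^ S n) by (simpl; ring).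
  apply Rle_trans with (INR (S n) ^ S n * (ln y / INR (S n)) ^ S n).
  + rewrite <- Rpow_mult_distr; apply Req_le; f_equal; field; lra.
  + apply Rmult_le_compat_l; [apply pow_le; lra|exact He].
Qed.

Lemma is_lim_ln_pow (n : nat) : is_lim (fun y => ln y ^ n / y) p_infty 0.
Proof.
apply (is_lim_le_le_loc (fun _ => 0) (fun y => INR (S n) ^ S n * / ln y)).
- exists 1; intros y Hy; apply (ln_pow_le n y Hy).
- apply is_lim_const.
- replace (Finite 0) with (Rbar_mult (INR (S n) ^ S n) (Rbar_inv p_infty))
    by (simpl; f_equal; ring).
  apply is_lim_scal_l, is_lim_inv; [apply is_lim_ln_p|easy].
Qed.

Lemma is_lim_dlogp (r : nat) : is_lim (dlogp r) p_infty 0.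
Proof.
apply (is_lim_ext (fun y => INR r * (ln y ^ (r - 1) / y))).
{ intros y; unfold dlogp, Rdiv; ring. }
replace (Finite 0) with (Rbar_mult (INR r) 0) by (simpl; f_equal; ring).
apply is_lim_scal_l, is_lim_ln_pow.
Qed.

Lemma is_lim_mult_glogp (r : nat) : is_lim (fun y => y * glogp r y) p_infty 0.
Proof.
apply (is_lim_ext_loc (fun y => INR r * (ln y ^ (r - 1) / y)
                      - INR r * INR (r - 1) * (ln y ^ (r - 2) / y))).
{ exists 0; intros y Hy; unfold glogp; field; lra. }
eapply is_lim_minus; [apply is_lim_scal_l, is_lim_ln_pow|
  apply is_lim_scal_l, is_lim_ln_pow|].
unfold is_Rbar_minus, is_Rbar_plus; simpl; f_equal; f_equal; ring.
Qed.

Lemma is_lim_seq_comp_p_infty (f : R -> R) (l : R) (u : nat -> R) :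
  is_lim f p_infty l -> is_lim_seq u p_infty -> is_lim_seq (fun n => f (u n)) l.
Proof.
intros Hf Hu; apply (is_lim_comp_seq f u p_infty l Hf); [|exact Hu].
exists 0%nat; easy.
Qed.

Lemma is_lim_seq_affine (y v : R) :
  0 < v -> is_lim_seq (fun n => y + INR n * v) p_infty.
Proof.
intros Hv.
eapply is_lim_seq_plus; [apply is_lim_seq_const| |].
- apply is_lim_seq_scal_r, is_lim_seq_INR.
- simpl; destruct (Rle_dec 0 v) as [H|]; [|lra].
  destruct (Rle_lt_or_eq_dec 0 v H); [easy|lra].
Qed.

(** Beyond [exp (2 r)] one has [ln y >= 2 r], so [(r - 1) L ^ (r - 2)] is at most half of
    [L ^ (r - 1)] for [L = ln y]. The leading power then decides all three signs. *)
Lemma logp_eventually (r : nat) : (0 < r)%nat ->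
  exists Y, 1 <= Y /\ forall y, Y <= y ->
    0 <= glogp r y /\ dglogp r y <= 0 /\ dlogp r y <= 2 * y * glogp r y.
Proof.
intros Hr; exists (exp (2 * INR r)).
assert (Hr1 : 1 <= INR r) by (apply (le_INR 1); lia).
split; [rewrite <- exp_0; apply Rlt_le, exp_increasing; lra|].
intros y Hy.
assert (Hy0 : 0 < y) by (eapply Rlt_le_trans; [apply exp_pos|exact Hy]).
assert (HL : 2 * INR r <= ln y).
{ rewrite <- (ln_exp (2 * INR r)).
  destruct Hy as [Hy|<-]; [apply Rlt_le, ln_increasing; [apply exp_pos|easy]|lra]. }
set (L := ln y) in *.
assert (Hs : INR r = INR (r - 1) + 1).
{ rewrite <- S_INR; f_equal; lia. }
assert (H2 : INR (r - 1) * L ^ (r - 2) * L = INR (r - 1) * L ^ (r - 1)).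
{ destruct r as [|[|r]]; [lia|simpl; ring|].
  replace (S (S r) - 1)%nat with (S r) by lia.
  replace (S (S r) - 2)%nat with r by lia; simpl pow; ring. }
assert (HA : 0 <= L ^ (r - 1)) by (apply pow_le; lra).
assert (HB : INR (r - 1) * L ^ (r - 2) <= L ^ (r - 1) / 2).
{ assert (0 <= L ^ (r - 2)) by (apply pow_le; lra); nra. }
assert (H0 : 0 <= INR (r - 1)) by apply pos_INR.
repeat split.
- unfold glogp; apply Rmult_le_pos; [|apply Rlt_le, Rinv_0_lt_compat; nra].
  apply Rmult_le_pos; fold L; lra.
- unfold dglogp; fold L.
  assert (0 <= INR (r - 1) * INR (r - 2) * L ^ (r - 3)).
  { apply Rmult_le_pos; [apply Rmult_le_pos; apply pos_INR|apply pow_le; lra]. }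
  assert (0 < / y ^ 3) by (apply Rinv_0_lt_compat; apply pow_lt; lra).
  assert (0 <= INR r * (2 * L ^ (r - 1) - 3 * INR (r - 1) * L ^ (r - 2)
              + INR (r - 1) * INR (r - 2) * L ^ (r - 3))).
  { apply Rmult_le_pos; lra. }
  unfold Rdiv; nra.
- unfold dlogp, glogp; fold L.
  replace (2 * y * (INR r * (L ^ (r - 1) - INR (r - 1) * L ^ (r - 2)) / y ^ 2))
    with (INR r * (2 * (L ^ (r - 1) - INR (r - 1) * L ^ (r - 2))) / y)
    by (field; lra).
  apply Rmult_le_compat_r; [apply Rlt_le, Rinv_0_lt_compat; lra|].
  apply Rmult_le_compat_l; lra.
Qed.

(** The form in which later convergence proofs use the logarithm: a single threshold [Y], beyond
    which the mean value theorem bounds the increments of [dlogp] and [logp] by the derivative at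
    either end. *)
Lemma logp_tame (r : nat) : (0 < r)%nat ->
  exists Y, 1 <= Y /\
    (forall y, Y <= y -> 0 <= glogp r y) /\
    (forall y z, Y <= y -> y <= z -> glogp r z <= glogp r y) /\
    (forall y z, Y <= y -> y <= z ->
       (z - y) * glogp r z <= dlogp r y - dlogp r z <= (z - y) * glogp r y) /\
    (forall y, Y <= y -> 0 <= dlogp r y) /\
    (forall y z, Y <= y -> y <= z ->
       (z - y) * dlogp r z <= logp r z - logp r y <= (z - y) * dlogp r y) /\
    (forall y, Y <= y -> dlogp r y <= 2 * y * glogp r y).
Proof.
intros Hr; destruct (logp_eventually r Hr) as [Y [HY H]].
assert (Hmono : forall y z, Y <= y -> y <= z -> glogp r z <= glogp r y).
{ intros y z Hy Hz.
  destruct (mean_value (glogp r) (dglogp r) y z Hz) as [c [Hc E]].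
  - intros; apply is_derive_glogp; lra.
  - destruct (H c ltac:(lra)) as [_ [Hd _]]; nra. }
assert (Hd : forall y z, Y <= y -> y <= z ->
       (z - y) * glogp r z <= dlogp r y - dlogp r z <= (z - y) * glogp r y).
{ intros y z Hy Hz.
  destruct (mean_value (dlogp r) (fun y => - glogp r y) y z Hz) as [c [Hc E]].
  - intros; apply is_derive_dlogp; lra.
  - generalize (Hmono c z ltac:(lra) ltac:(lra)) (Hmono y c Hy ltac:(lra)); nra. }
assert (Hp : forall y, Y <= y -> 0 <= glogp r y) by (intros; now apply H).
assert (Hdm : forall y z, Y <= y -> y <= z -> dlogp r z <= dlogp r y).
{ intros y z Hy Hz; generalize (Hd y z Hy Hz) (Hp z ltac:(lra)); nra. }
(* [dlogp] decreases beyond [Y] and tends to 0. *)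
assert (Hd0 : forall y, Y <= y -> 0 <= dlogp r y).
{ intros y Hy.
  assert (Hl : is_lim_seq (fun n => dlogp r (y + INR n * 1)) 0).
  { apply (is_lim_seq_comp_p_infty (dlogp r)); [apply is_lim_dlogp|].
    apply is_lim_seq_affine; lra. }
  apply (is_lim_seq_le _ (fun _ => dlogp r y) 0 (dlogp r y)) in Hl;
    [exact Hl| |apply is_lim_seq_const].
  intros n; apply Hdm; [lra|]; generalize (pos_INR n); lra. }
exists Y; do 5 (split; [assumption|]); split; [|intros; now apply H].
intros y z Hy Hz.
destruct (mean_value (logp r) (dlogp r) y z Hz) as [c [Hc E]].
- intros; apply is_derive_logp; lra.
- generalize (Hdm c z ltac:(lra) ltac:(lra)) (Hdm y c Hy ltac:(lra)); nra.
Qed.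

(** Comparison of a decreasing function with its integral: [dlogp r y] is the integral of [glogp r]
    from [y] to infinity, and with step [v] the sum exceeds the integral over [v] by at most its
    first term. *)
Lemma glogp_series_bounds (r : nat) (Y y v : R) :
  0 < v -> Y <= y ->
  (forall y z, Y <= y -> y <= z ->
     (z - y) * glogp r z <= dlogp r y - dlogp r z <= (z - y) * glogp r y) ->
  (forall y, Y <= y -> 0 <= glogp r y) ->
  (forall y, Y <= y -> 0 <= dlogp r y) ->
  ex_series (fun q => glogp r (y + INR q * v)) /\
  dlogp r y / v <= Series (fun q => glogp r (y + INR q * v))
    <= dlogp r y / v + glogp r y.
Proof.
intros Hv Hy Hd Hg Hd0.
set (g := fun q => glogp r (y + INR q * v)).
set (t := fun q => dlogp r (y + INR q * v) / v).
assert (HqY : forall q, Y <= y + INR q * v).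
{ intros q; generalize (pos_INR q); nra. }
assert (Hstep : forall q, g (S q) <= t q - t (S q) <= g q).
{ intros q; generalize (Hd (y + INR q * v) (y + INR (S q) * v) (HqY q)).
  rewrite S_INR; intros H; specialize (H ltac:(lra)).
  replace (y + (INR q + 1) * v - (y + INR q * v)) with v in H by ring.
  unfold g, t; rewrite S_INR.
  split; apply Rmult_le_reg_l with v; try lra;
  match goal with |- context [v * (?a / v - ?b / v)] =>
    replace (v * (a / v - b / v)) with (a - b) by (field; lra) end; lra. }
assert (Ht : is_series (fun q => t q - t (S q)) (dlogp r y / v)).
{ apply is_series_lsum.
  apply (is_lim_seq_ext (fun N => t 0%nat - t N)).
  - intros N; rewrite (lsum_ext _ _ (fun i => (-1) * (t (S i) - t i)))
      by (intros; ring).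
    rewrite lsum_scal, lsum_telescope; ring.
  - replace (Finite (dlogp r y / v)) with (Finite (t 0%nat - 0 / v)).
    + apply is_lim_seq_minus'; [apply is_lim_seq_const|].
      unfold t, Rdiv; apply is_lim_seq_mult_r.
      apply (is_lim_seq_comp_p_infty (dlogp r)); [apply is_lim_dlogp|].
      now apply is_lim_seq_affine.
    + unfold t; simpl INR; f_equal; unfold Rdiv.
      rewrite Rmult_0_l, Rplus_0_r; ring. }
assert (Hg0 : forall q, 0 <= g q) by (intros; apply Hg, HqY).
assert (E1 : ex_series (fun q => g (S q))).
{ apply (ex_series_dominated 0 _ (fun q => t q - t (S q))); [|eexists; exact Ht].
  intros q _; rewrite Rabs_right by (apply Rle_ge, Hg0); apply Hstep. }
assert (E : ex_series g) by now apply ex_series_incr_1.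
split; [exact E|].
rewrite <- (is_series_unique _ _ Ht); split.
- apply Series_le; [|exact E]; intros q.
  generalize (Hstep q) (Hg0 (S q)); lra.
- rewrite (Series_incr_1 _ E); unfold g at 1; simpl INR.
  rewrite Rmult_0_l, Rplus_0_r.
  assert (Series (fun q => g (S q)) <= Series (fun q => t q - t (S q))).
  { apply Series_le; [|eexists; exact Ht].
    intros q; split; [apply Hg0|apply Hstep]. }
  unfold g in *; lra.
Qed.

Lemma ex_series_glogp (r : nat) (y v : R) :
  (0 < r)%nat -> 0 < v -> ex_series (fun q => glogp r (y + INR q * v)).
Proof.
intros Hr Hv; destruct (logp_tame r Hr) as [Y (HY & Hg & _ & Hd & Hd0 & _)].
destruct (INR_unbounded ((Y - y) / v)) as [n Hn].
apply (ex_series_incr_n _ n).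
apply (ex_series_ext (fun q => glogp r ((y + INR n * v) + INR q * v))).
{ intros q; rewrite plus_INR; f_equal; ring. }
apply (glogp_series_bounds r Y); try assumption.
apply Rmult_gt_compat_r with (r := v) in Hn; [|lra].
unfold Rdiv in Hn; rewrite Rmult_assoc, Rinv_l in Hn by lra; lra.
Qed.

(** * The logarithm of the generalized gamma function *)

(* [r psi_(r-1)(y) - log^r(y)], see [psi_RtoC]. *)
Definition phir (r : nat) (y : R) : R :=
  Series (fun j => logp r (y + INR j + 1) - logp r (y + INR j) - dlogp r (y + INR j)).

Definition phid (r : nat) (y : R) : R :=
  Series (fun j => dlogp r (y + INR j + 1) - dlogp r (y + INR j) + glogp r (y + INR j)).

Lemma ex_series_glogp_1 (r : nat) (y : R) :
  (0 < r)%nat -> ex_series (fun q => glogp r (y + INR q)).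
Proof.
intros Hr; apply (ex_series_ext (fun q => glogp r (y + INR q * 1))).
- intros q; now rewrite Rmult_1_r.
- apply ex_series_glogp; [exact Hr|lra].
Qed.

Lemma is_derive_shift (f : R -> R) (y c l : R) :
  is_derive f (y + c) l -> is_derive (fun y => f (y + c)) y l.
Proof.
intros H; evar_last;
  [apply (is_derive_comp f (fun y => y + c));
   [exact H|auto_derive; [easy|reflexivity]]|].
unfold scal; simpl; unfold mult; simpl; ring.
Qed.

Lemma ex_series_phir (r : nat) (y : R) : (0 < r)%nat -> 0 < y ->
  ex_series (fun j => logp r (y + INR j + 1) - logp r (y + INR j) - dlogp r (y + INR j)).
Proof.
intros Hr Hy; destruct (logp_tame r Hr) as [Y (HY & Hg & Hm & Hd & Hd0 & Hl & _)].
destruct (INR_unbounded Y) as [J HJ].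
apply (ex_series_dominated J _ (fun j => glogp r (y + INR j)));
  [|now apply ex_series_glogp_1].
intros n Hn; apply le_INR in Hn.
generalize (Hl (y + INR n) (y + INR n + 1)) (Hd (y + INR n) (y + INR n + 1)).
intros H1 H2; specialize (H1 ltac:(lra) ltac:(lra)).
specialize (H2 ltac:(lra) ltac:(lra)).
generalize (Hg (y + INR n) ltac:(lra)); intros; apply Rabs_le; lra.
Qed.

Lemma is_derive_phir (r : nat) (y : R) : (0 < r)%nat -> 0 < y ->
  is_derive (phir r) y (phid r y).
Proof.
intros Hr Hy; destruct (logp_tame r Hr) as [Y (HY & Hg & Hm & Hd & Hd0 & Hl & _)].
destruct (INR_unbounded Y) as [J HJ].
assert (Hy2 : 0 < y / 2) by lra.
apply (is_derive_Series
  (fun j y => logp r (y + INR j + 1) - logp r (y + INR j) - dlogp r (y + INR j))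
  (fun j y => dlogp r (y + INR j + 1) - dlogp r (y + INR j) + glogp r (y + INR j))
  (fun j => glogp r (INR j)) J y (mkposreal _ Hy2)).
- intros n z Hz; apply Rabs_def2 in Hz; simpl in Hz.
  assert (Hn := pos_INR n).
  replace (dlogp r (z + INR n + 1) - dlogp r (z + INR n) + glogp r (z + INR n))
    with (dlogp r (z + INR n + 1) - dlogp r (z + INR n) - (- glogp r (z + INR n)))
    by ring.
  apply (is_derive_minus (V := R_NormedModule) (fun z => logp r (z + INR n + 1) - logp r (z + INR n))).
  + apply (is_derive_minus (V := R_NormedModule) (fun z => logp r (z + INR n + 1))).
    * apply (is_derive_ext (fun z => logp r (z + (INR n + 1)))).
      { intros; f_equal; ring. }
      apply is_derive_shift.
      replace (z + (INR n + 1)) with (z + INR n + 1) by ring.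
      apply is_derive_logp; lra.
    * apply is_derive_shift, is_derive_logp; lra.
  + apply is_derive_shift, is_derive_dlogp; lra.
- intros z Hz; apply Rabs_def2 in Hz; simpl in Hz.
  apply ex_series_phir; [exact Hr|lra].
- intros n z Hn Hz; apply Rabs_def2 in Hz; simpl in Hz; apply le_INR in Hn.
  generalize (Hd (z + INR n) (z + INR n + 1) ltac:(lra) ltac:(lra)).
  generalize (Hg (z + INR n + 1) ltac:(lra)) (Hm (INR n) (z + INR n) ltac:(lra) ltac:(lra)).
  intros; apply Rabs_le; lra.
- apply (ex_series_ext (fun j => glogp r (0 + INR j))).
  + intros; now rewrite Rplus_0_l.
  + now apply ex_series_glogp_1.
Qed.

Lemma is_lim_seq_shift (y : R) : is_lim_seq (fun n => y + INR n) p_infty.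
Proof.
apply (is_lim_seq_ext (fun n => y + INR n * 1)).
- intros; now rewrite Rmult_1_r.
- apply is_lim_seq_affine; lra.
Qed.

(** The differences of [dlogp] telescope to [- dlogp r y], because [dlogp] vanishes at infinity.
    What remains is a sum of [glogp] along a ray, the inner sum of the future lattice sum. *)
Lemma phid_eq (r : nat) (y : R) : (0 < r)%nat ->
  phid r y = Series (fun q => glogp r (y + INR q)) - dlogp r y.
Proof.
intros Hr; apply is_series_unique, is_series_lsum.
apply (is_lim_seq_ext
  (fun N => lsum (seq 0 N) (fun q => glogp r (y + INR q))
            - (dlogp r y - dlogp r (y + INR N)))).
- intros N; rewrite lsum_plus.
  rewrite (lsum_ext _ (fun j => dlogp r (y + INR j + 1) - dlogp r (y + INR j))
     (fun j => dlogp r (y + INR (S j)) - dlogp r (y + INR j))).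
  + rewrite (lsum_telescope N (fun j => dlogp r (y + INR j))).
    simpl INR; rewrite Rplus_0_r; ring.
  + intros j _; rewrite S_INR; do 2 f_equal; ring.
- apply is_lim_seq_minus'.
  + now apply is_series_lsum, Series_correct, ex_series_glogp_1.
  + replace (Finite (dlogp r y)) with (Finite (dlogp r y - 0)) by (f_equal; ring).
    apply is_lim_seq_minus'; [apply is_lim_seq_const|].
    apply (is_lim_seq_comp_p_infty (dlogp r)); [apply is_lim_dlogp|].
    apply is_lim_seq_shift.
Qed.

(** Telescoping bounds [phir r y] by [dlogp r y]. The weaker form [2 * y * glogp r y] is chosen
    because at the argument [n y], after division by [n], it leaves the summable
    [2 * y * glogp r (n y)]. *)
Lemma phi_bounds (r : nat) : (0 < r)%nat ->
  exists Y, 1 <= Y /\ (forall y z, Y <= y -> y <= z -> glogp r z <= glogp r y) /\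
    forall y, Y <= y ->
    Rabs (phir r y) <= 2 * y * glogp r y /\ Rabs (phid r y) <= glogp r y.
Proof.
intros Hr; destruct (logp_tame r Hr) as [Y (HY & Hg & Hm & Hd & Hd0 & Hl & Hb)].
exists Y; do 2 (split; [assumption|]); intros y Hy; split.
- apply Rle_trans with (2 := Hb y Hy).
  assert (Ht : is_series (fun j => dlogp r (y + INR j) - dlogp r (y + INR j + 1))
     (dlogp r y)).
  { apply is_series_lsum.
    apply (is_lim_seq_ext (fun N => dlogp r y - dlogp r (y + INR N))).
    - intros N.
      rewrite (lsum_ext _ (fun j => dlogp r (y + INR j) - dlogp r (y + INR j + 1))
       (fun j => (-1) * (dlogp r (y + INR (S j)) - dlogp r (y + INR j)))).
      + rewrite lsum_scal, (lsum_telescope N (fun j => dlogp r (y + INR j))).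
        simpl INR; rewrite Rplus_0_r; ring.
      + intros j _; rewrite S_INR, <- Rplus_assoc; ring.
    - replace (Finite (dlogp r y)) with (Finite (dlogp r y - 0)) by (f_equal; ring).
      apply is_lim_seq_minus'; [apply is_lim_seq_const|].
      apply (is_lim_seq_comp_p_infty (dlogp r)); [apply is_lim_dlogp|].
      apply is_lim_seq_shift. }
  rewrite <- (is_series_unique _ _ Ht); unfold phir.
  assert (Hj : forall j,
    Rabs (logp r (y + INR j + 1) - logp r (y + INR j) - dlogp r (y + INR j))
    <= dlogp r (y + INR j) - dlogp r (y + INR j + 1)).
  { intros j; assert (Hj := pos_INR j).
    generalize (Hl (y + INR j) (y + INR j + 1) ltac:(lra) ltac:(lra)).
    intros; apply Rabs_le; lra. }
  eapply Rle_trans; [apply Series_Rabs|].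
  + apply (ex_series_dominated 0 _
      (fun j => dlogp r (y + INR j) - dlogp r (y + INR j + 1)));
      [|eexists; exact Ht].
    intros j _; rewrite Rabs_Rabsolu; apply Hj.
  + apply Series_le; [|eexists; exact Ht].
    intros j; split; [apply Rabs_pos|apply Hj].
- rewrite phid_eq by exact Hr.
  destruct (glogp_series_bounds r Y y 1) as [_ H]; try assumption; [lra|].
  rewrite (Series_ext _ (fun q => glogp r (y + INR q))) in H
    by (intros; now rewrite Rmult_1_r).
  apply Rabs_le; rewrite Rdiv_1_r in H; generalize (Hg y Hy); lra.
Qed.

Definition lgam_term (r n : nat) (x : R) : R :=
  ((logp r (INR (S n)) - logp r (INR n)) * x
   + logp r (INR (S n)) - logp r (x + INR (S n))) / INR r.

Definition lgam_term' (r n : nat) (x : R) : R :=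
  (logp r (INR (S n)) - logp r (INR n) - dlogp r (x + INR (S n))) / INR r.

(* The logarithm of Dilcher's [Gamma_(r-1)], with its defining limit written as a
   telescoping series. *)
Definition lgam (r : nat) (x : R) : R :=
  - logp r x / INR r + Series (fun n => lgam_term r n x).

(** Up to the factor [1 / r], the term compares [y] times the increment of [logp] over a unit step
    with its increment over the next step, of length [y]. Both lie between values of [y * dlogp] on
    an interval of length [1 + y], so they differ by at most [y * (1 + y) * glogp]. *)
Lemma lgam_term_bounds (r : nat) : (0 < r)%nat ->
  exists J, forall n y, (J <= n)%nat -> 0 < y ->
    Rabs (lgam_term r n y) <= y * (1 + y) / INR r * glogp r (INR n) /\
    Rabs (lgam_term' r n y) <= (1 + y) / INR r * glogp r (INR n).
Proof.
intros Hr; destruct (logp_tame r Hr) as [Y (HY & Hg & Hm & Hd & Hd0 & Hl & _)].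
destruct (INR_unbounded Y) as [J HJ].
assert (Hr0 : 0 < INR r) by (apply lt_0_INR; lia).
assert (Hir : 0 < / INR r) by now apply Rinv_0_lt_compat.
exists J; intros n y Hn Hy; apply le_INR in Hn.
unfold lgam_term, lgam_term'; rewrite S_INR; set (m := INR n) in *.
generalize (Hl m (m + 1) ltac:(lra) ltac:(lra))
  (Hl (m + 1) (y + (m + 1)) ltac:(lra) ltac:(lra))
  (Hd m (y + (m + 1)) ltac:(lra) ltac:(lra))
  (Hd (m + 1) (y + (m + 1)) ltac:(lra) ltac:(lra))
  (Hg (y + (m + 1)) ltac:(lra)) (Hg m ltac:(lra)).
intros H1 H2 H3 H4 H5 H6.
replace (m + 1 - m) with 1 in H1 by ring.
replace (y + (m + 1) - (m + 1)) with y in * by ring.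
replace (y + (m + 1) - m) with (1 + y) in H3 by ring.
assert (H7 : dlogp r (y + (m + 1)) <= dlogp r (m + 1)) by nra.
assert (Hy1 : y * dlogp r (m + 1) <= y * (logp r (m + 1) - logp r m) <= y * dlogp r m)
  by (split; apply Rmult_le_compat_l; lra).
assert (Hy2 : y * (dlogp r m - dlogp r (y + (m + 1))) <= y * ((1 + y) * glogp r m))
  by (apply Rmult_le_compat_l; lra).
assert (Hk : forall a b, 0 <= a <= b -> Rabs (a / INR r) <= b / INR r).
{ intros a b Hab; unfold Rdiv; rewrite Rabs_mult, !Rabs_right by lra.
  apply Rmult_le_compat_r; lra. }
split.
- replace (y * (1 + y) / INR r * glogp r m)
    with ((y * (1 + y) * glogp r m) / INR r) by (field; lra).
  apply Hk; lra.
- replace ((1 + y) / INR r * glogp r m)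
    with (((1 + y) * glogp r m) / INR r) by (field; lra).
  apply Hk; lra.
Qed.

Lemma ex_series_lgam (r : nat) (x : R) : (0 < r)%nat -> 0 < x ->
  ex_series (fun n => lgam_term r n x).
Proof.
intros Hr Hx; destruct (lgam_term_bounds r Hr) as [J HJ].
apply (ex_series_dominated J _ (fun n => x * (1 + x) / INR r * glogp r (0 + INR n))).
- intros n Hn; rewrite Rplus_0_l; now apply HJ.
- apply (ex_series_scal_l (V := R_NormedModule)).
  now apply ex_series_glogp_1.
Qed.

Lemma lim_logp_shift (r : nat) (x : R) : (0 < r)%nat -> 0 <= x ->
  is_lim_seq (fun n => logp r (INR n + x) - logp r (INR n)) 0.
Proof.
intros Hr Hx; destruct (logp_tame r Hr) as [Y (HY & Hg & Hm & Hd & Hd0 & Hl & _)].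
destruct (INR_unbounded Y) as [J HJ].
apply (is_lim_seq_le_le_loc (fun _ => 0) _ (fun n => x * dlogp r (0 + INR n))).
- exists J; intros n Hn; apply le_INR in Hn; rewrite Rplus_0_l.
  generalize (Hl (INR n) (INR n + x) ltac:(lra) ltac:(lra)) (Hd0 (INR n + x) ltac:(lra)).
  replace (INR n + x - INR n) with x by ring; nra.
- apply is_lim_seq_const.
- replace (Finite 0) with (Finite (x * 0)) by (f_equal; ring).
  apply is_lim_seq_mult_l, (is_lim_seq_comp_p_infty (dlogp r)); [apply is_lim_dlogp|].
  apply is_lim_seq_shift.
Qed.

Lemma is_derive_lgam (r : nat) (x : R) : (0 < r)%nat -> 0 < x ->
  is_derive (lgam r) x ((logp r x + phir r x) / INR r).
Proof.
intros Hr Hx; destruct (lgam_term_bounds r Hr) as [J HJ].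
assert (Hr0 : 0 < INR r) by (apply lt_0_INR; lia).
assert (Hir : 0 < / INR r) by now apply Rinv_0_lt_compat.
assert (Hx2 : 0 < x / 2) by lra.
assert (HS : is_derive (fun y => Series (fun n => lgam_term r n y)) x
               (Series (fun n => lgam_term' r n x))).
{ apply (is_derive_Series _ (lgam_term' r)
    (fun n => (1 + 2 * x) / INR r * glogp r (0 + INR n)) (Nat.max J 1) x
    (mkposreal _ Hx2)).
  - intros n y Hy; apply Rabs_def2 in Hy; simpl in Hy.
    assert (H0 := lt_0_INR (S n) ltac:(lia)).
    assert (E := is_derive_logp r (y + INR (S n)) ltac:(lra)).
    apply (is_derive_shift (logp r)) in E.
    unfold lgam_term, lgam_term'.
    set (a := logp r (INR (S n))); set (b := logp r (INR n)).
    apply (is_derive_ext (fun y => / INR r * ((a - b) * y + a - logp r (y + INR (S n))))).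
    { intros; unfold Rdiv; apply Rmult_comm. }
    replace ((a - b - dlogp r (y + INR (S n))) / INR r)
      with (scal (/ INR r) (a - b - dlogp r (y + INR (S n))))
      by (unfold scal; simpl; unfold mult; simpl; field; lra).
    apply is_derive_scal.
    apply (is_derive_minus (V := R_NormedModule) (fun y => (a - b) * y + a)); [|exact E].
    auto_derive; [easy|ring].
  - intros y Hy; apply Rabs_def2 in Hy; simpl in Hy.
    apply ex_series_lgam; [exact Hr|lra].
  - intros n y Hn Hy; apply Rabs_def2 in Hy; simpl in Hy.
    rewrite Rplus_0_l.
    destruct (HJ n y ltac:(lia) ltac:(lra)) as [_ H].
    eapply Rle_trans; [exact H|].
    assert (0 <= (1 + y) / INR r * glogp r (INR n))
      by (eapply Rle_trans; [apply Rabs_pos|exact H]).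
    assert (0 < (1 + y) / INR r) by (apply Rdiv_lt_0_compat; lra).
    apply Rmult_le_compat_r; [nra|].
    apply Rmult_le_compat_r; lra.
  - apply (ex_series_scal_l (V := R_NormedModule)).
    now apply ex_series_glogp_1. }
(* The partial sums on the two sides differ by boundary terms only. Those at [x] give
   [logp r x + dlogp r x], both to be accounted for by the derivative of [lgam]; the one at [N]
   vanishes in the limit by [lim_logp_shift]. *)
assert (HE : Series (fun n => lgam_term' r n x)
             = (phir r x + logp r x + dlogp r x) / INR r).
{ apply is_series_unique, is_series_lsum.
  apply (is_lim_seq_ext (fun N =>
    (lsum (seq 0 (S N)) (fun j => logp r (x + INR j + 1) - logp r (x + INR j)
        - dlogp r (x + INR j)) + logp r x + dlogp r x
     - (logp r (INR N + (x + 1)) - logp r (INR N))) * / INR r)).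
  - intros N.
    rewrite (lsum_ext _ (fun n => lgam_term' r n x)
      (fun n => / INR r * (logp r (INR (S n)) - logp r (INR n)
                           - dlogp r (x + INR (S n)))))
      by (intros; unfold lgam_term'; field; lra).
    rewrite lsum_scal, Rmult_comm; f_equal.
    rewrite !lsum_minus, <- (lsum_minus (seq 0 N)).
    rewrite (lsum_telescope N (fun n => logp r (INR n))).
    rewrite <- lsum_minus.
    rewrite (lsum_ext (seq 0 (S N)) (fun a => logp r (x + INR a + 1) - logp r (x + INR a))
      (fun a => logp r (x + INR (S a)) - logp r (x + INR a)))
      by (intros; rewrite S_INR; do 2 f_equal; ring).
    rewrite (lsum_telescope (S N) (fun n => logp r (x + INR n))).
    change (seq 0 (S N)) with (0%nat :: seq (0 + 1) N).
    change (lsum (0%nat :: seq (0 + 1) N) ?f) with (f 0%nat + lsum (seq (0 + 1) N) f).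
    rewrite lsum_seq_shift.
    rewrite (lsum_ext (seq 0 N) (fun i => dlogp r (x + INR (i + 1)))
      (fun i => dlogp r (x + INR (S i)))) by (intros; now rewrite Nat.add_1_r).
    rewrite !S_INR; simpl INR; rewrite !Rplus_0_r.
    replace (INR N + (x + 1)) with (x + (INR N + 1)) by ring.
    (* The lower end of the telescoping sum is [ln 0 ^ r], which is 0 because [ln] takes the default
       value 0 there and [r] is positive. *)
    replace (logp r 0) with 0; [ring|].
    unfold logp, ln; destruct (Rlt_dec 0 0) as [H0|_]; [exfalso; lra|].
    rewrite pow_ne_zero by lia; easy.
  - unfold Rdiv; apply is_lim_seq_mult_r.
    replace (phir r x + logp r x + dlogp r x)
      with (phir r x + logp r x + dlogp r x - 0) by ring.
    apply is_lim_seq_minus'; [|apply lim_logp_shift; [exact Hr|lra]].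
    apply is_lim_seq_plus'; [|apply is_lim_seq_const].
    apply is_lim_seq_plus'; [|apply is_lim_seq_const].
    apply (is_lim_seq_incr_1 (fun N => lsum (seq 0 N) _)).
    now apply is_series_lsum, Series_correct, ex_series_phir. }
evar_last; [apply (is_derive_plus (V := R_NormedModule) (fun x => - logp r x / INR r));
  [|exact HS]|].
- apply (is_derive_ext (fun x => - / INR r * logp r x)).
  { intros; simpl; field; lra. }
  apply (is_derive_scal (logp r)); now apply is_derive_logp.
- rewrite HE; unfold plus, scal; simpl; unfold mult; simpl; field; lra.
Qed.

(** * The Herglotz-Zagier functions on the positive reals *)

Lemma Cexp_RtoC (a : R) : Cexp (RtoC a) = RtoC (exp a).
Proof.
unfold Cexp, RtoC; simpl; rewrite cos_0, sin_0; f_equal; ring.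
Qed.

Lemma Clog_RtoC (y : R) : 0 < y -> Clog (RtoC y) = RtoC (ln y).
Proof.
intros Hy; unfold Clog, Carg; rewrite Cmod_R, Rabs_right by lra.
rewrite im_RtoC; unfold Rdiv; rewrite Rmult_0_l, atan_0, Rmult_0_r; easy.
Qed.

(* [C_derive] takes its limit along the horizontal line, so only real points enter. *)
Lemma C_derive_RtoC (f : C -> C) (g : R -> R) (x l : R) :
  0 < x -> (forall y, 0 < y -> f (RtoC y) = RtoC (g y)) ->
  is_derive g x l -> C_derive f (RtoC x) = RtoC l.
Proof.
intros Hx Hf Hg; unfold C_derive, C_lim.
change (fst (RtoC x)) with x; change (snd (RtoC x)) with 0.
assert (E : forall y, 0 < y -> y <> x ->
  ((f (y, 0) - f (RtoC x)) / ((y, 0) - RtoC x))%C = RtoC ((g y - g x) / (y - x))).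
{ intros y Hy Hyx; change (y, 0) with (RtoC y).
  rewrite !Hf by assumption; rewrite <- !RtoC_minus, <- RtoC_div; [easy|lra]. }
assert (Hloc : Rbar_locally' x (fun y => 0 < y /\ y <> x)).
{ exists (mkposreal x Hx); intros y Hy Hne; split; [|exact Hne].
  apply Rabs_def2 in Hy; unfold minus, plus, opp in Hy; simpl in Hy; lra. }
assert (Hl : is_lim (fun y => (g y - g x) / (y - x)) x l).
{ apply is_derive_Reals in Hg; apply is_lim_spec; intros eps.
  destruct (Hg eps (cond_pos eps)) as [d Hd]; exists d; intros y Hy Hne.
  specialize (Hd (y - x) ltac:(lra)).
  rewrite Rplus_minus in Hd; apply Hd.
  apply Hy. }
change (RtoC l) with (l, 0); f_equal.
- rewrite (Lim_ext_loc (fun y => (g y - g x) / (y - x))).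
  + rewrite (is_lim_unique _ _ _ Hl). reflexivity.
  + revert Hloc; apply filter_imp; intros y [Hy Hne]; now rewrite E.
- rewrite (Lim_ext_loc (fun y => 0)).
  + now rewrite Lim_const.
  + revert Hloc; apply filter_imp; intros y [Hy Hne]; now rewrite E.
Qed.

Lemma Cprod_RtoC_exp (l : list nat) (f : nat -> C) (g : nat -> R) :
  (forall j, In j l -> f j = RtoC (exp (g j))) ->
  Cprod l f = RtoC (exp (lsum l g)).
Proof.
induction l as [|j l IH]; intros H.
- unfold Cprod, lsum; simpl; now rewrite exp_0.
- change (Cprod (j :: l) f) with (f j * Cprod l f)%C.
  rewrite H by now left.
  rewrite IH by (intros; apply H; now right).
  change (lsum (j :: l) g) with (g j + lsum l g).
  now rewrite exp_plus, RtoC_mult.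
Qed.

Lemma Gamma_seq_RtoC (k N : nat) (x : R) : 0 < x ->
  Gamma_seq k (RtoC x) N =
  RtoC (exp (- logp (S k) x / INR (S k) + lsum (seq 0 N) (fun n => lgam_term (S k) n x))).
Proof.
intros Hx; unfold Gamma_seq.
assert (Hk0 : 0 < INR (S k)) by (apply lt_0_INR; lia).
rewrite !Nat.add_1_r.
rewrite <- RtoC_mult, Cexp_RtoC.
rewrite (Cprod_RtoC_exp (seq 1 N) _ (fun j => logp (S k) (INR j) / INR (S k)))
  by (intros; apply Cexp_RtoC).
rewrite (Cprod_RtoC_exp _ _ (fun j => logp (S k) (x + INR j) / INR (S k))).
2:{ intros j _; rewrite <- RtoC_plus, Clog_RtoC by (generalize (pos_INR j); lra).
    rewrite <- RtoC_pow, <- RtoC_div, Cexp_RtoC by lra.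
    unfold logp; do 5 f_equal; ring. }
rewrite <- RtoC_mult, <- RtoC_div by (apply Rgt_not_eq, exp_pos).
f_equal; rewrite <- exp_plus; unfold Rdiv at 1; rewrite <- exp_Ropp, <- exp_plus.
f_equal.
rewrite (lsum_ext _ (fun n => lgam_term (S k) n x) (fun n => / INR (S k) *
  ((logp (S k) (INR (S n)) - logp (S k) (INR n)) * x
   + logp (S k) (INR (S n)) - logp (S k) (x + INR (S n)))))
  by (intros; unfold lgam_term, Rdiv; apply Rmult_comm).
rewrite (lsum_ext _ (fun j => logp (S k) (INR j) / INR (S k))
  (fun j => / INR (S k) * logp (S k) (INR j)))
  by (intros; unfold Rdiv; apply Rmult_comm).
rewrite (lsum_ext _ (fun j => logp (S k) (x + INR j) / INR (S k))
  (fun j => / INR (S k) * logp (S k) (x + INR j)))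
  by (intros; unfold Rdiv; apply Rmult_comm).
rewrite !lsum_scal, lsum_minus, lsum_plus.
rewrite (lsum_ext _ (fun a => (logp (S k) (INR (S a)) - logp (S k) (INR a)) * x)
  (fun a => x * (logp (S k) (INR (S a)) - logp (S k) (INR a))))
  by (intros; apply Rmult_comm).
rewrite lsum_scal, (lsum_telescope N (fun a => logp (S k) (INR a))).
(* The denominator has one factor more than the numerator's product; its factor at [j = 0] supplies
   [- logp (S k) x]. *)
change (seq 0 (S N)) with (0%nat :: seq (0 + 1) N).
change (seq 1 N) with (seq (0 + 1) N).
change (lsum (0%nat :: seq (0 + 1) N) ?f) with (f 0%nat + lsum (seq (0 + 1) N) f).
rewrite (lsum_seq_shift 0 N 1 (fun j => logp (S k) (x + INR j))).
rewrite (lsum_seq_shift 0 N 1 (fun j => logp (S k) (INR j))).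
rewrite (lsum_ext (seq 0 N) (fun i => logp (S k) (x + INR (i + 1)))
   (fun i => logp (S k) (x + INR (S i)))) by (intros; now rewrite Nat.add_1_r).
rewrite (lsum_ext (seq 0 N) (fun i => logp (S k) (INR (i + 1)))
   (fun i => logp (S k) (INR (S i)))) by (intros; now rewrite Nat.add_1_r).
replace (logp (S k) (INR 0)) with 0.
2:{ unfold logp, ln; simpl INR; destruct (Rlt_dec 0 0) as [H0|_]; [exfalso; lra|].
    rewrite pow_ne_zero by lia; easy. }
simpl (INR 0); rewrite Rplus_0_r.
change (ln (INR N) ^ S k) with (logp (S k) (INR N)); field; lra.
Qed.

Lemma DGamma_RtoC (k : nat) (x : R) : 0 < x ->
  DGamma k (RtoC x) = RtoC (exp (lgam (S k) x)).
Proof.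
intros Hx; unfold DGamma, CLim_seq.
change (RtoC (exp (lgam (S k) x))) with (exp (lgam (S k) x), 0).
assert (H : is_lim_seq (fun N => - logp (S k) x / INR (S k)
  + lsum (seq 0 N) (fun n => lgam_term (S k) n x)) (lgam (S k) x)).
{ apply is_lim_seq_plus'; [apply is_lim_seq_const|].
  apply is_series_lsum, Series_correct, ex_series_lgam; [lia|exact Hx]. }
f_equal.
- rewrite (Lim_seq_ext _ (fun N => exp (- logp (S k) x / INR (S k)
    + lsum (seq 0 N) (fun n => lgam_term (S k) n x))))
    by (intros; now rewrite Gamma_seq_RtoC).
  rewrite (is_lim_seq_unique _ (exp (lgam (S k) x))); [easy|].
  apply (is_lim_seq_continuous exp); [|exact H].
  apply derivable_continuous_pt, derivable_pt_exp.
- rewrite (Lim_seq_ext _ (fun N => 0)).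
  + now rewrite Lim_seq_const.
  + intros; now rewrite Gamma_seq_RtoC.
Qed.

Lemma psi_RtoC (k : nat) (x : R) : 0 < x ->
  psi k (RtoC x) = RtoC ((logp (S k) x + phir (S k) x) / INR (S k)).
Proof.
intros Hx; unfold psi.
rewrite (C_derive_RtoC _ (fun y => exp (lgam (S k) y)) x
  ((logp (S k) x + phir (S k) x) / INR (S k) * exp (lgam (S k) x))).
- rewrite DGamma_RtoC by exact Hx.
  rewrite <- RtoC_div by (apply Rgt_not_eq, exp_pos); f_equal; field.
  split; [apply Rgt_not_eq, lt_0_INR; lia|apply Rgt_not_eq, exp_pos].
- exact Hx.
- intros y Hy; now apply DGamma_RtoC.
- apply (is_derive_comp exp (lgam (S k))).
  + apply is_derive_Reals, derivable_pt_lim_exp.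
  + apply is_derive_lgam; [lia|exact Hx].
Qed.

Lemma Phi_RtoC (r : nat) (x : R) : (0 < r)%nat -> 0 < x ->
  Phi r (RtoC x) =
  RtoC (Series (fun m => phir r (INR (m + 1) * x) / INR (m + 1))).
Proof.
intros Hr Hx; unfold Phi, CSeries.
change (RtoC (Series ?f)) with (Series f, 0).
assert (E : forall m,
  ((RtoC (INR r) * psi (r - 1) (RtoC (INR (m + 1)) * RtoC x)
    - Clog (RtoC (INR (m + 1)) * RtoC x) ^ r) / RtoC (INR (m + 1)))%C
  = RtoC (phir r (INR (m + 1) * x) / INR (m + 1))).
{ intros m; assert (H : 0 < INR (m + 1)) by (apply lt_0_INR; lia).
  assert (H' : 0 < INR (m + 1) * x) by nra.
  rewrite <- RtoC_mult, psi_RtoC, Clog_RtoC by exact H'.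
  replace (S (r - 1)) with r by lia.
  rewrite <- RtoC_pow, <- RtoC_mult, <- RtoC_minus, <- RtoC_div by lra.
  unfold logp; do 2 f_equal; field; apply Rgt_not_eq, lt_0_INR, Hr. }
f_equal.
- apply Series_ext; intros m; now rewrite E.
- rewrite (Series_ext _ (fun m => 0 * 0)).
  + rewrite Series_scal_l; ring.
  + intros m; rewrite E; simpl; ring.
Qed.

(** The termwise derivative of [Phi r]: the chain rule factor [m + 1] cancels the weight
    [1 / (m + 1)]. *)
Definition dphi (r : nat) (x : R) : R := Series (fun m => phid r (INR (m + 1) * x)).

Lemma ex_series_dphi (r : nat) (x : R) : (0 < r)%nat -> 0 < x ->
  ex_series (fun m => phid r (INR (m + 1) * x)).
Proof.
intros Hr Hx; destruct (phi_bounds r Hr) as [Y (HY & Hm & HB)].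
destruct (INR_unbounded (Y / x)) as [J HJ].
apply (ex_series_dominated J _ (fun m => glogp r (x + INR m * x)));
  [|now apply ex_series_glogp].
intros n Hn; apply le_INR in Hn.
assert (Y <= INR n * x).
{ apply Rmult_le_reg_r with (/ x); [now apply Rinv_0_lt_compat|].
  rewrite Rmult_assoc, Rinv_r by lra; unfold Rdiv in HJ; lra. }
rewrite plus_INR; simpl INR.
replace (x + INR n * x) with ((INR n + 1) * x) by ring.
apply HB; lra.
Qed.

Lemma is_derive_Phi (r : nat) (x : R) : (0 < r)%nat -> 0 < x ->
  is_derive (fun x => Series (fun m => phir r (INR (m + 1) * x) / INR (m + 1))) x
    (dphi r x).
Proof.
intros Hr Hx; destruct (phi_bounds r Hr) as [Y (HY & Hm & HB)].
(* On the neighbourhood of radius [x / 2] the arguments stay above the multiples of [x / 2], so the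
   monotone [glogp] at those multiples dominates uniformly. *)
assert (Hx2 : 0 < x / 2) by lra.
assert (Hbig : exists J, forall n y, (J <= n)%nat -> x / 2 <= y ->
  Y <= INR (n + 1) * (x / 2) <= INR (n + 1) * y).
{ destruct (INR_unbounded (Y / (x / 2))) as [J HJ].
  exists J; intros n y Hn Hy; apply le_INR in Hn.
  rewrite plus_INR; simpl INR; assert (H0 := pos_INR n).
  assert (Y <= INR n * (x / 2)).
  { apply Rmult_le_reg_r with (/ (x / 2)); [now apply Rinv_0_lt_compat|].
    rewrite Rmult_assoc, Rinv_r by lra; unfold Rdiv at 1 in HJ; lra. }
  split; [lra|]; apply Rmult_le_compat_l; lra. }
destruct Hbig as [J HJ].
assert (EM : forall y, 0 < y -> ex_series (fun m => glogp r (INR (m + 1) * y))).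
{ intros y Hy; apply (ex_series_ext (fun m => glogp r (y + INR m * y))).
  - intros m; rewrite plus_INR; simpl INR; f_equal; ring.
  - now apply ex_series_glogp. }
apply (is_derive_Series _ (fun m x => phid r (INR (m + 1) * x))
  (fun m => glogp r (INR (m + 1) * (x / 2))) J x (mkposreal _ Hx2)).
- intros n y Hy; apply Rabs_def2 in Hy; simpl in Hy.
  assert (Hn : 0 < INR (n + 1)) by (apply lt_0_INR; lia).
  apply (is_derive_ext (fun y => / INR (n + 1) * phir r (INR (n + 1) * y))).
  { intros; unfold Rdiv; apply Rmult_comm. }
  assert (H : is_derive (fun y => phir r (INR (n + 1) * y)) y
    (INR (n + 1) * phid r (INR (n + 1) * y))).
  { apply (is_derive_comp (phir r) (fun y => INR (n + 1) * y)).
    - apply is_derive_phir; [exact Hr|]; apply Rmult_lt_0_compat; lra.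
    - auto_derive; [easy|ring]. }
  apply (is_derive_scal _ _ (/ INR (n + 1))) in H.
  rewrite <- Rmult_assoc, Rinv_l, Rmult_1_l in H by lra; exact H.
- intros y Hy; apply Rabs_def2 in Hy; simpl in Hy.
  apply (ex_series_dominated J _ (fun m => 2 * y * glogp r (INR (m + 1) * y))).
  + intros n Hn; specialize (HJ n y Hn ltac:(lra)).
    assert (H0 : 0 < INR (n + 1)) by (apply lt_0_INR; lia).
    destruct (HB (INR (n + 1) * y) ltac:(lra)) as [H _].
    unfold Rdiv; rewrite Rabs_mult, (Rabs_right (/ INR (n + 1)))
      by (apply Rle_ge, Rlt_le, Rinv_0_lt_compat; lra).
    apply Rmult_le_reg_r with (INR (n + 1)); [lra|].
    rewrite Rmult_assoc, Rinv_l, Rmult_1_r by lra; lra.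
  + apply (ex_series_scal_l (V := R_NormedModule)), EM; lra.
- intros n y Hn Hy; apply Rabs_def2 in Hy; simpl in Hy.
  specialize (HJ n y Hn ltac:(lra)).
  eapply Rle_trans; [apply HB; lra|]; apply Hm; lra.
- apply EM; lra.
Qed.

Lemma dPhi_RtoC (r : nat) (x : R) : (0 < r)%nat -> 0 < x ->
  dPhi r x = RtoC (dphi r x).
Proof.
intros Hr Hx; unfold dPhi.
apply (C_derive_RtoC _
  (fun x => Series (fun m => phir r (INR (m + 1) * x) / INR (m + 1)))); [exact Hx| |].
- intros y Hy; now apply Phi_RtoC.
- now apply is_derive_Phi.
Qed.

(** * Collapsing the binomial sums *)

Lemma is_derive_lsum {A : Type} (l : list A) (f f' : A -> R -> R) (y : R) :
  (forall a, In a l -> is_derive (f a) y (f' a y)) ->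
  is_derive (fun y => lsum l (fun a => f a y)) y (lsum l (fun a => f' a y)).
Proof.
induction l as [|a l IH]; intros H.
- apply (is_derive_const (V := R_NormedModule) 0).
- apply (is_derive_plus (V := R_NormedModule) (f a)).
  + apply H; now left.
  + apply IH; intros b Hb; apply H; now right.
Qed.

Lemma derive_eq_pos (f g : R -> R) (y a b : R) :
  0 < y -> (forall z, 0 < z -> f z = g z) ->
  is_derive f y a -> is_derive g y b -> a = b.
Proof.
intros Hy H Ha Hb.
apply (is_derive_ext_loc f g) in Ha.
- now rewrite <- (is_derive_unique _ _ _ Ha), <- (is_derive_unique _ _ _ Hb).
- exists (mkposreal y Hy); intros z Hz; apply H.
  apply Rabs_def2 in Hz; unfold minus, plus, opp in Hz; simpl in Hz; lra.
Qed.

Lemma is_derive_dilate (f : R -> R) (c y l : R) :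
  is_derive f (c * y) l -> is_derive (fun y => f (c * y)) y (c * l).
Proof.
intros H; apply (is_derive_comp f (fun y => c * y)); [exact H|].
auto_derive; [easy|ring].
Qed.

Lemma logp_scale (k : nat) (v y : R) : 0 < v -> 0 < y ->
  lsum (seq 0 (S k)) (fun r => Binomial.C k r * ln v ^ (k - r) * logp r y)
  = logp k (v * y).
Proof.
intros Hv Hy; unfold logp; rewrite ln_mult, Rplus_comm, binomial, lsum_sum_f_R0 by lra.
apply lsum_ext; intros r _; ring.
Qed.

Lemma lsum_seq_0 (k : nat) (f : nat -> R) :
  f 0%nat = 0 -> lsum (seq 0 (S k)) f = lsum (seq 1 k) f.
Proof.
intros H; change (lsum (seq 0 (S k)) f) with (f 0%nat + lsum (seq 1 k) f).
rewrite H; ring.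
Qed.

(** Obtained by differentiating [logp_scale] in [y] instead of manipulating binomial coefficients;
    [glogp_scale] differentiates once more. The term [r = 0] is constant in [y] and drops out, which
    is why the sums of the theorem start at 1. *)
Lemma dlogp_scale (k : nat) (v y : R) : 0 < v -> 0 < y ->
  lsum (seq 1 k) (fun r => Binomial.C k r * ln v ^ (k - r) * dlogp r y)
  = v * dlogp k (v * y).
Proof.
intros Hv Hy.
rewrite <- lsum_seq_0 by (unfold dlogp, Rdiv; simpl INR; ring).
apply (derive_eq_pos
  (fun y => lsum (seq 0 (S k)) (fun r => Binomial.C k r * ln v ^ (k - r) * logp r y))
  (fun y => logp k (v * y)) y); [exact Hy| | |].
- intros z Hz; now apply logp_scale.
- apply (is_derive_lsum _ (fun r y => Binomial.C k r * ln v ^ (k - r) * logp r y)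
    (fun r y => Binomial.C k r * ln v ^ (k - r) * dlogp r y)).
  intros r _; apply (is_derive_scal (logp r)); now apply is_derive_logp.
- apply is_derive_dilate, is_derive_logp, Rmult_lt_0_compat; lra.
Qed.

Lemma glogp_scale (k : nat) (v y : R) : 0 < v -> 0 < y ->
  lsum (seq 1 k) (fun r => Binomial.C k r * ln v ^ (k - r) * glogp r y)
  = v ^ 2 * glogp k (v * y).
Proof.
intros Hv Hy.
apply Ropp_eq_reg.
replace (- (v ^ 2 * glogp k (v * y))) with (v * (v * - glogp k (v * y))) by ring.
replace (- lsum (seq 1 k) (fun r => Binomial.C k r * ln v ^ (k - r) * glogp r y))
 with (lsum (seq 1 k) (fun r => Binomial.C k r * ln v ^ (k - r) * - glogp r y)).
2:{ rewrite (lsum_ext _ _ (fun r => (-1) * (Binomial.C k r * ln v ^ (k - r) * glogp r y)))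
      by (intros; ring).
    rewrite lsum_scal; ring. }
apply (derive_eq_pos
  (fun y => lsum (seq 1 k) (fun r => Binomial.C k r * ln v ^ (k - r) * dlogp r y))
  (fun y => v * dlogp k (v * y)) y); [exact Hy| | |].
- intros z Hz; now apply dlogp_scale.
- apply (is_derive_lsum _ (fun r y => Binomial.C k r * ln v ^ (k - r) * dlogp r y)
    (fun r y => Binomial.C k r * ln v ^ (k - r) * - glogp r y)).
  intros r _; apply (is_derive_scal (dlogp r)); now apply is_derive_dlogp.
- apply is_derive_scal, is_derive_dilate, is_derive_dlogp, Rmult_lt_0_compat; lra.
Qed.

(** One row of a cone: with [y = p u], the arguments [p u + q v] for fixed [p] and all [q >= 0]. *)
Definition gray (k : nat) (v y : R) : R := Series (fun q => glogp k (y + INR q * v)).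

(** Passing from unit steps at [y / v] to steps [v] at [y], the binomial sum of [glogp] gains
    [v ^ 2] and that of [dlogp] gains [v]. Against the weight [1 / v ^ 2] this leaves a whole row
    and [dlogp k y / v]. *)
Lemma phid_scale (k : nat) (v y : R) : (0 < k)%nat -> 0 < v -> 0 < y ->
  lsum (seq 1 k) (fun r => Binomial.C k r * (ln v ^ (k - r) / v ^ 2) * phid r (y / v))
  = gray k v y - dlogp k y / v.
Proof.
intros Hk Hv Hy.
assert (Hyv : 0 < y / v) by now apply Rdiv_lt_0_compat.
rewrite (lsum_ext _ _ (fun r => / v ^ 2 *
  (Binomial.C k r * ln v ^ (k - r) * Series (fun q => glogp r (y / v + INR q))
   - Binomial.C k r * ln v ^ (k - r) * dlogp r (y / v)))).
2:{ intros r Hr; apply in_seq in Hr; rewrite phid_eq by lia; unfold Rdiv; ring. }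
rewrite lsum_scal, lsum_minus, dlogp_scale by assumption.
replace (v * (y / v)) with y by (field; lra).
assert (H : is_series (fun q => lsum (seq 1 k) (fun r =>
   Binomial.C k r * ln v ^ (k - r) * glogp r (y / v + INR q)))
   (lsum (seq 1 k) (fun r => Binomial.C k r * ln v ^ (k - r)
     * Series (fun q => glogp r (y / v + INR q))))).
{ apply (is_series_Rlsum _
    (fun r q => Binomial.C k r * ln v ^ (k - r) * glogp r (y / v + INR q))).
  intros r Hr; apply in_seq in Hr.
  apply (is_series_scal_l (V := R_NormedModule)), Series_correct, ex_series_glogp_1; lia. }
apply is_series_unique in H; rewrite <- H.
rewrite (Series_ext _ (fun q => v ^ 2 * glogp k (y + INR q * v))).
- rewrite Series_scal_l; fold (gray k v y); field; lra.
- intros q; rewrite glogp_scale by (generalize (pos_INR q); lra).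
  do 2 f_equal; field; lra.
Qed.

(** The contribution of one matrix to the left-hand side of the theorem, for [u = a x + b] and
    [v = c x + d]. *)
Definition dphi_cone (k : nat) (u v : R) : R :=
  lsum (seq 1 k) (fun r => Binomial.C k r * (ln v ^ (k - r) / v ^ 2) * dphi r (u / v)).

Lemma dphi_cone_lim (k : nat) (u v : R) : (0 < k)%nat -> 0 < u -> 0 < v ->
  is_lim_seq (fun N => lsum (seq 1 N) (fun p => gray k v (INR p * u))
                       - lsum (seq 1 N) (fun p => dlogp k (INR p * u)) / v)
    (dphi_cone k u v).
Proof.
intros Hk Hu Hv.
assert (H : is_series (fun m => lsum (seq 1 k) (fun r =>
  Binomial.C k r * (ln v ^ (k - r) / v ^ 2) * phid r (INR (m + 1) * (u / v))))
  (dphi_cone k u v)).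
{ apply (is_series_Rlsum _ (fun r m =>
    Binomial.C k r * (ln v ^ (k - r) / v ^ 2) * phid r (INR (m + 1) * (u / v)))).
  intros r Hr; apply in_seq in Hr.
  apply (is_series_scal_l (V := R_NormedModule)), Series_correct, ex_series_dphi; [lia|].
  now apply Rdiv_lt_0_compat. }
apply is_series_lsum in H; revert H; apply is_lim_seq_ext; intros N.
change (seq 1 N) with (seq (0 + 1) N); rewrite !(lsum_seq_shift 0 N 1).
unfold Rdiv at 3; rewrite Rmult_comm, <- lsum_scal, <- lsum_minus.
apply lsum_ext; intros m _.
assert (Hm : 0 < INR (m + 1)) by (apply lt_0_INR; lia).
replace (INR (m + 1) * (u / v)) with (INR (m + 1) * u / v) by (field; lra).
rewrite phid_scale by (auto; apply Rmult_lt_0_compat; lra).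
unfold Rdiv; ring.
Qed.

(* The sum in the theorem starts at [r = 1]; the constant term [r = 0] cancels by
   [covolume_defect_0]. *)
Definition log_poly (gamma : nat -> R) (k : nat) (L : R) : R :=
  lsum (seq 0 (S k)) (fun r => Binomial.C k r * gamma_tilde gamma (k - r) * L ^ r).

Lemma lsum_seq_rev (n : nat) (f : nat -> R) :
  lsum (seq 0 (S n)) f = lsum (seq 0 (S n)) (fun r => f (n - r)%nat).
Proof.
induction n as [|n IH].
- unfold lsum; simpl; ring.
- rewrite lsum_seq_S, IH; change (seq 0 (S (S n))) with (0%nat :: seq (0 + 1) (S n)).
  change (lsum (0%nat :: seq (0 + 1) (S n)) ?f)
    with (f 0%nat + lsum (seq (0 + 1) (S n)) f).
  rewrite lsum_seq_shift, Nat.add_0_l, Nat.sub_0_r, Rplus_comm; f_equal.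
  apply lsum_ext; intros r Hr; f_equal; lia.
Qed.

(** The classical limit for [gamma_(r-1)], namely the sum of [log^(r-1)(p) / p] minus
    [log^r(N) / r], multiplied by [r]. *)
Definition stieltjes_limits (gamma : nat -> R) : Prop :=
  forall r, (0 < r)%nat ->
  is_lim_seq (fun N => lsum (seq 1 N) (fun p => dlogp r (INR p)) - logp r (INR N))
    (- gamma_tilde gamma r).

(** Expanding in powers of [ln u] reduces the claim to the limits at [u = 1]. The term [r = 0] in
    the expansion of [logp k (N u)] has no counterpart among the derivatives; it is [ln u ^ k],
    which is where [gamma_tilde 0 = 1] comes from. *)
Lemma dlogp_sum_lim (gamma : nat -> R) (k : nat) (u : R) :
  stieltjes_limits gamma -> (0 < k)%nat -> 0 < u ->
  is_lim_seq (fun N => lsum (seq 1 N) (fun p => dlogp k (INR p * u))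
                       - logp k (INR N * u) / u)
    (- (log_poly gamma k (ln u) / u)).
Proof.
intros Hgamma Hk Hu.
apply (is_lim_seq_ext_loc (fun N =>
  (lsum (seq 1 k) (fun r => Binomial.C k r * ln u ^ (k - r) *
    (lsum (seq 1 N) (fun p => dlogp r (INR p)) - logp r (INR N))) - ln u ^ k) * / u)).
{ exists 1%nat; intros N HN.
  assert (HN0 : 0 < INR N) by (apply lt_0_INR; lia).
  rewrite (Rmult_comm (INR N)), <- logp_scale by assumption.
  change (seq 0 (S k)) with (0%nat :: seq 1 k).
  change (lsum (0%nat :: seq 1 k) ?f) with (f 0%nat + lsum (seq 1 k) f); cbv beta.
  rewrite C_n_0, Nat.sub_0_r; change (logp 0 (INR N)) with 1.
  rewrite (lsum_ext _ _ (fun r =>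
     lsum (seq 1 N) (fun p => Binomial.C k r * ln u ^ (k - r) * dlogp r (INR p))
     - Binomial.C k r * ln u ^ (k - r) * logp r (INR N))).
  2:{ intros r _; rewrite lsum_scal; ring. }
  rewrite lsum_minus, lsum_swap.
  rewrite (lsum_ext (seq 1 N) _ (fun p => u * dlogp k (INR p * u))).
  2:{ intros p Hp; apply in_seq in Hp.
      rewrite dlogp_scale; [do 2 f_equal; ring|exact Hu|apply lt_0_INR; lia]. }
  rewrite lsum_scal; field; lra. }
replace (- (log_poly gamma k (ln u) / u))
  with ((lsum (seq 1 k) (fun r => Binomial.C k r * ln u ^ (k - r) *
          (- gamma_tilde gamma r)) - ln u ^ k) * / u).
- apply is_lim_seq_mult_r, is_lim_seq_minus'; [|apply is_lim_seq_const].
  apply (is_lim_seq_lsum _ (fun r N => Binomial.C k r * ln u ^ (k - r) *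
    (lsum (seq 1 N) (fun p => dlogp r (INR p)) - logp r (INR N)))).
  intros r Hr; apply in_seq in Hr; apply is_lim_seq_mult_l, Hgamma; lia.
- unfold log_poly; rewrite lsum_seq_rev.
  change (seq 0 (S k)) with (0%nat :: seq 1 k).
  change (lsum (0%nat :: seq 1 k) ?f) with (f 0%nat + lsum (seq 1 k) f); cbv beta.
  rewrite Nat.sub_0_r, C_n_n, Nat.sub_diag; simpl gamma_tilde.
  rewrite (lsum_ext (seq 1 k) (fun r => Binomial.C k (k - r) * _ * _)
    (fun r => (-1) * (Binomial.C k r * ln u ^ (k - r) * - gamma_tilde gamma r))).
  + rewrite lsum_scal; field; lra.
  + intros r Hr; apply in_seq in Hr.
    rewrite <- pascal_step1 by lia.
    replace (k - (k - r))%nat with r by lia; ring.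
Qed.

(** Trading the compensating sum of [dlogp] for the explicit [logp k (N u) / (u v)] is the step that
    introduces the Stieltjes constants. *)
Lemma cone_lim (gamma : nat -> R) (k : nat) (u v : R) :
  stieltjes_limits gamma -> (0 < k)%nat -> 0 < u -> 0 < v ->
  is_lim_seq (fun N => lsum (seq 1 N) (fun p => gray k v (INR p * u))
                       - logp k (INR N * u) / (u * v))
    (dphi_cone k u v - log_poly gamma k (ln u) / (u * v)).
Proof.
intros Hgamma Hk Hu Hv.
apply (is_lim_seq_ext (fun N =>
  (lsum (seq 1 N) (fun p => gray k v (INR p * u))
                       - lsum (seq 1 N) (fun p => dlogp k (INR p * u)) / v)
  + (lsum (seq 1 N) (fun p => dlogp k (INR p * u)) - logp k (INR N * u) / u) * / v)).
{ intros N; field; lra. }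
replace (dphi_cone k u v - log_poly gamma k (ln u) / (u * v))
  with (dphi_cone k u v + - (log_poly gamma k (ln u) / u) * / v) by (field; lra).
apply is_lim_seq_plus'; [now apply dphi_cone_lim|].
now apply is_lim_seq_mult_r, dlogp_sum_lim.
Qed.

(** * Stieltjes constants *)

(** The limit exists for elementary reasons, by telescoping. It remains to recognize [phir r 1] in
    terms of the Laurent coefficients of zeta. *)
Lemma dlogp_sum_phir (r : nat) : (0 < r)%nat ->
  is_lim_seq (fun N => lsum (seq 1 N) (fun p => dlogp r (INR p)) - logp r (INR N))
    (- phir r 1).
Proof.
intros Hr.
apply (is_lim_seq_ext (fun N => (logp r (INR N + 1) - logp r (INR N))
  - lsum (seq 0 N) (fun j => logp r (1 + INR j + 1) - logp r (1 + INR j)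
                             - dlogp r (1 + INR j)))).
- intros N; rewrite lsum_minus.
  rewrite (lsum_ext _ (fun a => logp r (1 + INR a + 1) - logp r (1 + INR a))
    (fun a => logp r (1 + INR (S a)) - logp r (1 + INR a)))
    by (intros; rewrite S_INR; do 2 f_equal; ring).
  rewrite (lsum_telescope N (fun a => logp r (1 + INR a))).
  change (seq 1 N) with (seq (0 + 1) N); rewrite lsum_seq_shift.
  rewrite (lsum_ext _ (fun i => dlogp r (INR (i + 1))) (fun i => dlogp r (1 + INR i)))
    by (intros; rewrite plus_INR; simpl INR; f_equal; ring).
  simpl (INR 0); rewrite Rplus_0_r, (Rplus_comm 1 (INR N)).
  replace (logp r 1) with 0; [ring|].
  unfold logp; rewrite ln_1, pow_ne_zero by lia; easy.
- replace (- phir r 1) with (0 - phir r 1) by ring.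
  apply is_lim_seq_minus'; [apply lim_logp_shift; [exact Hr|lra]|].
  apply is_series_lsum, Series_correct, ex_series_phir; [exact Hr|lra].
Qed.

(** * Taylor remainders of powers, and the expansion of zeta at 1 *)

Definition exp_rem (n : nat) (z : R) : R :=
  exp (- z) - lsum (seq 0 n) (fun r => (- z) ^ r / INR (fact r)).

Lemma is_derive_exp_rem (n : nat) (z : R) :
  is_derive (exp_rem (S n)) z (- exp_rem n z).
Proof.
assert (HI : forall i, is_derive (fun z => (- z) ^ S i / INR (fact (S i))) z
                        (- ((- z) ^ i / INR (fact i)))).
{ intros i; auto_derive; [easy|].
  assert (INR (fact i) <> 0) by apply INR_fact_neq_0.
  replace (fact i + i * fact i)%nat with (S i * fact i)%nat by lia.
  rewrite mult_INR.
  change (match i with 0%nat => 1 | S _ => INR i + 1 end) with (INR (S i)).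
  field; split; [assumption|apply not_0_INR; lia]. }
apply (is_derive_ext (fun z => (exp (- z) - 1)
  - lsum (seq 0 n) (fun i => (- z) ^ S i / INR (fact (S i))))).
{ intros y; unfold exp_rem.
  change (seq 0 (S n)) with (0%nat :: seq (0 + 1) n).
  change (lsum (0%nat :: seq (0 + 1) n) ?f) with (f 0%nat + lsum (seq (0 + 1) n) f).
  rewrite lsum_seq_shift; cbv beta.
  rewrite (lsum_ext _ (fun i => (- y) ^ (i + 1) / INR (fact (i + 1)))
    (fun i => (- y) ^ S i / INR (fact (S i)))) by (intros; now rewrite Nat.add_1_r).
  replace ((- y) ^ 0 / INR (fact 0)) with 1 by (simpl; field).
  match goal with |- ?a = ?b => change (a = b :> R) end; ring. }
replace (- exp_rem n z)
  with (- exp (- z) - lsum (seq 0 n) (fun i => - ((- z) ^ i / INR (fact i)))).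
- apply (is_derive_minus (V := R_NormedModule) (fun z => exp (- z) - 1)).
  + auto_derive; [easy|ring].
  + apply (is_derive_lsum _ (fun i z => (- z) ^ S i / INR (fact (S i)))
      (fun i z => - ((- z) ^ i / INR (fact i)))); intros; apply HI.
- unfold exp_rem; rewrite (lsum_ext _ _ (fun i => (-1) * ((- z) ^ i / INR (fact i))))
    by (intros; ring).
  rewrite lsum_scal; ring.
Qed.

(** Each remainder is minus the derivative of the next and all but the first vanish at 0, so the
    mean value theorem gains one power of [z] per order. The factorial is given up. *)
Lemma exp_rem_bound (n : nat) (z : R) : 0 <= z -> Rabs (exp_rem n z) <= z ^ n.
Proof.
revert z; induction n as [|n IH]; intros z Hz.
- unfold exp_rem, lsum; simpl; rewrite Rminus_0_r, Rabs_right
    by (apply Rle_ge, Rlt_le, exp_pos).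
  rewrite <- exp_0; destruct Hz as [Hz|<-]; [|rewrite Ropp_0; lra].
  apply Rlt_le, exp_increasing; lra.
- destruct (mean_value (exp_rem (S n)) (fun z => - exp_rem n z) 0 z Hz) as [c [Hc E]].
  { intros; apply is_derive_exp_rem. }
  replace (exp_rem (S n) 0) with 0 in E.
  + rewrite Rminus_0_r in E; rewrite E, Rabs_mult, Rabs_Ropp, Rminus_0_r.
    rewrite (Rabs_right z) by lra; rewrite <- tech_pow_Rmult, Rmult_comm.
    apply Rmult_le_compat_l; [exact Hz|].
    apply Rle_trans with (c ^ n); [apply IH; lra|apply pow_incr; lra].
  + unfold exp_rem; rewrite Ropp_0, exp_0.
    change (seq 0 (S n)) with (0%nat :: seq 1 n).
    change (lsum (0%nat :: seq 1 n) ?f) with (f 0%nat + lsum (seq 1 n) f).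
    rewrite lsum_zero; [simpl; field|].
    intros r Hr; apply in_seq in Hr; rewrite pow_ne_zero by lia.
    unfold Rdiv; ring.
Qed.

(* [y^(-t)] minus its Taylor polynomial of degree below [n] in [t]. *)
Definition pow_rem (n : nat) (t y : R) : R :=
  exp (- (t * ln y)) - lsum (seq 0 n) (fun r => (- t) ^ r / INR (fact r) * logp r y).

Definition pow_rem' (n : nat) (t y : R) : R :=
  - t * exp (- (t * ln y)) / y
  - lsum (seq 0 n) (fun r => (- t) ^ r / INR (fact r) * dlogp r y).

Lemma pow_rem_eq (n : nat) (t y : R) : pow_rem n t y = exp_rem n (t * ln y).
Proof.
unfold pow_rem, exp_rem; f_equal; apply lsum_ext; intros r _.
unfold logp; replace (- (t * ln y)) with (- t * ln y) by ring.
rewrite Rpow_mult_distr; unfold Rdiv; ring.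
Qed.

Lemma is_derive_pow_rem (n : nat) (t y : R) :
  0 < y -> is_derive (pow_rem n t) y (pow_rem' n t y).
Proof.
intros Hy; apply (is_derive_minus (V := R_NormedModule) (fun y => exp (- (t * ln y)))).
- auto_derive; [exact Hy|field; lra].
- apply (is_derive_lsum _ (fun r y => (- t) ^ r / INR (fact r) * logp r y)
    (fun r y => (- t) ^ r / INR (fact r) * dlogp r y)).
  intros r _; apply (is_derive_scal (logp r)); now apply is_derive_logp.
Qed.

Lemma is_derive_exp_rem_ln (n : nat) (t y : R) : 0 < y ->
  is_derive (fun y => exp_rem (S n) (t * ln y)) y (- t * exp_rem n (t * ln y) / y).
Proof.
intros Hy; replace (- t * exp_rem n (t * ln y) / y)
  with (scal (t / y) (- exp_rem n (t * ln y)))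
  by (unfold scal; simpl; unfold mult; simpl; field; lra).
apply (is_derive_comp (exp_rem (S n)) (fun y => t * ln y)).
- apply is_derive_exp_rem.
- auto_derive; [exact Hy|field; lra].
Qed.

Lemma pow_rem'_eq (n : nat) (t y : R) : 0 < y ->
  pow_rem' (S n) t y = - t * exp_rem n (t * ln y) / y.
Proof.
intros Hy; apply (derive_eq_pos (pow_rem (S n) t) (fun y => exp_rem (S n) (t * ln y)) y);
  [exact Hy| | |].
- intros; apply pow_rem_eq.
- now apply is_derive_pow_rem.
- now apply is_derive_exp_rem_ln.
Qed.

(** The left-hand side is a second-order difference, so the mean value theorem is used twice, with
    [K2] as second derivative. Differentiating in [y] lowers the order of [exp_rem] by one but
    releases a factor [t], so the total power [t ^ (m + 2)] survives. *)
Lemma pow_rem_step (m : nat) (t y : R) : 0 < t -> 1 <= y ->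
  Rabs (pow_rem (S (S m)) t (y + 1) - pow_rem (S (S m)) t y - pow_rem' (S (S m)) t y)
  <= t ^ S (S m) * ((ln (y + 1) ^ m + ln (y + 1) ^ S m) / y ^ 2).
Proof.
intros Ht Hy.
destruct (mean_value (pow_rem (S (S m)) t) (pow_rem' (S (S m)) t) y (y + 1))
  as [c [Hc E]]; [lra|intros; apply is_derive_pow_rem; lra|].
rewrite E; replace (y + 1 - y) with 1 by ring; rewrite Rmult_1_r.
set (K2 := fun z => t * (t * exp_rem m (t * ln z) + exp_rem (S m) (t * ln z)) / z ^ 2).
destruct (mean_value (fun z => - t * exp_rem (S m) (t * ln z) / z) K2 y c)
  as [e [He E2]]; [lra| |].
{ intros z Hz.
  assert (H := is_derive_exp_rem_ln m t z ltac:(lra)).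
  apply (is_derive_ext (fun z => - t * (exp_rem (S m) (t * ln z) * / z))).
  { intros; unfold Rdiv; symmetry; apply Rmult_assoc. }
  assert (HD : is_derive (fun z => / z) z (- / z ^ 2))
    by (auto_derive; [lra|field; lra]).
  assert (HM := is_derive_mult (K := R_AbsRing) _ _ z _ _ H HD Rmult_comm).
  apply (is_derive_scal _ _ (- t)) in HM.
  replace (K2 z) with (- t * plus (mult (- t * exp_rem m (t * ln z) / z) (/ z))
    (mult (exp_rem (S m) (t * ln z)) (- / z ^ 2)))
    by (unfold K2, plus, mult; simpl; field; lra).
  exact HM. }
rewrite !pow_rem'_eq, E2 by lra.
assert (HL0 : 0 <= ln e).
{ rewrite <- ln_1; destruct (Req_dec e 1) as [->|]; [lra|].
  apply Rlt_le, ln_increasing; lra. }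
assert (HL1 : ln e <= ln (y + 1)).
{ destruct (Req_dec e (y + 1)) as [->|]; [lra|].
  apply Rlt_le, ln_increasing; lra. }
assert (Hle : forall i, (t * ln e) ^ i <= t ^ i * ln (y + 1) ^ i).
{ intros i; rewrite Rpow_mult_distr; apply Rmult_le_compat_l;
    [apply pow_le; lra|apply pow_incr; lra]. }
assert (Hz : 0 <= t * ln e) by nra.
assert (HK : Rabs (K2 e) <= t ^ S (S m) * ((ln (y + 1) ^ m + ln (y + 1) ^ S m) / y ^ 2)).
{ unfold K2; unfold Rdiv; rewrite Rabs_mult, Rabs_mult, (Rabs_right t) by lra.
  rewrite (Rabs_right (/ e ^ 2))
    by (apply Rle_ge, Rlt_le, Rinv_0_lt_compat, pow_lt; lra).
  rewrite <- Rmult_assoc.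
  apply Rmult_le_compat.
  - apply Rmult_le_pos; [lra|apply Rabs_pos].
  - apply Rlt_le, Rinv_0_lt_compat, pow_lt; lra.
  - replace (t ^ S (S m) * (ln (y + 1) ^ m + ln (y + 1) ^ S m))
      with (t * (t * (t ^ m * ln (y + 1) ^ m) + t ^ S m * ln (y + 1) ^ S m))
      by (simpl; ring).
    apply Rmult_le_compat_l; [lra|].
    eapply Rle_trans; [apply Rabs_triang|]; apply Rplus_le_compat.
    + rewrite Rabs_mult, Rabs_right by lra; apply Rmult_le_compat_l; [lra|].
      eapply Rle_trans; [apply exp_rem_bound, Hz|apply Hle].
    + eapply Rle_trans; [apply exp_rem_bound, Hz|apply Hle].
  - apply Rinv_le_contravar; [apply pow_lt; lra|apply pow_incr; lra]. }
rewrite Rabs_mult, (Rabs_right (c - y)) by lra.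
rewrite <- (Rmult_1_r (_ * (_ / _))).
apply Rmult_le_compat; [apply Rabs_pos|lra|exact HK|lra].
Qed.

Lemma ex_series_ln_pow (m : nat) :
  ex_series (fun j => (ln (1 + INR j + 1) ^ m + ln (1 + INR j + 1) ^ S m)
                      / (1 + INR j) ^ 2).
Proof.
assert (H : forall i, exists Y, 1 <= Y /\ forall y, Y <= y ->
  0 <= ln y ^ i / y ^ 2 <= 2 * glogp (S i) y).
{ intros i; destruct (logp_tame (S i) ltac:(lia)) as [Y (HY & Hg & _ & _ & _ & _ & Hb)].
  exists Y; split; [exact HY|]; intros y Hy.
  assert (HL : 0 <= ln y).
  { rewrite <- ln_1; destruct (Req_dec y 1) as [->|]; [lra|].
    apply Rlt_le, ln_increasing; lra. }
  assert (Hp : 0 <= ln y ^ i) by now apply pow_le.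
  split; [apply Rmult_le_pos; [exact Hp|apply Rlt_le, Rinv_0_lt_compat, pow_lt; lra]|].
  specialize (Hb y Hy); unfold dlogp in Hb.
  replace (S i - 1)%nat with i in Hb by lia.
  apply Rmult_le_reg_r with y; [lra|].
  apply Rle_trans with (INR (S i) * ln y ^ i / y); [|lra].
  replace (ln y ^ i / y ^ 2 * y) with (ln y ^ i / y) by (field; lra).
  apply Rmult_le_compat_r; [apply Rlt_le, Rinv_0_lt_compat; lra|].
  rewrite S_INR; generalize (pos_INR i); nra. }
destruct (H m) as [Y1 [HY1 H1]]; destruct (H (S m)) as [Y2 [HY2 H2]].
destruct (INR_unbounded (Y1 + Y2)) as [J HJ].
(* The constant 8 is 2 from [ln y ^ i / y ^ 2 <= 2 * glogp], times 4 from
   [1 / (y - 1) ^ 2 <= 4 / y ^ 2] for [y >= 2]. *)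
apply (ex_series_dominated J _ (fun j => 8 * (glogp (S m) (2 + INR j)
                                              + glogp (S (S m)) (2 + INR j)))).
- intros n Hn; apply le_INR in Hn.
  replace (1 + INR n + 1) with (2 + INR n) by ring.
  specialize (H1 (2 + INR n) ltac:(lra)); specialize (H2 (2 + INR n) ltac:(lra)).
  set (y := 2 + INR n) in *; replace (1 + INR n) with (y - 1) by (unfold y; ring).
  assert (Hy : 2 <= y) by (unfold y; generalize (pos_INR n); lra).
  unfold Rdiv in *; set (a := ln y ^ m) in *; set (b := ln y ^ S m) in *.
  assert (Hi0 : 0 < / y ^ 2) by (apply Rinv_0_lt_compat, pow_lt; lra).
  assert (Ha : 0 <= a) by (apply Rmult_le_reg_r with (/ y ^ 2); lra).
  assert (Hb : 0 <= b) by (apply Rmult_le_reg_r with (/ y ^ 2); lra).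
  assert (Hi : 0 < / (y - 1) ^ 2 <= 4 * / y ^ 2).
  { split; [apply Rinv_0_lt_compat, pow_lt; lra|].
    replace (4 * / y ^ 2) with (/ ((y / 2) ^ 2)) by (field; lra).
    apply Rinv_le_contravar; [apply pow_lt; lra|apply pow_incr; lra]. }
  rewrite Rabs_right by (apply Rle_ge, Rmult_le_pos; lra); nra.
- apply (ex_series_scal_l (V := R_NormedModule)).
  apply (ex_series_plus (V := R_NormedModule)); apply ex_series_glogp_1; lia.
Qed.

(** Uniqueness of asymptotic expansions: letting [t] tend to 0 kills the constant coefficient, then
    one divides by [t] and repeats. *)
Lemma poly_coef_zero (n : nat) (d : nat -> R) (C : R) :
  (forall t, 0 < t <= 1 -> Rabs (lsum (seq 0 n) (fun j => d j * t ^ j)) <= C * t ^ n) ->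
  forall j, (j < n)%nat -> d j = 0.
Proof.
revert d; induction n as [|n IH]; intros d H j Hj; [lia|].
set (q := fun t => lsum (seq 0 n) (fun j => d (S j) * t ^ j)).
assert (E : forall t, lsum (seq 0 (S n)) (fun j => d j * t ^ j) = d 0%nat + t * q t).
{ intros t; change (seq 0 (S n)) with (0%nat :: seq (0 + 1) n).
  change (lsum (0%nat :: seq (0 + 1) n) ?f) with (f 0%nat + lsum (seq (0 + 1) n) f).
  rewrite lsum_seq_shift; unfold q; rewrite <- lsum_scal; simpl pow at 1.
  rewrite Rmult_1_r; f_equal; apply lsum_ext; intros i _.
  rewrite Nat.add_1_r; simpl; ring. }
set (D := lsum (seq 0 n) (fun j => Rabs (d (S j)))).
assert (Hq : forall t, 0 < t <= 1 -> Rabs (q t) <= D).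
{ intros t Ht; eapply Rle_trans; [apply lsum_Rabs|]; apply lsum_le; intros i _.
  rewrite Rabs_mult, (Rabs_right (t ^ i)) by (apply Rle_ge, pow_le; lra).
  rewrite <- (Rmult_1_r (Rabs (d (S i)))) at 2.
  apply Rmult_le_compat_l; [apply Rabs_pos|].
  rewrite <- (pow1 i); apply pow_incr; lra. }
assert (HD : 0 <= D) by (eapply Rle_trans; [apply Rabs_pos|apply (Hq 1); lra]).
assert (HC : 0 <= C).
{ specialize (H 1 ltac:(lra)); rewrite pow1, Rmult_1_r in H.
  eapply Rle_trans; [apply Rabs_pos|exact H]. }
assert (H0 : d 0%nat = 0).
{ destruct (Req_dec (d 0%nat) 0) as [|Hne]; [assumption|exfalso].
  apply Rabs_pos_lt in Hne; set (a := Rabs (d 0%nat)) in *.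
  (* For this [t] both the bound [C * t] and the rest [t * D] together stay below [a], although [a]
     is at most their sum. *)
  set (t := Rmin 1 (a / (2 * (C + D + 1)))).
  assert (Ht : 0 < t <= 1).
  { split; [|apply Rmin_l]; apply Rmin_glb_lt; [lra|apply Rdiv_lt_0_compat; lra]. }
  assert (Ht2 : t * (2 * (C + D + 1)) <= a).
  { apply Rle_trans with (a / (2 * (C + D + 1)) * (2 * (C + D + 1))).
    - apply Rmult_le_compat_r; [lra|apply Rmin_r].
    - apply Req_le; field; lra. }
  specialize (H t Ht); rewrite E in H; specialize (Hq t Ht).
  assert (t ^ S n <= t).
  { simpl; rewrite <- (Rmult_1_r t) at 3; apply Rmult_le_compat_l; [lra|].
    rewrite <- (pow1 n); apply pow_incr; lra. }
  assert (Ha : a <= Rabs (d 0%nat + t * q t) + t * Rabs (q t)).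
  { unfold a; replace (d 0%nat) with ((d 0%nat + t * q t) + - (t * q t)) at 1 by ring.
    eapply Rle_trans; [apply Rabs_triang|].
    rewrite Rabs_Ropp, Rabs_mult, (Rabs_right t) by lra; lra. }
  nra. }
destruct j as [|j]; [exact H0|].
apply (IH (fun j => d (S j))); [|lia].
intros t Ht; specialize (H t Ht); rewrite E, H0, Rplus_0_l, Rabs_mult in H.
rewrite (Rabs_right t) in H by lra.
apply Rmult_le_reg_l with t; [lra|]; fold (q t); simpl in H; lra.
Qed.

Lemma is_series_Re (a : nat -> C) (l : C) :
  is_series a l -> is_series (fun n => Re (a n)) (Re l).
Proof.
intros H; unfold is_series.
apply (filterlim_ext (fun n => fst (sum_n a n))).
- induction x as [|n IH].
  + now rewrite !sum_O.
  + rewrite !sum_Sn, <- IH; reflexivity.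
- eapply filterlim_comp; [exact H|].
  apply (continuous_fst (U := R_UniformSpace) (V := R_UniformSpace)).
Qed.

Lemma stieltjes_real_expansion (gamma : nat -> R) : is_stieltjes gamma ->
  exists Z : R -> R, forall t, 0 < t ->
    is_series (fun j => exp (- ((1 + t) * ln (1 + INR j)))) (Z t) /\
    is_series (fun j => (-1) ^ j * gamma j / INR (fact j) * t ^ j) (Z t - 1 / t).
Proof.
intros [zeta [[Hz _] HL]]; exists (fun t => Re (zeta (RtoC (1 + t)))).
intros t Ht; split.
- assert (H := Hz (RtoC (1 + t)) ltac:(simpl; lra)); apply is_series_Re in H.
  revert H; apply is_series_ext; intros j.
  rewrite <- RtoC_opp, <- RtoC_mult, Cexp_RtoC, re_RtoC; f_equal.
  rewrite plus_INR, (Rplus_comm (INR j)); simpl INR; ring.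
- assert (Hne : RtoC (1 + t) <> RtoC 1) by (intros E; apply RtoC_inj in E; lra).
  assert (H := HL (RtoC (1 + t)) Hne); apply is_series_Re in H.
  assert (Es : (RtoC (1 + t) - 1)%C = RtoC t).
  { rewrite <- RtoC_minus; f_equal; ring. }
  rewrite Es in H.
  replace (Re (zeta (RtoC (1 + t)) - 1 / RtoC t)%C)
    with (Re (zeta (RtoC (1 + t))) - 1 / t) in H.
  + revert H; apply is_series_ext; intros j.
    now rewrite <- RtoC_pow, <- RtoC_mult, re_RtoC.
  + rewrite <- RtoC_div by lra; reflexivity.
Qed.

(** The series defining [phir] at 1, with [y ^ (-t)] in place of [log^r y]. The differences
    telescope to [-1], and the derivatives contribute [t] times the zeta series at [1 + t]. *)
Lemma zeta_telescoped (t z : R) : 0 < t ->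
  is_series (fun j => exp (- ((1 + t) * ln (1 + INR j)))) z ->
  is_series (fun j => exp (- (t * ln (1 + INR j + 1))) - exp (- (t * ln (1 + INR j)))
                      - - t * exp (- (t * ln (1 + INR j))) / (1 + INR j)) (t * z - 1).
Proof.
intros Ht Hz; apply is_series_lsum.
set (e := fun j => exp (- (t * ln (1 + INR j)))).
apply (is_lim_seq_ext (fun N => e N - 1 +
  t * lsum (seq 0 N) (fun j => exp (- ((1 + t) * ln (1 + INR j)))))).
- intros N; rewrite <- lsum_scal.
  replace (e N - 1) with (e N - e 0%nat)
    by (unfold e; simpl INR; rewrite Rplus_0_r, ln_1, Rmult_0_r, Ropp_0, exp_0; ring).
  rewrite <- lsum_telescope, <- lsum_plus; apply lsum_ext; intros j _.
  assert (Hj := pos_INR j); unfold e; rewrite S_INR.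
  replace (1 + (INR j + 1)) with (1 + INR j + 1) by ring.
  replace (- ((1 + t) * ln (1 + INR j)))
    with (- (t * ln (1 + INR j)) + - ln (1 + INR j)) by ring.
  rewrite exp_plus, (exp_Ropp (ln _)), exp_ln by lra; field; lra.
- replace (t * z - 1) with (0 - 1 + t * z) by ring.
  apply is_lim_seq_plus'; [|now apply is_lim_seq_mult_l, is_series_lsum].
  apply is_lim_seq_minus'; [|apply is_lim_seq_const].
  unfold e; apply (is_lim_comp_seq exp _ m_infty 0); [apply is_lim_exp_m|exists 0%nat; easy|].
  apply (is_lim_seq_opp _ p_infty).
  apply (is_lim_seq_ext (fun n => t * ln (1 + INR n))); [reflexivity|].
  replace p_infty with (Rbar_mult t p_infty).
  + apply is_lim_seq_scal_l, (is_lim_comp_seq ln _ p_infty p_infty);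
      [apply is_lim_ln_p|exists 0%nat; easy|apply is_lim_seq_shift].
  + simpl; destruct (Rle_dec 0 t) as [H|]; [|lra].
    destruct (Rle_lt_or_eq_dec 0 t H); [easy|lra].
Qed.

(** Expanding [y ^ (-t)] in powers of [t] inside [zeta_telescoped] turns each [log^r] into
    [phir r 1]. The term [r = 0] is constant in [y] and contributes nothing; the remainders are
    summed with [pow_rem_step]. *)
Lemma phir_1_asymptotic (m : nat) : exists B, forall t z, 0 < t ->
  is_series (fun j => exp (- ((1 + t) * ln (1 + INR j)))) z ->
  Rabs ((t * z - 1) - lsum (seq 1 (S m)) (fun r => (- t) ^ r / INR (fact r) * phir r 1))
  <= B * t ^ S (S m).
Proof.
exists (Series (fun j => (ln (1 + INR j + 1) ^ m + ln (1 + INR j + 1) ^ S m)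
                      / (1 + INR j) ^ 2)).
intros t z Ht Hz; apply (zeta_telescoped t z Ht) in Hz.
assert (Hp : is_series (fun j => lsum (seq 1 (S m)) (fun r => (- t) ^ r / INR (fact r) *
   (logp r (1 + INR j + 1) - logp r (1 + INR j) - dlogp r (1 + INR j))))
   (lsum (seq 1 (S m)) (fun r => (- t) ^ r / INR (fact r) * phir r 1))).
{ apply (is_series_Rlsum _ (fun r j => (- t) ^ r / INR (fact r) *
   (logp r (1 + INR j + 1) - logp r (1 + INR j) - dlogp r (1 + INR j)))).
  intros r Hr; apply in_seq in Hr.
  apply (is_series_scal_l (V := R_NormedModule)), Series_correct, ex_series_phir; [lia|lra]. }
assert (H := is_series_minus _ _ _ _ Hz Hp).
assert (HK : is_series (fun j => pow_rem (S (S m)) t (1 + INR j + 1)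
    - pow_rem (S (S m)) t (1 + INR j) - pow_rem' (S (S m)) t (1 + INR j))
  ((t * z - 1) - lsum (seq 1 (S m)) (fun r => (- t) ^ r / INR (fact r) * phir r 1))).
{ revert H; apply is_series_ext; intros j.
  unfold pow_rem, pow_rem', minus, plus, opp; simpl plus; simpl opp.
  rewrite (lsum_ext (seq 1 (S m)) _ (fun r =>
     (- t) ^ r / INR (fact r) * logp r (1 + INR j + 1)
     - (- t) ^ r / INR (fact r) * logp r (1 + INR j)
     - (- t) ^ r / INR (fact r) * dlogp r (1 + INR j))) by (intros; ring).
  rewrite !lsum_minus.
  change (seq 0 (S (S m))) with (0%nat :: seq 1 (S m)).
  rewrite !(lsum_cons 0%nat).
  replace (dlogp 0 (1 + INR j)) with 0 by (unfold dlogp, Rdiv; simpl; ring).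
  change (logp 0 (1 + INR j)) with 1; change (logp 0 (1 + INR j + 1)) with 1.
  simpl; ring. }
rewrite <- (is_series_unique _ _ HK).
assert (Hb : forall j, Rabs (pow_rem (S (S m)) t (1 + INR j + 1)
    - pow_rem (S (S m)) t (1 + INR j) - pow_rem' (S (S m)) t (1 + INR j))
  <= t ^ S (S m) * ((ln (1 + INR j + 1) ^ m + ln (1 + INR j + 1) ^ S m)
                      / (1 + INR j) ^ 2)).
{ intros j; apply pow_rem_step; [exact Ht|generalize (pos_INR j); lra]. }
assert (Eb := ex_series_scal_l (V := R_NormedModule) (t ^ S (S m)) _ (ex_series_ln_pow m)).
rewrite Rmult_comm, <- Series_scal_l.
eapply Rle_trans; [apply Series_Rabs|apply Series_le; [|exact Eb]].
(* The transport along [Rabs_Rabsolu] adapts [Hb] to the doubled absolute value that arises from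
   asking for absolute convergence. *)
- apply (ex_series_dominated 0 _ _ (fun j _ => eq_ind_r (fun x => x <= _) (Hb j)
    (Rabs_Rabsolu _)) Eb).
- intros j; split; [apply Rabs_pos|apply Hb].
Qed.

(** Convergence at 2 places 1 strictly inside the disk of convergence, so the coefficients are
    absolutely summable and the tail is at most [t ^ n] times their tail sum. *)
Lemma power_series_split_bound (a : nat -> R) (n : nat) :
  ex_series (fun j => a j * 2 ^ j) ->
  exists D, forall t, 0 < t <= 1 ->
    Rabs (Series (fun j => a j * t ^ j) - lsum (seq 0 n) (fun j => a j * t ^ j))
    <= D * t ^ n.
Proof.
intros H2.
assert (Hr : Rbar_le 2 (CV_radius a)).
{ apply Rbar_not_lt_le; intros Hlt.
  apply (CV_disk_outside a 2).
  - rewrite Rabs_right by lra; exact Hlt.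
  - now apply ex_series_lim_0. }
assert (HA : forall t, 0 < t <= 1 -> ex_series (fun j => Rabs (a j * t ^ j))).
{ intros t Ht; apply CV_disk_inside; rewrite Rabs_right by lra.
  eapply Rbar_lt_le_trans; [|exact Hr]; simpl; lra. }
exists (Series (fun i => Rabs (a (n + i)%nat))).
intros t Ht.
rewrite (Series_split n) by (apply ex_series_Rabs, HA, Ht).
match goal with |- Rabs (?x + ?y - ?x) <= _ => replace (x + y - x) with y by ring end.
assert (E1 : ex_series (fun i => t ^ n * Rabs (a (n + i)%nat))).
{ apply (ex_series_scal_l (V := R_NormedModule)), (ex_series_incr_n (fun i => Rabs (a i))).
  eapply ex_series_ext; [|exact (HA 1 ltac:(lra))].
  intros i; simpl; now rewrite pow1, Rmult_1_r. }
assert (Hb : forall i, Rabs (a (n + i)%nat * t ^ (n + i)) <= t ^ n * Rabs (a (n + i)%nat)).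
{ intros i; rewrite pow_add, Rabs_mult, (Rabs_right (_ * _))
    by (apply Rle_ge, Rmult_le_pos; apply pow_le; lra).
  assert (t ^ i <= 1) by (rewrite <- (pow1 i); apply pow_incr; lra).
  assert (0 < t ^ n) by (apply pow_lt; lra).
  rewrite Rmult_comm; apply Rmult_le_compat_r; [apply Rabs_pos|nra]. }
rewrite Rmult_comm, <- Series_scal_l.
eapply Rle_trans; [apply Series_Rabs|apply Series_le; [|exact E1]].
- apply (ex_series_dominated 0 _ _ (fun j _ => eq_ind_r (fun x => x <= _) (Hb j)
    (Rabs_Rabsolu _)) E1).
- intros j; split; [apply Rabs_pos|apply Hb].
Qed.

(** Two expansions of [zeta(1 + t) - 1 / t] up to order [t ^ (m + 1)] are compared: the Laurent
    expansion, with coefficients [a], and [phir_1_asymptotic] divided by [t], with coefficients [c].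
    Equality of the coefficients of [t ^ m] is the claim. *)
Lemma stieltjes_phir (gamma : nat -> R) (m : nat) :
  is_stieltjes gamma -> phir (S m) 1 = - INR (S m) * gamma m.
Proof.
intros Hg; destruct (stieltjes_real_expansion gamma Hg) as [Z HZ].
destruct (phir_1_asymptotic m) as [B HB].
set (a := fun j => (-1) ^ j * gamma j / INR (fact j)) in *.
destruct (power_series_split_bound a (S m)) as [D HD].
{ destruct (HZ 2 ltac:(lra)) as [_ H]; now exists (Z 2 - 1 / 2). }
set (c := fun j => (-1) ^ S j / INR (fact (S j)) * phir (S j) 1).
assert (H : a m - c m = 0).
{ apply (poly_coef_zero (S m) (fun j => a j - c j) (B + D)); [|lia].
  intros t Ht; specialize (HD t Ht).
  destruct (HZ t ltac:(lra)) as [H1 H2].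
  specialize (HB t (Z t) ltac:(lra) H1).
  apply is_series_unique in H2; fold a in H2.
  change (fun j => (-1) ^ j * gamma j / INR (fact j) * t ^ j)
    with (fun j => a j * t ^ j) in H2.
  rewrite H2 in HD.
  rewrite (lsum_ext _ _ (fun j => a j * t ^ j - c j * t ^ j)) by (intros; ring).
  rewrite lsum_minus.
  replace (lsum (seq 1 (S m)) (fun r => (- t) ^ r / INR (fact r) * phir r 1))
    with (t * lsum (seq 0 (S m)) (fun j => c j * t ^ j)) in HB.
  2:{ change (seq 1 (S m)) with (seq (0 + 1) (S m)).
      rewrite lsum_seq_shift, <- lsum_scal; apply lsum_ext; intros j _.
      rewrite Nat.add_1_r; unfold c.
      replace (- t) with (-1 * t) by ring; rewrite Rpow_mult_distr.
      simpl; unfold Rdiv; ring. }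
  set (A := lsum (seq 0 (S m)) (fun j => a j * t ^ j)) in *.
  set (C := lsum (seq 0 (S m)) (fun j => c j * t ^ j)) in *.
  replace (t * Z t - 1 - t * C) with (t * (Z t - 1 / t - C)) in HB by (field; lra).
  rewrite Rabs_mult, (Rabs_right t) in HB by lra.
  assert (HB' : Rabs (Z t - 1 / t - C) <= B * t ^ S m).
  { apply Rmult_le_reg_l with t; [lra|].
    replace (t * (B * t ^ S m)) with (B * t ^ S (S m)) by (simpl; ring); exact HB. }
  replace (A - C) with ((Z t - 1 / t - C) + - (Z t - 1 / t - A)) by ring.
  eapply Rle_trans; [apply Rabs_triang|]; rewrite Rabs_Ropp, Rmult_plus_distr_r; lra. }
unfold a, c in H.
change (fact (S m)) with (S m * fact m)%nat in H; rewrite mult_INR in H.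
assert (Hf : INR (fact m) <> 0) by apply INR_fact_neq_0.
assert (Hs : INR (S m) <> 0) by (apply not_0_INR; lia).
assert (Hp : (-1) ^ m <> 0) by (apply pow_nonzero; lra).
apply Rmult_eq_reg_l with ((-1) ^ m / (INR (S m) * INR (fact m))).
- replace ((-1) ^ m / (INR (S m) * INR (fact m)) * (- INR (S m) * gamma m))
    with (- ((-1) ^ m * gamma m / INR (fact m))) by (field; split; assumption).
  simpl pow in H; unfold Rdiv in *; lra.
- unfold Rdiv; apply Rmult_integral_contrapositive_currified; [exact Hp|].
  apply Rinv_neq_0_compat, Rmult_integral_contrapositive_currified; assumption.
Qed.

Lemma is_stieltjes_limits (gamma : nat -> R) :
  is_stieltjes gamma -> stieltjes_limits gamma.
Proof.
intros Hg [|m] Hr; [lia|].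
simpl gamma_tilde; change (match m with 0%nat => 1 | S _ => INR m + 1 end) with (INR (S m)).
rewrite <- (stieltjes_phir gamma m Hg); now apply dlogp_sum_phir.
Qed.

(** * Cutting cones off by the size of the lattice point *)

Definition cut (X : R) (f : R -> R) (y : R) : R := if Rle_dec y X then f y else 0.

(** Informative existence, so that a floor can be chosen for every [m] and used as a sequence in
    [cut_cone_lim]. *)
Lemma nat_floor (z : R) : 0 <= z -> {n : nat | INR n <= z < INR n + 1}.
Proof. intros Hz; destruct (nfloor_ex z Hz) as [n Hn]; now exists n. Qed.

Lemma cut_progression (k B : nat) (v y X : R) :
  (0 < k)%nat -> 0 < v -> 0 < y -> y <= X -> X < INR B * v ->
  exists z, X < z <= X + v /\
    lsum (seq 0 B) (fun q => cut X (glogp k) (y + INR q * v)) = gray k v y - gray k v z.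
Proof.
intros Hk Hv Hy HyX HB.
destruct (nat_floor ((X - y) / v)) as [n [Hn1 Hn2]].
{ apply Rmult_le_pos; [lra|apply Rlt_le, Rinv_0_lt_compat, Hv]. }
apply (Rmult_le_compat_r v) in Hn1; [|lra].
apply (Rmult_lt_compat_r v) in Hn2; [|lra].
replace ((X - y) / v * v) with (X - y) in * by (field; lra).
assert (HnB : (n < B)%nat).
{ apply INR_lt, Rmult_lt_reg_r with v; lra. }
exists (y + INR (S n) * v); split; [rewrite S_INR; lra|].
replace B with (S n + (B - S n))%nat by lia.
rewrite seq_app, lsum_app.
rewrite (lsum_zero (seq (0 + S n) _)).
2:{ intros q Hq; apply in_seq in Hq; unfold cut.
    assert (INR (S n) <= INR q) by (apply le_INR; lia).
    destruct (Rle_dec (y + INR q * v) X) as [Hle|]; [exfalso|easy].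
    rewrite S_INR in *; nra. }
rewrite Rplus_0_r; unfold gray at 1.
rewrite (Series_split (S n)) by now apply ex_series_glogp.
rewrite (Series_ext _ (fun q => glogp k (y + INR (S n) * v + INR q * v)))
  by (intros; rewrite plus_INR; f_equal; ring).
fold (gray k v (y + INR (S n) * v)).
rewrite (lsum_ext _ _ (fun q => glogp k (y + INR q * v))); [ring|].
intros q Hq; apply in_seq in Hq; unfold cut.
assert (INR q <= INR n) by (apply le_INR; lia).
destruct (Rle_dec (y + INR q * v) X) as [|Hne]; [easy|exfalso; apply Hne; nra].
Qed.

(** The estimate is uniform in the position of [z] within the step after [X], so the tails of all
    rows of a cone can be compared with the same value. *)
Lemma gray_approx (k : nat) (v : R) : (0 < k)%nat -> 0 < v ->
  exists Y, 1 <= Y /\ forall X z, Y <= X -> X < z <= X + v ->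
    Rabs (gray k v z - dlogp k X / v) <= glogp k X.
Proof.
intros Hk Hv; destruct (logp_tame k Hk) as [Y (HY & Hg & Hm & Hd & Hd0 & _)].
exists Y; split; [exact HY|]; intros X z HX Hz.
destruct (glogp_series_bounds k Y z v) as [_ HS]; try assumption; [lra|].
fold (gray k v z) in HS.
generalize (Hd X z HX ltac:(lra)) (Hm X z HX ltac:(lra)) (Hg X HX) (Hg z ltac:(lra)).
intros H1 H2 H3 H4.
assert (Hiv : 0 < / v) by now apply Rinv_0_lt_compat.
assert (Hlo : dlogp k X / v - glogp k X <= dlogp k z / v).
{ apply Rmult_le_reg_r with v; [lra|].
  replace ((dlogp k X / v - glogp k X) * v) with (dlogp k X - v * glogp k X)
    by (field; lra).
  replace (dlogp k z / v * v) with (dlogp k z) by (field; lra); nra. }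
assert (Hhi : dlogp k z / v <= dlogp k X / v).
{ apply Rmult_le_compat_r; [lra|nra]. }
apply Rabs_le; lra.
Qed.

(* Passing from the cutoff [p u <= m] to [p u + q v <= m] removes about [m / u] tails,
   each close to [dlogp k m / v]. *)
Lemma cut_cone_lim (k : nat) (u v T : R) (B : nat -> nat) :
  (0 < k)%nat -> 0 < u -> 0 < v ->
  (forall m, INR m <= INR (B m) * u) -> (forall m, INR m < INR (B m) * v) ->
  is_lim_seq (fun N => lsum (seq 1 N) (fun p => gray k v (INR p * u))
                       - logp k (INR N * u) / (u * v)) T ->
  is_lim_seq (fun m => lsum (seq 1 (B m)) (fun p => lsum (seq 0 (B m)) (fun q =>
      cut (INR m) (glogp k) (INR p * u + INR q * v)))
      - (logp k (INR m) - INR m * dlogp k (INR m)) / (u * v)) T.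
Proof.
intros Hk Hu Hv HBu HBv HT.
assert (sN : forall m, {N : nat | INR N * u <= INR m < (INR N + 1) * u}).
{ intros m; destruct (nat_floor (INR m / u)) as [N HN].
  - apply Rmult_le_pos; [apply pos_INR|apply Rlt_le, Rinv_0_lt_compat, Hu].
  - exists N; replace (INR m) with (INR m / u * u) by (field; lra).
    split; [apply Rmult_le_compat_r|apply Rmult_lt_compat_r]; lra. }
set (N := fun m => proj1_sig (sN m)).
assert (HN : forall m, INR (N m) * u <= INR m < (INR (N m) + 1) * u)
  by (intros m; apply (proj2_sig (sN m))).
clearbody N; clear sN.
assert (HNlim : filterlim N eventually eventually).
{ intros P [N0 HP]; destruct (INR_unbounded (INR N0 * u)) as [M HM].
  exists M; intros m Hm; apply HP.
  apply le_INR in Hm; specialize (HN m).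
  assert (INR N0 < INR (S (N m))).
  { rewrite S_INR; apply Rmult_lt_reg_r with u; lra. }
  apply INR_lt in H; lia. }
set (inner := fun m p => lsum (seq 0 (B m)) (fun q =>
      cut (INR m) (glogp k) (INR p * u + INR q * v))).
assert (Hout : forall m, lsum (seq 1 (B m)) (inner m) = lsum (seq 1 (N m)) (inner m)).
{ intros m; specialize (HN m).
  assert (HNB : (N m <= B m)%nat).
  { apply INR_le, Rmult_le_reg_r with u; [lra|]; specialize (HBu m); lra. }
  replace (B m) with (N m + (B m - N m))%nat at 1 by lia.
  rewrite seq_app, lsum_app, (lsum_zero (seq (1 + N m) _)); [ring|].
  intros p Hp; apply in_seq in Hp; unfold inner; apply lsum_zero; intros q _.
  unfold cut; destruct (Rle_dec (INR p * u + INR q * v) (INR m)) as [Hle|]; [exfalso|easy].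
  assert (INR (S (N m)) <= INR p) by (apply le_INR; lia); rewrite S_INR in *.
  assert (0 <= INR q * v) by (apply Rmult_le_pos; [apply pos_INR|lra]); nra. }
destruct (gray_approx k v Hk Hv) as [Y1 [HY1 HG]].
destruct (logp_tame k Hk) as [Y2 (HY2 & Hg & _ & _ & Hd0 & Hl & _)].
(* The error has three sources: the tails against their common approximation, the rounding of
   [m / u] to [N m], and the change of [h] from [N m * u] to [m]. The three terms of [bound] below
   answer them in this order. *)
set (err := fun m => (lsum (seq 1 (N m)) (inner m)
  - lsum (seq 1 (N m)) (fun p => gray k v (INR p * u)) + INR (N m) * (dlogp k (INR m) / v))
  + (INR m * dlogp k (INR m) / (u * v) - INR (N m) * (dlogp k (INR m) / v))
  + (logp k (INR (N m) * u) - logp k (INR m)) / (u * v)).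
apply (is_lim_seq_ext (fun m =>
  (lsum (seq 1 (N m)) (fun p => gray k v (INR p * u)) - logp k (INR (N m) * u) / (u * v))
  + err m)).
{ intros m; change (lsum (seq 1 (B m)) (fun p => lsum (seq 0 (B m)) (fun q =>
      cut (INR m) (glogp k) (INR p * u + INR q * v)))) with (lsum (seq 1 (B m)) (inner m)).
  rewrite Hout; unfold err; field; lra. }
replace T with (T + 0) by ring; apply is_lim_seq_plus'.
{ apply (is_lim_seq_subseq _ T N HNlim HT). }
assert (HNu : is_lim_seq (fun m => INR (N m) * u) p_infty).
{ apply (is_lim_seq_subseq (fun n => INR n * u) p_infty N HNlim).
  apply (is_lim_seq_ext (fun n => 0 + INR n * u)); [intros; ring|].
  now apply is_lim_seq_affine. }
apply is_lim_seq_abs_0.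
set (bound := fun m => (INR m * glogp k (INR m)) * / u + dlogp k (INR m) * / v
                       + dlogp k (INR (N m) * u) * / v).
apply (is_lim_seq_le_le_loc (fun _ => 0) _ bound).
- apply is_lim_seq_spec in HNu; destruct (HNu (Y1 + Y2)) as [M HM].
  exists M; intros m Hm; split; [apply Rabs_pos|].
  specialize (HM m Hm); specialize (HN m); set (X := INR m) in *.
  assert (HX : Y1 + Y2 < X) by lra.
  assert (Hiu : 0 < / u) by now apply Rinv_0_lt_compat.
  assert (Hiv : 0 < / v) by now apply Rinv_0_lt_compat.
  assert (HNX : INR (N m) <= X * / u).
  { apply Rmult_le_reg_r with u; [lra|]; rewrite Rmult_assoc, Rinv_l by lra; lra. }
  unfold err, bound; fold X.
  eapply Rle_trans; [apply Rabs_triang|]; apply Rplus_le_compat;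
    [eapply Rle_trans; [apply Rabs_triang|]; apply Rplus_le_compat|].
  + rewrite <- (length_seq (N m) 1) at 3; rewrite <- lsum_const, <- lsum_minus, <- lsum_plus.
    eapply Rle_trans; [apply lsum_Rabs|].
    apply Rle_trans with (lsum (seq 1 (N m)) (fun _ => glogp k X)).
    * apply lsum_le; intros p Hp; apply in_seq in Hp.
      assert (Hp0 : 0 < INR p) by (apply lt_0_INR; lia).
      assert (HpN : INR p <= INR (N m)) by (apply le_INR; lia).
      destruct (cut_progression k (B m) v (INR p * u) X) as [z [Hz E]]; try assumption.
      -- now apply Rmult_lt_0_compat.
      -- nra.
      -- apply HBv.
      -- unfold inner; fold X; rewrite E.
         replace (gray k v (INR p * u) - gray k v z - gray k v (INR p * u)
                  + dlogp k X / v) with (- (gray k v z - dlogp k X / v)) by ring.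
         rewrite Rabs_Ropp; apply HG; [lra|exact Hz].
    * rewrite lsum_const, length_seq.
      replace (X * glogp k X * / u) with (X * / u * glogp k X) by ring.
      apply Rmult_le_compat_r; [apply Hg; lra|exact HNX].
  + assert (Hd : 0 <= dlogp k X) by (apply Hd0; lra).
    replace (X * dlogp k X / (u * v) - INR (N m) * (dlogp k X / v))
      with ((X * / u - INR (N m)) * (dlogp k X * / v)) by (field; lra).
    assert (0 <= dlogp k X * / v) by (apply Rmult_le_pos; lra).
    assert (X * / u - INR (N m) <= 1).
    { apply Rmult_le_reg_r with u; [lra|].
      rewrite Rmult_minus_distr_r, Rmult_assoc, Rinv_l by lra; lra. }
    rewrite Rabs_right; [nra|]; apply Rle_ge, Rmult_le_pos; lra.
  + assert (Hd : 0 <= dlogp k (INR (N m) * u)) by (apply Hd0; lra).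
    assert (HL := Hl (INR (N m) * u) X ltac:(lra) ltac:(lra)).
    assert (Hd' : 0 <= dlogp k X) by (apply Hd0; lra).
    assert (Hl0 : 0 <= logp k X - logp k (INR (N m) * u)).
    { eapply Rle_trans; [|apply HL]; apply Rmult_le_pos; lra. }
    assert (Hl1 : logp k X - logp k (INR (N m) * u) <= u * dlogp k (INR (N m) * u)).
    { eapply Rle_trans; [apply HL|]; apply Rmult_le_compat_r; lra. }
    replace ((logp k (INR (N m) * u) - logp k X) / (u * v))
      with (- ((logp k X - logp k (INR (N m) * u)) * / u * / v)) by (field; lra).
    rewrite Rabs_Ropp, Rabs_right.
    * apply Rmult_le_compat_r; [lra|].
      apply Rmult_le_reg_r with u; [lra|]; rewrite Rmult_assoc, Rinv_l by lra; lra.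
    * apply Rle_ge, Rmult_le_pos; [apply Rmult_le_pos|]; lra.
- apply is_lim_seq_const.
- unfold bound; replace 0 with (0 * / u + 0 * / v + 0 * / v) by ring.
  apply is_lim_seq_plus'; [apply is_lim_seq_plus'|]; apply is_lim_seq_mult_r.
  + apply (is_lim_seq_comp_p_infty (fun y => y * glogp k y));
      [apply is_lim_mult_glogp|apply is_lim_seq_INR].
  + apply (is_lim_seq_comp_p_infty (dlogp k)); [apply is_lim_dlogp|apply is_lim_seq_INR].
  + apply (is_lim_seq_comp_p_infty (dlogp k)); [apply is_lim_dlogp|exact HNu].
Qed.

(** * Tiling the quadrant by cones *)

(** The bijection is a relation, since it arises from an iteration of unspecified length, and it is
    required only between the supports: the boxes on the two sides match only below the cutoff. *)
Lemma lsum_correspondence {A B : Type} (la : list A) (lb : list B)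
  (f : A -> R) (g : B -> R) (rel : A -> B -> Prop) :
  NoDup la -> NoDup lb ->
  (forall a, In a la -> f a <> 0 -> exists b, In b lb /\ rel a b) ->
  (forall b, In b lb -> g b <> 0 -> exists a, In a la /\ rel a b) ->
  (forall a b, In a la -> In b lb -> rel a b -> f a = g b) ->
  (forall a b b', rel a b -> rel a b' -> b = b') ->
  (forall a a' b, rel a b -> rel a' b -> a = a') ->
  lsum la f = lsum lb g.
Proof.
intros Hla; revert lb; induction Hla as [|a la Ha Hla IH];
  intros lb Hlb Hab Hba Hfg Hfun Hinj.
- symmetry; apply lsum_zero; intros b Hb.
  destruct (Req_dec (g b) 0) as [|Hne]; [assumption|].
  now destruct (Hba b Hb Hne) as [a [[] _]].
- rewrite lsum_cons; destruct (Req_dec (f a) 0) as [H0|Hne].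
  + rewrite H0, Rplus_0_l; apply IH; try assumption.
    * intros a' Ha'; apply Hab; now right.
    * intros b Hb Hb0; destruct (Hba b Hb Hb0) as [a' [[<-|Ha'] Hr]]; [|now exists a'].
      exfalso; apply Hb0; rewrite <- (Hfg a b); auto; now left.
    * intros a' b Ha'; apply Hfg; now right.
  + destruct (Hab a (or_introl eq_refl) Hne) as [b [Hb Hr]].
    destruct (in_split _ _ Hb) as [l1 [l2 ->]].
    rewrite (lsum_Permutation _ (b :: l1 ++ l2))
      by (symmetry; apply Permutation_middle).
    rewrite lsum_cons, (Hfg a b); [f_equal|now left|exact Hb|exact Hr].
    destruct (NoDup_remove _ _ _ Hlb) as [Hlb' Hb'].
    assert (Hsub : forall b', In b' (l1 ++ l2) -> In b' (l1 ++ b :: l2)).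
    { intros b'; rewrite !in_app_iff; simpl; tauto. }
    apply IH; try assumption.
    * intros a' Ha' H'; destruct (Hab a' (or_intror Ha') H') as [b' [Hin Hr']].
      exists b'; split; [|exact Hr'].
      rewrite in_app_iff in *; destruct Hin as [|[<-|]]; try tauto.
      exfalso; apply Ha; now rewrite (Hinj a a' b).
    * intros b' Hin H'; destruct (Hba b' (Hsub b' Hin) H') as [a' [[<-|Ha'] Hr']];
        [|now exists a'].
      exfalso; apply Hb'; now rewrite (Hfun a b b').
    * intros a' b' Ha' Hin; apply Hfg; [now right|auto].
Qed.

Local Open Scope Z_scope.

(* A state [(a, b, c, d, p, q)] records a vector [p (a, b) + q (c, d)] of the
   cone spanned by [(a, b)] and [(c, d)].  One step of the subtractive Euclidean
   algorithm on [(p, q)] splits the cone along [(a + c, b + d)] and passes to the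
   half containing the vector. *)
Definition cone_step (s : Z * Z * Z * Z * Z * Z) : Z * Z * Z * Z * Z * Z :=
  let '(a, b, c, d, p, q) := s in
  if q <? p then (a, b, a + c, b + d, p - q, q) else (a + c, b + d, c, d, p, q - p).

(** The cone is half-open: [1 <= p] and [0 <= q] keep the ray of [(a, b)] and exclude that of
    [(c, d)]. When a cone is split, the new ray thus belongs to the second half only, and the two
    halves are disjoint. *)
Definition cone_state (n : Z) (s : Z * Z * Z * Z * Z * Z) : Prop :=
  let '(a, b, c, d, p, q) := s in
  0 < a /\ 0 <= b /\ 0 <= c /\ 0 < d /\ a * d - b * c = n /\ 1 <= p /\ 0 <= q.

Definition cone_root (s : Z * Z * Z * Z * Z * Z) : Prop :=
  let '(a, b, c, d, p, q) := s in c < a /\ b < d.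

(** When [q = 0] the vector lies on the first ray, and every further step only adds [(a, b)] to
    [(c, d)]. The condition [c < a] therefore singles out one state of the orbit. *)
Definition cone_final (s : Z * Z * Z * Z * Z * Z) : Prop :=
  let '(a, b, c, d, p, q) := s in q = 0 /\ c < a.

Definition cone_vector (s : Z * Z * Z * Z * Z * Z) : Z * Z :=
  let '(a, b, c, d, p, q) := s in (p * a + q * c, p * b + q * d).

Lemma cone_step_state (n : Z) s : cone_state n s -> cone_state n (cone_step s).
Proof.
destruct s as [[[[[a b] c] d] p] q]; unfold cone_step, cone_state.
destruct (Z.ltb_spec q p); intros H'; repeat split; try lia; nia.
Qed.

Lemma cone_step_vector s : cone_vector (cone_step s) = cone_vector s.
Proof.
destruct s as [[[[[a b] c] d] p] q]; unfold cone_step; destruct (Z.ltb_spec q p); simpl; f_equal; ring.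
Qed.

(** The branch can be read off the result: the first leaves [a <= c], the second [c < a]. Orbits can
    thus be traced back uniquely. *)
Lemma cone_step_inj (n : Z) s s' :
  cone_state n s -> cone_state n s' -> cone_step s = cone_step s' -> s = s'.
Proof.
destruct s as [[[[[a b] c] d] p] q]; destruct s' as [[[[[a' b'] c'] d'] p'] q'].
unfold cone_step, cone_state.
destruct (Z.ltb_spec q p); destruct (Z.ltb_spec q' p'); intros H1 H2 E; injection E;
  intros; try (exfalso; lia); repeat f_equal; lia.
Qed.

Lemma cone_step_not_root (n : Z) s : cone_state n s -> ~ cone_root (cone_step s).
Proof.
destruct s as [[[[[a b] c] d] p] q]; unfold cone_step, cone_state, cone_root.
destruct (Z.ltb_spec q p); lia.
Qed.

Lemma cone_iter_state (n : Z) j s :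
  cone_state n s -> cone_state n (Nat.iter j cone_step s).
Proof. intros H; induction j as [|j IH]; [exact H|]; now apply cone_step_state. Qed.

Lemma cone_iter_vector j s : cone_vector (Nat.iter j cone_step s) = cone_vector s.
Proof. induction j as [|j IH]; [easy|]; simpl; now rewrite cone_step_vector. Qed.

Lemma cone_final_once (n : Z) j s :
  cone_state n s -> cone_final s -> ~ cone_final (Nat.iter (S j) cone_step s).
Proof.
intros Hs Hf.
assert (H : let '(a, b, c, d, p, q) := Nat.iter (S j) cone_step s in q = 0 /\ a <= c).
{ induction j as [|j IH].
  - destruct s as [[[[[a b] c] d] p] q]; unfold cone_state, cone_final in *; simpl.
    destruct (Z.ltb_spec q p); lia.
  - assert (Hs' := cone_iter_state n (S j) s Hs).
    change (Nat.iter (S (S j)) cone_step s)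
      with (cone_step (Nat.iter (S j) cone_step s)).
    destruct (Nat.iter (S j) cone_step s) as [[[[[a b] c] d] p] q].
    unfold cone_state in Hs'; simpl; destruct (Z.ltb_spec q p); lia. }
destruct (Nat.iter (S j) cone_step s) as [[[[[a b] c] d] p] q]; unfold cone_final; lia.
Qed.

Lemma cone_iter_add i j s :
  Nat.iter (i + j) cone_step s = Nat.iter i cone_step (Nat.iter j cone_step s).
Proof. induction i as [|i IH]; simpl; [easy|now rewrite IH]. Qed.

Lemma cone_final_unique (n : Z) i j s :
  cone_state n s -> cone_final (Nat.iter i cone_step s) ->
  cone_final (Nat.iter j cone_step s) ->
  Nat.iter i cone_step s = Nat.iter j cone_step s.
Proof.
assert (W : forall i j, (i <= j)%nat -> cone_state n s ->
  cone_final (Nat.iter i cone_step s) -> cone_final (Nat.iter j cone_step s) ->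
  Nat.iter i cone_step s = Nat.iter j cone_step s).
{ clear i j; intros i j Hij Hs Hi Hj.
  destruct (Nat.eq_dec i j) as [->|Hne]; [easy|exfalso].
  replace j with (S (j - i - 1) + i)%nat in Hj by lia.
  rewrite cone_iter_add in Hj; revert Hj.
  now apply (cone_final_once n), Hi; apply cone_iter_state. }
intros Hs Hi Hj; destruct (Nat.le_ge_cases i j); [now apply W|symmetry; now apply W].
Qed.

Lemma cone_root_unique (n : Z) i j s s' :
  cone_state n s -> cone_state n s' -> cone_root s -> cone_root s' ->
  Nat.iter i cone_step s = Nat.iter j cone_step s' -> s = s'.
Proof.
intros Hs Hs' Hr Hr'; revert j; induction i as [|i IH]; intros [|j] E.
- exact E.
- exfalso; simpl in E; rewrite E in Hr; revert Hr.
  apply (cone_step_not_root n), cone_iter_state, Hs'.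
- exfalso; simpl in E; rewrite <- E in Hr'; revert Hr'.
  apply (cone_step_not_root n), cone_iter_state, Hs.
- apply (IH j), (cone_step_inj n); [now apply cone_iter_state..|exact E].
Qed.

(** As in Euclid's algorithm, [p + q] decreases as long as [q > 0]. A step that brings [q] to 0
    takes the second branch, which makes [c < a]; at a root this holds already. *)
Lemma cone_reach_final (n : Z) s : cone_state n s -> cone_root s ->
  exists j, cone_final (Nat.iter j cone_step s).
Proof.
intros Hs Hr.
assert (H : forall N s, cone_state n s ->
  (let '(a, b, c, d, p, q) := s in (q = 0 -> c < a) /\ p + q < Z.of_nat N) ->
  exists j, cone_final (Nat.iter j cone_step s)).
{ clear s Hs Hr; induction N as [|N IH]; intros [[[[[a b] c] d] p] q] Hs [Hc HN].
  - unfold cone_state in Hs; lia.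
  - destruct (Z.eq_dec q 0) as [Hq|Hq].
    + exists 0%nat; simpl; auto.
    + destruct (IH (cone_step (a, b, c, d, p, q))) as [j Hj].
      * now apply cone_step_state.
      * unfold cone_state in Hs; simpl; destruct (Z.ltb_spec q p); split; lia.
      * exists (S j); rewrite Nat.iter_succ_r; exact Hj. }
destruct s as [[[[[a b] c] d] p] q].
apply (H (S (Z.to_nat (p + q))) _ Hs).
unfold cone_state, cone_root in *; lia.
Qed.

(** Every state that is not a root has a predecessor with smaller [a + b + c + d]. If [c < a] fails,
    positivity of the determinant gives [b < d] and the first branch is undone; if only [b < d]
    fails, the second is. *)
Lemma cone_reach_root (n : Z) s : 0 < n -> cone_state n s ->
  exists j s', cone_state n s' /\ cone_root s' /\ Nat.iter j cone_step s' = s.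
Proof.
intros Hn Hs.
assert (H : forall N s, cone_state n s ->
  (let '(a, b, c, d, p, q) := s in a + b + c + d < Z.of_nat N) ->
  exists j s', cone_state n s' /\ cone_root s' /\ Nat.iter j cone_step s' = s).
{ clear s Hs; induction N as [|N IH]; intros [[[[[a b] c] d] p] q] Hs HN.
  - unfold cone_state in Hs; lia.
  - assert (Hpred : forall s0, cone_state n s0 -> cone_step s0 = (a, b, c, d, p, q) ->
      (let '(a, b, c, d, p, q) := s0 in a + b + c + d < Z.of_nat N) ->
      exists j s', cone_state n s' /\ cone_root s'
                   /\ Nat.iter j cone_step s' = (a, b, c, d, p, q)).
    { intros s0 H0 E HN0; destruct (IH s0 H0 HN0) as [j [s' [H1 [H2 H3]]]].
      exists (S j), s'; repeat split; try assumption; simpl; now rewrite H3. }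
    unfold cone_state in Hs.
    destruct (Z_lt_le_dec c a) as [Hca|Hca]; [destruct (Z_lt_le_dec b d) as [Hbd|Hbd]|].
    + exists 0%nat, (a, b, c, d, p, q); unfold cone_state, cone_root; simpl; tauto.
    + apply (Hpred (a - c, b - d, c, d, p, q + p)).
      * unfold cone_state; repeat split; try lia; nia.
      * unfold cone_step; destruct (Z.ltb_spec (q + p) p); [lia|]; repeat f_equal; lia.
      * lia.
    + assert (b < d) by nia.
      apply (Hpred (a, b, c - a, d - b, p + q, q)).
      * unfold cone_state; repeat split; try lia; nia.
      * unfold cone_step; destruct (Z.ltb_spec q (p + q)); [|lia]; repeat f_equal; lia.
      * lia. }
destruct s as [[[[[a b] c] d] p] q].
apply (H (S (Z.to_nat (a + b + c + d))) _ Hs); unfold cone_state in Hs; lia.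
Qed.

(* With [l = gcd(a, b)], the final states over a vector [l (P, Q)] are counted by the [l]
   admissible residues of [c]. *)
Definition final_code (s : Z * Z * Z * Z * Z * Z) (t : Z * Z * Z * Z) : Prop :=
  let '(a, b, c, d, p, q) := s in
  let '(l, i, P, Q) := t in
  q = 0 /\ 0 < l /\ exists a' b', Z.gcd a' b' = 1 /\ a = l * a' /\ b = l * b' /\
    P = p * a' /\ Q = p * b' /\ 0 <= c - a' * i < a'.

Lemma final_code_fun (n : Z) s t t' : cone_state n s ->
  final_code s t -> final_code s t' -> t = t'.
Proof.
destruct s as [[[[[a b] c] d] p] q], t as [[[l i] P] Q], t' as [[[l2 i2] P2] Q2].
intros Hs [_ [Hl [a' [b' [G [Ea [Eb [EP [EQ Hc]]]]]]]]]
  [_ [Hl2 [a2 [b2 [G2 [Ea2 [Eb2 [EP2 [EQ2 Hc2]]]]]]]]].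
assert (E : l = l2).
{ assert (Z.gcd a b = l).
  { rewrite Ea, Eb, Z.gcd_mul_mono_l_nonneg, G by lia; lia. }
  assert (Z.gcd a b = l2).
  { rewrite Ea2, Eb2, Z.gcd_mul_mono_l_nonneg, G2 by lia; lia. }
  lia. }
subst l2; unfold cone_state in Hs.
assert (a' = a2) by (apply Z.mul_reg_l with l; lia); subst a2.
assert (b' = b2) by (apply Z.mul_reg_l with l; lia); subst b2.
assert (i = i2) by nia; subst; easy.
Qed.

(** The coefficient [p] is [gcd(P, Q)]. The determinant fixes [c] modulo [a'] by Gauss's lemma, and
    [i] selects the interval of length [a'] that contains [c]. *)
Lemma final_code_inj (n : Z) s s' t : cone_state n s -> cone_state n s' ->
  final_code s t -> final_code s' t -> s = s'.
Proof.
destruct s as [[[[[a b] c] d] p] q], s' as [[[[[a2 b2] c2] d2] p2] q2],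
  t as [[[l i] P] Q].
intros Hs Hs' [Hq [Hl [a' [b' [G [Ea [Eb [EP [EQ Hc]]]]]]]]]
  [Hq2 [_ [a3 [b3 [G2 [Ea2 [Eb2 [EP2 [EQ2 Hc2]]]]]]]]].
unfold cone_state in *.
assert (E : p = p2).
{ assert (Z.gcd P Q = p).
  { rewrite EP, EQ, Z.gcd_mul_mono_l_nonneg, G by lia; lia. }
  assert (Z.gcd P Q = p2).
  { rewrite EP2, EQ2, Z.gcd_mul_mono_l_nonneg, G2 by lia; lia. }
  lia. }
subst p2.
assert (a' = a3) by (apply Z.mul_reg_l with p; lia); subst a3.
assert (b' = b3) by (apply Z.mul_reg_l with p; lia); subst b3.
assert (Ha' : 0 < a') by nia.
assert (E : c = c2).
{ assert (D : (a' | b' * (c - c2))).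
  { exists (d - d2); apply Z.mul_reg_l with l; [lia|]; subst a b a2 b2; nia. }
  apply Z.gauss in D; [|exact G].
  destruct D as [m Hm]; assert (m = 0) by nia; subst m; lia. }
subst c2 a2 b2; assert (d = d2) by (apply Z.mul_reg_l with a; lia).
subst; easy.
Qed.

(** Writing [n = l m], one needs [a' d - b' c = m] with [c] in the interval of length [a'] numbered
    [i]. As [i < l], such a [c] is below [l a' = a], as a final state requires. *)
Lemma final_code_exists (n l i P Q : Z) :
  0 < n -> 0 < l -> (l | n) -> 0 <= i < l -> 1 <= P -> 0 <= Q ->
  exists s, cone_state n s /\ cone_final s /\ final_code s (l, i, P, Q).
Proof.
intros Hn Hl [m Hm] Hi HP HQ.
set (g := Z.gcd P Q).
assert (Hg : 0 < g).
{ assert (0 <= g) by apply Z.gcd_nonneg.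
  assert (g <> 0) by (intros E; apply Z.gcd_eq_0_l in E; lia); lia. }
destruct (Z.gcd_divide_l P Q) as [a' Ha]; fold g in Ha.
destruct (Z.gcd_divide_r P Q) as [b' Hb]; fold g in Hb.
assert (G : Z.gcd a' b' = 1).
{ apply Z.mul_reg_l with g; [lia|].
  rewrite <- Z.gcd_mul_mono_l_nonneg by lia.
  rewrite (Z.mul_comm g a'), (Z.mul_comm g b'), <- Ha, <- Hb; unfold g; lia. }
assert (Ha0 : 0 < a') by nia.
assert (Hb0 : 0 <= b') by nia.
destruct (Z.gcd_bezout a' b' 1 G) as [u [v Huv]].
set (c0 := (- m * v) mod a').
assert (Hc0 : 0 <= c0 < a') by (apply Z.mod_pos_bound; lia).
assert (Ec0 : - m * v = a' * ((- m * v) / a') + c0) by (apply Z.div_mod; lia).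
set (w := (- m * v) / a') in *.
set (c := c0 + a' * i).
(* The Bezout solution [(- m v, m u)] shifted by [i - w] times [(a', b')], which leaves the
   determinant unchanged. *)
set (d := m * u - b' * w + b' * i).
assert (Hd : a' * d - b' * c = m).
{ unfold d, c; replace c0 with (- m * v - a' * w) by lia.
  transitivity (m * (u * a' + v * b')); [ring|rewrite Huv; ring]. }
assert (Hm0 : 0 < m) by nia.
assert (Hc : 0 <= c) by (unfold c; nia).
exists (l * a', l * b', c, d, g, 0); repeat split; try nia.
exists a', b'; repeat split; try lia; unfold c; lia.
Qed.

Lemma final_code_of_state (n : Z) s : cone_state n s -> cone_final s ->
  exists l i P Q, final_code s (l, i, P, Q) /\ 0 < l /\ (l | n) /\ 0 <= i < l /\
    1 <= P /\ 0 <= Q.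
Proof.
destruct s as [[[[[a b] c] d] p] q]; unfold cone_state, cone_final.
intros Hs [Hq Hc].
set (l := Z.gcd a b).
assert (Hl : 0 < l).
{ assert (0 <= l) by apply Z.gcd_nonneg.
  assert (l <> 0) by (intros E; apply Z.gcd_eq_0_l in E; lia); lia. }
destruct (Z.gcd_divide_l a b) as [a' Ha]; fold l in Ha.
destruct (Z.gcd_divide_r a b) as [b' Hb]; fold l in Hb.
assert (G : Z.gcd a' b' = 1).
{ apply Z.mul_reg_l with l; [lia|].
  rewrite <- Z.gcd_mul_mono_l_nonneg by lia.
  rewrite (Z.mul_comm l a'), (Z.mul_comm l b'), <- Ha, <- Hb; unfold l; lia. }
assert (Ha0 : 0 < a') by nia.
assert (Hb0 : 0 <= b') by nia.
assert (Hdm := Z.div_mod c a' ltac:(lia)).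
assert (Hmb := Z.mod_pos_bound c a' Ha0).
assert (Hi0 : 0 <= c / a') by (apply Z.div_pos; lia).
exists l, (c / a'), (p * a'), (p * b'); repeat split; try lia; try nia.
- exists a', b'; repeat split; lia.
- exists (a' * d - b' * c).
  destruct Hs as (_ & _ & _ & _ & E & _); rewrite <- E, Ha, Hb; ring.
Qed.

Local Close Scope Z_scope.

(** * Summation over matrices and divisors *)

Definition matrix_state (z : (Z * Z * Z * Z) * (nat * nat)) : Z * Z * Z * Z * Z * Z :=
  let '((a, b, c, d), (p, q)) := z in (a, b, c, d, Z.of_nat p, Z.of_nat q).

Definition vector_code (t : (nat * nat) * (nat * nat)) : Z * Z * Z * Z :=
  let '((l, i), (p, q)) := t in (Z.of_nat l, Z.of_nat i, Z.of_nat p, Z.of_nat q).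

Definition cone_rel (n : nat) z t : Prop :=
  cone_state (Z.of_nat n) (matrix_state z) /\ cone_root (matrix_state z) /\
  exists j, cone_final (Nat.iter j cone_step (matrix_state z)) /\
    final_code (Nat.iter j cone_step (matrix_state z)) (vector_code t).

Lemma NoDup_list_prod {A B : Type} (l : list A) (l' : list B) :
  NoDup l -> NoDup l' -> NoDup (list_prod l l').
Proof.
intros Hl Hl'; induction Hl as [|x l Hx Hl IH]; simpl; [constructor|].
apply NoDup_app; [|exact IH|].
- apply Injective_map_NoDup; [|exact Hl'].
  intros u v E; now injection E.
- intros [u v] Hu Hv; apply in_map_iff in Hu; destruct Hu as [w [E _]].
  apply in_prod_iff in Hv; injection E as -> _; tauto.
Qed.

Lemma cone_rel_fun n z t t' : cone_rel n z t -> cone_rel n z t' -> t = t'.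
Proof.
intros [Hs [Hr [j [Hf Hc]]]] [_ [_ [j' [Hf' Hc']]]].
rewrite (cone_final_unique _ j' j _ Hs Hf' Hf) in Hc'.
assert (E : vector_code t = vector_code t').
{ apply (final_code_fun (Z.of_nat n) _ _ _ (cone_iter_state _ _ _ Hs) Hc Hc'). }
destruct t as [[l i] [p q]], t' as [[l' i'] [p' q']]; simpl in E; injection E.
intros; repeat f_equal; lia.
Qed.

Lemma cone_rel_inj n z z' t : cone_rel n z t -> cone_rel n z' t -> z = z'.
Proof.
intros [Hs [Hr [j [_ Hc]]]] [Hs' [Hr' [j' [_ Hc']]]].
assert (E : matrix_state z = matrix_state z').
{ apply (cone_root_unique (Z.of_nat n) j j'); try assumption.
  apply (final_code_inj (Z.of_nat n) _ _ (vector_code t)); try assumption;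
    now apply cone_iter_state. }
destruct z as [[[[a b] c] d] [p q]], z' as [[[[a' b'] c'] d'] [p' q']]; simpl in E.
injection E; intros; repeat f_equal; lia.
Qed.

Lemma cone_rel_vector n a b c d p q l i P Q :
  cone_rel n ((a, b, c, d), (p, q)) ((l, i), (P, Q)) ->
  (Z.of_nat p * a + Z.of_nat q * c = Z.of_nat l * Z.of_nat P)%Z /\
  (Z.of_nat p * b + Z.of_nat q * d = Z.of_nat l * Z.of_nat Q)%Z.
Proof.
intros [_ [_ [j [_ Hc]]]].
assert (E := cone_iter_vector j (matrix_state ((a, b, c, d), (p, q)))).
destruct (Nat.iter j _ _) as [[[[[a1 b1] c1] d1] p1] q1].
destruct Hc as [-> [_ [a' [b' [_ [-> [-> [EP [EQ _]]]]]]]]].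
simpl in E; injection E; intros H1 H2; rewrite EP, EQ; split; lia.
Qed.

Lemma cone_rel_value n a b c d p q l i P Q (x : R) :
  cone_rel n ((a, b, c, d), (p, q)) ((l, i), (P, Q)) ->
  INR p * (IZR a * x + IZR b) + INR q * (IZR c * x + IZR d)
  = INR P * (INR l * x) + INR Q * INR l.
Proof.
intros H; destruct (cone_rel_vector _ _ _ _ _ _ _ _ _ _ _ H) as [H1 H2].
apply (f_equal IZR) in H1, H2; rewrite !plus_IZR, !mult_IZR, <- !INR_IZR_INZ in H1, H2.
transitivity ((INR p * IZR a + INR q * IZR c) * x + (INR p * IZR b + INR q * IZR d));
  [ring|rewrite H1, H2; ring].
Qed.

Lemma cut_neq_0 (X : R) (f : R -> R) (y : R) : cut X f y <> 0 -> y <= X.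
Proof. unfold cut; destruct (Rle_dec y X); [easy|intros H; now elim H]. Qed.

(** The weight [l] is unfolded into [l] copies indexed by [i], to be matched with pairs of a matrix
    and coefficients through the Euclidean orbit. The orbit preserves the vector, hence the argument
    of [cut], and the bounds on [B] make both boxes contain every point below the cutoff. *)
Lemma hecke_cone_sum (n B : nat) (x X : R) (f : R -> R) :
  (0 < n)%nat -> 0 < x -> X < INR B * x -> X < INR B ->
  lsum (hecke_matrices n) (fun '(a, b, c, d) =>
    lsum (seq 1 B) (fun p => lsum (seq 0 B) (fun q =>
      cut X f (INR p * (IZR a * x + IZR b) + INR q * (IZR c * x + IZR d)))))
  = lsum (divisors n) (fun l => INR l *
      lsum (seq 1 B) (fun p => lsum (seq 0 B) (fun q =>
        cut X f (INR p * (INR l * x) + INR q * INR l)))).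
Proof.
intros Hn Hx HBx HB.
set (F := fun '((a, b, c, d), (p, q)) =>
  cut X f (INR p * (IZR a * x + IZR b) + INR q * (IZR c * x + IZR d))).
(* All divisors share the range [seq 0 n] for [i], so that the index set is a plain product; the
   summand is 0 for [i >= l]. *)
set (G := fun '((l, i), (p, q)) => if (i <? l)%nat then
  cut X f (INR p * (INR l * x) + INR q * INR l) else 0).
transitivity (lsum (list_prod (hecke_matrices n) (list_prod (seq 1 B) (seq 0 B))) F).
{ rewrite lsum_prod; apply lsum_ext; intros [[[a b] c] d] _.
  rewrite lsum_prod; reflexivity. }
transitivity (lsum (list_prod (list_prod (divisors n) (seq 0 n))
                      (list_prod (seq 1 B) (seq 0 B))) G).
2:{ rewrite lsum_prod, lsum_prod; apply lsum_ext; intros l Hl.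
    apply In_divisors in Hl; [|exact Hn].
    apply Nat.divide_pos_le in Hl; [|exact Hn].
    set (S := lsum (seq 1 B) (fun p => lsum (seq 0 B) (fun q =>
        cut X f (INR p * (INR l * x) + INR q * INR l)))).
    replace n with (l + (n - l))%nat by lia.
    rewrite seq_app, lsum_app, (lsum_zero (seq (0 + l) _)).
    - rewrite (lsum_ext _ _ (fun _ => S)).
      + rewrite lsum_const, length_seq; ring.
      + intros i Hi; apply in_seq in Hi; rewrite lsum_prod.
        apply lsum_ext; intros p _; apply lsum_ext; intros q _; unfold G.
        destruct (Nat.ltb_spec i l); [easy|lia].
    - intros i Hi; apply in_seq in Hi; apply lsum_zero; intros [p q] _; unfold G.
      destruct (Nat.ltb_spec i l); [lia|easy]. }
apply (lsum_correspondence _ _ F G (cone_rel n)).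
- apply NoDup_list_prod; [apply NoDup_hecke_matrices|].
  apply NoDup_list_prod; apply seq_NoDup.
- apply NoDup_list_prod; apply NoDup_list_prod; try apply seq_NoDup.
  apply NoDup_divisors.
- intros [[[[a b] c] d] [p q]] Hin HF; unfold F in HF; apply cut_neq_0 in HF.
  rewrite !in_prod_iff, In_hecke_matrices, !in_seq in Hin.
  destruct Hin as [(Hc & Hb & Hdet) [Hp Hq]].
  assert (Hs : cone_state (Z.of_nat n) (matrix_state ((a, b, c, d), (p, q)))).
  { unfold matrix_state, cone_state; repeat split; lia. }
  assert (Hr : cone_root (matrix_state ((a, b, c, d), (p, q)))).
  { unfold matrix_state, cone_root; lia. }
  destruct (cone_reach_final _ _ Hs Hr) as [j Hj].
  destruct (final_code_of_state _ _ (cone_iter_state _ j _ Hs) Hj)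
    as (l & i & P & Q & Hcode & Hl & Hln & Hi & HP & HQ).
  assert (Hrel : cone_rel n ((a, b, c, d), (p, q))
     ((Z.to_nat l, Z.to_nat i), (Z.to_nat P, Z.to_nat Q))).
  { split; [exact Hs|split; [exact Hr|]]; exists j; split; [exact Hj|].
    unfold vector_code; rewrite !Z2Nat.id by lia; exact Hcode. }
  exists ((Z.to_nat l, Z.to_nat i), (Z.to_nat P, Z.to_nat Q)); split; [|exact Hrel].
  rewrite (cone_rel_value _ _ _ _ _ _ _ _ _ _ _ x Hrel) in HF.
  assert (Hl1 : 1 <= INR (Z.to_nat l)) by (apply (le_INR 1); lia).
  assert (HP0 := pos_INR (Z.to_nat P)); assert (HQ0 := pos_INR (Z.to_nat Q)).
  assert (HPx : 0 <= INR (Z.to_nat P) * x) by (apply Rmult_le_pos; lra).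
  assert (HPB : (Z.to_nat P < B)%nat).
  { apply INR_lt, Rmult_lt_reg_r with x; [lra|]; nra. }
  assert (HQB : (Z.to_nat Q < B)%nat) by (apply INR_lt; nra).
  assert (Hln' : Nat.divide (Z.to_nat l) n).
  { destruct Hln as [m Hm]; exists (Z.to_nat m); nia. }
  assert (Hle := Nat.divide_pos_le _ _ Hn Hln').
  rewrite !in_prod_iff, In_divisors, !in_seq by exact Hn; repeat split; try lia.
  exact Hln'.
- intros [[l i] [P Q]] Hin HG; unfold G in HG.
  rewrite !in_prod_iff, In_divisors, !in_seq in Hin by exact Hn.
  destruct Hin as [[Hl Hi] [HP HQ]].
  destruct (Nat.ltb_spec i l) as [Hil|]; [|now elim HG].
  apply cut_neq_0 in HG.
  destruct (final_code_exists (Z.of_nat n) (Z.of_nat l) (Z.of_nat i) (Z.of_nat P)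
    (Z.of_nat Q)) as [s [Hs [Hf Hcode]]]; try lia.
  { destruct Hl as [m ->]; exists (Z.of_nat m); lia. }
  destruct (cone_reach_root (Z.of_nat n) s ltac:(lia) Hs) as [j [s' [Hs' [Hr E]]]].
  destruct s' as [[[[[a b] c] d] p] q].
  assert (Hs0 := Hs'); unfold cone_state in Hs0; unfold cone_root in Hr.
  assert (Hrel : cone_rel n ((a, b, c, d), (Z.to_nat p, Z.to_nat q)) ((l, i), (P, Q))).
  { unfold cone_rel, matrix_state; rewrite !Z2Nat.id by lia.
    split; [exact Hs'|split; [exact Hr|]]; exists j; rewrite E; now split. }
  exists ((a, b, c, d), (Z.to_nat p, Z.to_nat q)); split; [|exact Hrel].
  rewrite <- (cone_rel_value _ _ _ _ _ _ _ _ _ _ _ x Hrel) in HG.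
  assert (Ha : 1 <= IZR a) by (apply IZR_le; lia).
  assert (Hd : 1 <= IZR d) by (apply IZR_le; lia).
  assert (Hb : 0 <= IZR b) by (apply IZR_le; lia).
  assert (Hc : 0 <= IZR c) by (apply IZR_le; lia).
  assert (Hp0 := pos_INR (Z.to_nat p)); assert (Hq0 := pos_INR (Z.to_nat q)).
  assert (Hcx : 0 <= IZR c * x) by (apply Rmult_le_pos; lra).
  assert (Hax : x <= IZR a * x) by nra.
  assert (Hpu : INR (Z.to_nat p) * x <= INR (Z.to_nat p) * (IZR a * x + IZR b))
    by (apply Rmult_le_compat_l; lra).
  assert (Hqv : INR (Z.to_nat q) * 1 <= INR (Z.to_nat q) * (IZR c * x + IZR d))
    by (apply Rmult_le_compat_l; lra).
  assert (Hpx : 0 <= INR (Z.to_nat p) * x) by (apply Rmult_le_pos; lra).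
  assert (HpB : (Z.to_nat p < B)%nat).
  { apply INR_lt, Rmult_lt_reg_r with x; lra. }
  assert (HqB : (Z.to_nat q < B)%nat) by (apply INR_lt; lra).
  rewrite !in_prod_iff, In_hecke_matrices, !in_seq; repeat split; lia.
- intros [[[[a b] c] d] [p q]] [[l i] [P Q]] _ _ Hrel; unfold F, G.
  rewrite (cone_rel_value _ _ _ _ _ _ _ _ _ _ _ x Hrel).
  destruct (Nat.ltb_spec i l) as [|Hil]; [easy|exfalso].
  assert (Hs := proj1 Hrel).
  destruct Hrel as [_ [_ [j [Hf Hc]]]].
  assert (Hs' := cone_iter_state _ j _ Hs).
  destruct (Nat.iter j _ _) as [[[[[a1 b1] c1] d1] p1] q1].
  destruct Hc as [_ [_ [a' [b' [_ [Ea [_ [_ [_ Hc]]]]]]]]].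
  unfold cone_final in Hf; assert (0 < a')%Z by lia; nia.
- intros; eapply cone_rel_fun; eassumption.
- intros; eapply cone_rel_inj; eassumption.
Qed.

(** * From regularized cone sums to the real identities *)

Definition cone_term (gamma : nat -> R) (k : nat) (u v : R) : R :=
  dphi_cone k u v - log_poly gamma k (ln u) / (u * v).

(** The coefficient of the divergent term that is left when matrices and divisors are compared:
    about [X ^ 2 / (2 u v)] points of a cone have size at most [X], so [1 / (u v)] measures its
    density. *)
Definition covolume_defect (n : nat) (x : R) : R :=
  lsum (hecke_matrices n)
    (fun '(a, b, c, d) => / ((IZR a * x + IZR b) * (IZR c * x + IZR d)))
  - lsum (divisors n) (fun l => INR l * / (INR l * x * INR l)).

Lemma hecke_matrix_pos (n : nat) (x : R) (a b c d : Z) :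
  0 < x -> In (a, b, c, d) (hecke_matrices n) ->
  x <= IZR a * x + IZR b /\ 1 <= IZR c * x + IZR d.
Proof.
intros Hx H; apply In_hecke_matrices in H.
assert (Ha : 1 <= IZR a) by (apply IZR_le; lia).
assert (Hd : 1 <= IZR d) by (apply IZR_le; lia).
assert (Hb : 0 <= IZR b) by (apply IZR_le; lia).
assert (Hc : 0 <= IZR c) by (apply IZR_le; lia).
split; nra.
Qed.

Lemma hecke_cone_lim (gamma : nat -> R) (k n : nat) (x : R) :
  stieltjes_limits gamma -> (0 < k)%nat -> (0 < n)%nat -> 0 < x ->
  is_lim_seq (fun m => - covolume_defect n x
                       * (logp k (INR m) - INR m * dlogp k (INR m)))
    (lsum (hecke_matrices n) (fun '(a, b, c, d) =>
       cone_term gamma k (IZR a * x + IZR b) (IZR c * x + IZR d))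
     - lsum (divisors n) (fun l => INR l * cone_term gamma k (INR l * x) (INR l))).
Proof.
intros Hg Hk Hn Hx.
(* One box must serve all cones. They satisfy [u >= x] and [v >= 1], and this [K] makes both [K] and
   [K * x] exceed 1, so [(m + 1) * K] steps of either length pass [m]. *)
destruct (INR_unbounded (1 + / x)) as [K HK].
assert (Hix : 0 < / x) by now apply Rinv_0_lt_compat.
assert (HKx : 1 < INR K * x).
{ apply Rmult_lt_reg_r with (/ x); [lra|]; rewrite Rmult_assoc, Rinv_r by lra; lra. }
set (B := fun m => (S m * K)%nat).
assert (HB : forall m w, x <= w \/ 1 <= w -> INR m < INR (B m) * w).
{ intros m w Hw; unfold B; rewrite mult_INR, S_INR; assert (Hm := pos_INR m).
  assert (1 < INR K * w) by (destruct Hw; nra); nra. }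
set (sq := fun m u v => lsum (seq 1 (B m)) (fun p => lsum (seq 0 (B m)) (fun q =>
      cut (INR m) (glogp k) (INR p * u + INR q * v)))).
set (vol := fun m => logp k (INR m) - INR m * dlogp k (INR m)).
assert (Hlim : forall u v, x <= u -> 1 <= v ->
  is_lim_seq (fun m => sq m u v - vol m / (u * v)) (cone_term gamma k u v)).
{ intros u v Hu Hv; apply (cut_cone_lim k u v _ B); try assumption; try lra.
  - intros m; apply Rlt_le, HB; now left.
  - intros m; apply HB; now right.
  - apply cone_lim; assumption || lra. }
apply (is_lim_seq_ext (fun m =>
  lsum (hecke_matrices n) (fun '(a, b, c, d) =>
    sq m (IZR a * x + IZR b) (IZR c * x + IZR d)
    - vol m / ((IZR a * x + IZR b) * (IZR c * x + IZR d)))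
  - lsum (divisors n) (fun l => INR l *
     (sq m (INR l * x) (INR l) - vol m / (INR l * x * INR l))))).
- intros m.
  rewrite (lsum_ext (hecke_matrices n) _ (fun z =>
    (fun '(a, b, c, d) => sq m (IZR a * x + IZR b) (IZR c * x + IZR d)) z
    - vol m * (fun '(a, b, c, d) =>
        / ((IZR a * x + IZR b) * (IZR c * x + IZR d))) z))
    by (intros [[[a b] c] d] _; reflexivity).
  rewrite (lsum_ext (divisors n) _ (fun l => INR l * sq m (INR l * x) (INR l)
    - vol m * (INR l * / (INR l * x * INR l)))) by (intros; unfold Rdiv; ring).
  rewrite !lsum_minus, !lsum_scal; unfold sq.
  rewrite (hecke_cone_sum n (B m) x (INR m) (glogp k)); try assumption.
  + unfold covolume_defect, vol; ring.
  + apply HB; left; lra.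
  + rewrite <- (Rmult_1_r (INR (B m))); apply HB; right; lra.
- apply is_lim_seq_minus'.
  + apply (is_lim_seq_ext (fun m => lsum (hecke_matrices n) (fun z =>
      (fun z m => let '(a, b, c, d) := z in
         sq m (IZR a * x + IZR b) (IZR c * x + IZR d)
         - vol m / ((IZR a * x + IZR b) * (IZR c * x + IZR d))) z m))).
    { intros m; apply lsum_ext; intros [[[a b] c] d] _; reflexivity. }
    apply is_lim_seq_lsum; intros [[[a b] c] d] Hin.
    apply (hecke_matrix_pos n x) in Hin; [|exact Hx].
    now apply Hlim.
  + apply (is_lim_seq_lsum (divisors n) (fun l m => INR l *
     (sq m (INR l * x) (INR l) - vol m / (INR l * x * INR l)))).
    intros l Hl; apply is_lim_seq_mult_l, Hlim;
    (apply In_divisors in Hl; [|exact Hn]); destruct Hl as [r Hr];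
    assert (1 <= INR l) by (apply (le_INR 1); destruct l; lia); nra.
Qed.

(* For k = 1 the sequence of [hecke_cone_lim] is [(1 - ln m)] times the defect. *)
Lemma covolume_defect_0 (gamma : nat -> R) (n : nat) (x : R) :
  stieltjes_limits gamma -> (0 < n)%nat -> 0 < x -> covolume_defect n x = 0.
Proof.
intros Hg Hn Hx.
assert (H := hecke_cone_lim gamma 1 n x Hg ltac:(lia) Hn Hx).
set (L := lsum _ _ - _) in H; clearbody L.
destruct (Req_dec (covolume_defect n x) 0) as [|Hne]; [assumption|exfalso].
assert (Hln : is_lim_seq (fun m => ln (INR m)) p_infty).
{ apply (is_lim_comp_seq ln _ p_infty p_infty);
    [apply is_lim_ln_p|exists 0%nat; easy|apply is_lim_seq_INR]. }
assert (Hfin : is_lim_seq (fun m => ln (INR m)) (1 - L / covolume_defect n x)).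
{ apply (is_lim_seq_ext_loc (fun m => 1 + (- covolume_defect n x
       * (logp 1 (INR m) - INR m * dlogp 1 (INR m))) * - / covolume_defect n x)).
  - exists 1%nat; intros m Hm.
    assert (0 < INR m) by (apply lt_0_INR; lia).
    unfold logp, dlogp; simpl; field; split; [exact Hne|lra].
  - replace (1 - L / covolume_defect n x) with (1 + L * - / covolume_defect n x)
      by (field; exact Hne).
    apply is_lim_seq_plus'; [apply is_lim_seq_const|now apply is_lim_seq_mult_r]. }
apply is_lim_seq_unique in Hln; apply is_lim_seq_unique in Hfin; congruence.
Qed.

Lemma hecke_cone_identity (gamma : nat -> R) (k n : nat) (x : R) :
  stieltjes_limits gamma -> (0 < k)%nat -> (0 < n)%nat -> 0 < x ->
  lsum (hecke_matrices n) (fun '(a, b, c, d) =>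
       cone_term gamma k (IZR a * x + IZR b) (IZR c * x + IZR d))
  = lsum (divisors n) (fun l => INR l * cone_term gamma k (INR l * x) (INR l)).
Proof.
intros Hg Hk Hn Hx.
assert (H := hecke_cone_lim gamma k n x Hg Hk Hn Hx).
rewrite (covolume_defect_0 gamma n x Hg Hn Hx) in H.
apply (is_lim_seq_ext _ (fun _ => 0)) in H; [|intros; ring].
apply is_lim_seq_unique in H; rewrite Lim_seq_const in H.
injection H; lra.
Qed.

Lemma hecke_dphi_identity (gamma : nat -> R) (k n : nat) (x : R) :
  is_stieltjes gamma -> (0 < k)%nat -> (0 < n)%nat -> 0 < x ->
  lsum (seq 1 k) (fun r => Binomial.C k r *
    (lsum (hecke_matrices n) (fun '(a, b, c, d) =>
       ln (IZR c * x + IZR d) ^ (k - r) / (IZR c * x + IZR d) ^ 2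
       * dphi r ((IZR a * x + IZR b) / (IZR c * x + IZR d)))
     - lsum (divisors n) (fun l => ln (INR l) ^ (k - r) / INR l * dphi r x)))
  = lsum (seq 1 k) (fun r => Binomial.C k r * gamma_tilde gamma (k - r) *
    (lsum (hecke_matrices n) (fun '(a, b, c, d) =>
       ln (IZR a * x + IZR b) ^ r / ((IZR a * x + IZR b) * (IZR c * x + IZR d)))
     - lsum (divisors n) (fun l => ln (INR l * x) ^ r / (INR l * x)))).
Proof.
intros Hst Hk Hn Hx; apply is_stieltjes_limits in Hst.
assert (H := hecke_cone_identity gamma k n x Hst Hk Hn Hx).
assert (H0 := covolume_defect_0 gamma n x Hst Hn Hx); unfold covolume_defect in H0.
set (u := fun z : Z * Z * Z * Z => let '(a, b, c, d) := z in IZR a * x + IZR b).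
set (v := fun z : Z * Z * Z * Z => let '(a, b, c, d) := z in IZR c * x + IZR d).
assert (Huv : forall (f : R -> R -> R),
  lsum (hecke_matrices n) (fun '(a, b, c, d) => f (IZR a * x + IZR b) (IZR c * x + IZR d))
  = lsum (hecke_matrices n) (fun z => f (u z) (v z))).
{ intros f; apply lsum_ext; intros [[[a b] c] d] _; reflexivity. }
rewrite (Huv (cone_term gamma k)) in H; rewrite (Huv (fun u v => / (u * v))) in H0.
assert (Hl0 : forall l, In l (divisors n) -> 0 < INR l).
{ intros l Hl; apply In_divisors in Hl; [|exact Hn]; destruct Hl as [q Hq].
  apply lt_0_INR; destruct l; lia. }
assert (Hdiv : forall f g : nat -> R, (forall l, 0 < INR l -> f l = g l) ->
  lsum (divisors n) f = lsum (divisors n) g).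
{ intros f g E; apply lsum_ext; intros l Hl; now apply E, Hl0. }
set (P0 := gamma_tilde gamma k).
set (Q := fun L => lsum (seq 1 k) (fun r =>
  Binomial.C k r * gamma_tilde gamma (k - r) * L ^ r)).
assert (HQ : forall L, log_poly gamma k L = P0 + Q L).
{ intros L; unfold log_poly; change (seq 0 (S k)) with (0%nat :: seq 1 k).
  rewrite lsum_cons, C_n_0, Nat.sub_0_r; unfold P0, Q; simpl; ring. }
transitivity (lsum (hecke_matrices n) (fun z => dphi_cone k (u z) (v z))
  - lsum (divisors n) (fun l => INR l * dphi_cone k (INR l * x) (INR l))).
{ unfold dphi_cone; rewrite (lsum_swap (hecke_matrices n)).
  (* For a divisor the cone is spanned by [l x] and [l]: the ratio is [x], and the weight [l]
     reduces [1 / l ^ 2] to [1 / l]. *)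
  rewrite (Hdiv _ (fun l => lsum (seq 1 k) (fun r =>
    Binomial.C k r * (ln (INR l) ^ (k - r) / INR l * dphi r x)))).
  2:{ intros l Hl; rewrite <- lsum_scal; apply lsum_ext; intros r _.
      replace (INR l * x / INR l) with x by (field; lra); field; lra. }
  rewrite (lsum_swap (divisors n)), <- lsum_minus; apply lsum_ext; intros r _.
  rewrite (Huv (fun u v => ln v ^ (k - r) / v ^ 2 * dphi r (u / v))).
  rewrite Rmult_minus_distr_l, <- !lsum_scal.
  f_equal; apply lsum_ext; intros; ring. }
transitivity (lsum (hecke_matrices n) (fun z => Q (ln (u z)) * / (u z * v z))
  - lsum (divisors n) (fun l => Q (ln (INR l * x)) * / (INR l * x))).
- unfold cone_term in H; rewrite lsum_minus in H.
  rewrite (lsum_ext (hecke_matrices n)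
    (fun z => log_poly gamma k (ln (u z)) / (u z * v z))
    (fun z => P0 * / (u z * v z) + Q (ln (u z)) * / (u z * v z))) in H
    by (intros; rewrite HQ; unfold Rdiv; ring).
  rewrite (Hdiv (fun l => INR l * (dphi_cone k (INR l * x) (INR l)
      - log_poly gamma k (ln (INR l * x)) / (INR l * x * INR l)))
    (fun l => INR l * dphi_cone k (INR l * x) (INR l)
      - (P0 * (INR l * / (INR l * x * INR l)) + Q (ln (INR l * x)) * / (INR l * x)))) in H.
  2:{ intros l Hl; rewrite HQ; field; lra. }
  rewrite lsum_minus, !lsum_plus, !lsum_scal in H.
  apply (f_equal (Rmult P0)) in H0; lra.
- rewrite (lsum_ext (hecke_matrices n) _ (fun z => lsum (seq 1 k) (fun r =>
    Binomial.C k r * gamma_tilde gamma (k - r) * (ln (u z) ^ r / (u z * v z))))).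
  2:{ intros z _; unfold Q; rewrite Rmult_comm, <- lsum_scal; apply lsum_ext.
      intros; unfold Rdiv; ring. }
  rewrite (lsum_ext (divisors n) _ (fun l => lsum (seq 1 k) (fun r =>
    Binomial.C k r * gamma_tilde gamma (k - r) * (ln (INR l * x) ^ r / (INR l * x))))).
  2:{ intros z _; unfold Q; rewrite Rmult_comm, <- lsum_scal; apply lsum_ext.
      intros; unfold Rdiv; ring. }
  rewrite !(lsum_swap _ (seq 1 k)), <- lsum_minus; apply lsum_ext; intros r _.
  rewrite (Huv (fun u v => ln u ^ r / (u * v))), !lsum_scal; ring.
Qed.

Lemma hecke_2_dphi_identity (gamma : nat -> R) (k : nat) (x : R) :
  is_stieltjes gamma -> (0 < k)%nat -> 0 < x ->
  lsum (seq 1 k) (fun r => Binomial.C k r *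
    (ln 2 ^ (k - r) / 2 * (1 / 2 * dphi r (x / 2) + 1 / 2 * dphi r ((x + 1) / 2)
       - dphi r x)
     + ln (x + 1) ^ (k - r) / (x + 1) ^ 2 * dphi r (2 * x / (x + 1))))
  = dphi k x - dphi k (2 * x) +
    lsum (seq 1 k) (fun r => Binomial.C k r * gamma_tilde gamma (k - r) *
      (ln (x + 1) ^ r / (2 * (x + 1)) + ln (2 * x) ^ r / (2 * x * (x + 1))
       - ln x ^ r / (2 * x))).
Proof.
intros Hst Hk Hx.
assert (H := hecke_dphi_identity gamma k 2 x Hst Hk ltac:(lia) Hx).
replace (hecke_matrices 2) with
  [(1, 0, 0, 2); (1, 1, 0, 2); (2, 0, 0, 1); (2, 0, 1, 1)]%Z in H by reflexivity.
change (divisors 2) with [1; 2]%nat in H.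
(* The matrix [(2, 0, 0, 1)] and the divisor 1 carry the weight [ln 1 ^ (k - r) = 0 ^ (k - r)],
   which is 1 for [r = k] and 0 otherwise. This produces the two terms outside the binomial sum. *)
assert (Hdiag : lsum (seq 1 k) (fun r =>
   Binomial.C k r * (0 ^ (k - r) * (dphi r (2 * x) - dphi r x)))
   = dphi k (2 * x) - dphi k x).
{ destruct k as [|k]; [lia|]; rewrite lsum_seq_S, lsum_zero.
  - change (1 + k)%nat with (S k); rewrite C_n_n, Nat.sub_diag; simpl; ring.
  - intros r Hr; apply in_seq in Hr; rewrite pow_ne_zero by lia; ring. }
match goal with |- ?L = _ =>
  replace L with (L + lsum (seq 1 k) (fun r =>
    Binomial.C k r * (0 ^ (k - r) * (dphi r (2 * x) - dphi r x)))
    - (dphi k (2 * x) - dphi k x)) by lra end.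
rewrite <- lsum_plus.
match type of H with ?A = ?B => transitivity (A - (dphi k (2 * x) - dphi k x)) end.
- f_equal; apply lsum_ext; intros r _; unfold lsum; simpl map; simpl fold_right.
  replace (0 * x + 2) with 2 by ring; replace (0 * x + 1) with 1 by ring.
  replace (1 * x + 0) with x by ring; replace (1 * x + 1) with (x + 1) by ring.
  replace (2 * x + 0) with (2 * x) by ring.
  simpl INR; replace (1 + 1) with 2 by ring; rewrite ln_1, Rdiv_1_r.
  field; lra.
(* On the right-hand side the matrix [(2, 0, 0, 1)] cancels the divisor 2, and [(1, 0, 0, 2)]
   together with the divisor 1 leaves [- ln x ^ r / (2 * x)]. *)
- rewrite H; unfold Rminus at 1; rewrite Rplus_comm; f_equal; [ring|].
  apply lsum_ext; intros r _; unfold lsum; simpl map; simpl fold_right.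
  replace (0 * x + 2) with 2 by ring; replace (0 * x + 1) with 1 by ring.
  replace (1 * x + 0) with x by ring; replace (1 * x + 1) with (x + 1) by ring.
  replace (2 * x + 0) with (2 * x) by ring.
  simpl INR; replace (1 + 1) with 2 by ring; rewrite Rmult_1_l.
  field; lra.
Qed.

(** * Transfer to complex-valued sums *)

Lemma Csum_RtoC {A : Type} (l : list A) (f : A -> C) (g : A -> R) :
  (forall a, In a l -> f a = RtoC (g a)) -> Csum l f = RtoC (lsum l g).
Proof.
induction l as [|a l IH]; intros H; [easy|].
change (Csum (a :: l) f) with (f a + Csum l f)%C.
rewrite lsum_cons, RtoC_plus, H by now left.
f_equal; apply IH; intros b Hb; apply H; now right.
Qed.

Lemma sum_n_m_RtoC (k : nat) (f : nat -> C) (g : nat -> R) :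
  (forall r, (1 <= r <= k)%nat -> f r = RtoC (g r)) ->
  sum_n_m f 1 k = RtoC (lsum (seq 1 k) g).
Proof.
induction k as [|k IH]; intros H.
- rewrite sum_n_m_zero by lia; reflexivity.
- rewrite sum_n_Sm by lia; rewrite lsum_seq_S, RtoC_plus, IH by (intros; apply H; lia).
  rewrite H by lia; reflexivity.
Qed.

Theorem corollary1p4 (gamma : nat -> R) (Hgamma : is_stieltjes gamma)
  (k : nat) (Hk : (0 < k)%nat) (x : R) (Hx : (0 < x)%R) :
  (forall n : nat, (0 < n)%nat ->
     sum_n_m (fun r =>
       RtoC (Binomial.C k r) *
       (Csum (hecke_matrices n) (fun '(a, b, c, d) =>
          RtoC (ln (IZR c * x + IZR d) ^ (k - r) / (IZR c * x + IZR d) ^ 2) *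
          dPhi r ((IZR a * x + IZR b) / (IZR c * x + IZR d)))
        - Csum (divisors n) (fun l =>
            RtoC (ln (INR l) ^ (k - r) / INR l) * dPhi r x)))%C 1 k
     =
     sum_n_m (fun r =>
       RtoC (Binomial.C k r * gamma_tilde gamma (k - r)) *
       (Csum (hecke_matrices n) (fun '(a, b, c, d) =>
          RtoC (ln (IZR a * x + IZR b) ^ r /
                ((IZR a * x + IZR b) * (IZR c * x + IZR d))))
        - Csum (divisors n) (fun l =>
            RtoC (ln (INR l * x) ^ r / (INR l * x)))))%C 1 k)
  /\
  (sum_n_m (fun r =>
     RtoC (Binomial.C k r) *
     (RtoC (ln 2 ^ (k - r) / 2) *
        (RtoC (1 / 2) * dPhi r (x / 2) + RtoC (1 / 2) * dPhi r ((x + 1) / 2)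
         - dPhi r x)
      + RtoC (ln (x + 1) ^ (k - r) / (x + 1) ^ 2) *
          dPhi r (2 * x / (x + 1))))%C 1 k
   =
   (dPhi k x - dPhi k (2 * x) +
    sum_n_m (fun r =>
      RtoC (Binomial.C k r * gamma_tilde gamma (k - r) *
        (ln (x + 1) ^ r / (2 * (x + 1))
         + ln (2 * x) ^ r / (2 * x * (x + 1))
         - ln x ^ r / (2 * x)))) 1 k)%C).
Proof.
split.
- intros n Hn.
  set (u := fun z : Z * Z * Z * Z => let '(a, b, c, d) := z in IZR a * x + IZR b).
  set (v := fun z : Z * Z * Z * Z => let '(a, b, c, d) := z in IZR c * x + IZR d).
  rewrite (sum_n_m_RtoC _ _ (fun r => Binomial.C k r *
    (lsum (hecke_matrices n) (fun '(a, b, c, d) =>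
       ln (IZR c * x + IZR d) ^ (k - r) / (IZR c * x + IZR d) ^ 2
       * dphi r ((IZR a * x + IZR b) / (IZR c * x + IZR d)))
     - lsum (divisors n) (fun l => ln (INR l) ^ (k - r) / INR l * dphi r x)))).
  2:{ intros r Hr; rewrite RtoC_mult, RtoC_minus; do 2 f_equal; apply Csum_RtoC.
      - intros [[[a b] c] d] Hin; apply (hecke_matrix_pos n x) in Hin; [|exact Hx].
        rewrite RtoC_mult, dPhi_RtoC; [reflexivity|lia|].
        apply Rdiv_lt_0_compat; lra.
      - intros l _; rewrite RtoC_mult, dPhi_RtoC; [reflexivity|lia|exact Hx]. }
  rewrite (sum_n_m_RtoC _ _ (fun r => Binomial.C k r * gamma_tilde gamma (k - r) *
    (lsum (hecke_matrices n) (fun '(a, b, c, d) =>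
       ln (IZR a * x + IZR b) ^ r / ((IZR a * x + IZR b) * (IZR c * x + IZR d)))
     - lsum (divisors n) (fun l => ln (INR l * x) ^ r / (INR l * x))))).
  2:{ intros r Hr; rewrite (RtoC_mult (_ * _)), RtoC_minus; do 2 f_equal;
      apply Csum_RtoC; [intros [[[a b] c] d] _|intros l _]; reflexivity. }
  f_equal; now apply hecke_dphi_identity.
- rewrite !dPhi_RtoC by (assumption || lra).
  rewrite (sum_n_m_RtoC _ _ (fun r => Binomial.C k r *
    (ln 2 ^ (k - r) / 2 * (1 / 2 * dphi r (x / 2) + 1 / 2 * dphi r ((x + 1) / 2)
       - dphi r x)
     + ln (x + 1) ^ (k - r) / (x + 1) ^ 2 * dphi r (2 * x / (x + 1))))).
  2:{ intros r Hr; rewrite !dPhi_RtoC by (lia || lra || apply Rdiv_lt_0_compat; lra).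
      now rewrite <- !RtoC_mult, <- RtoC_plus, <- RtoC_minus, <- !RtoC_mult,
        <- RtoC_plus, <- RtoC_mult. }
  rewrite (sum_n_m_RtoC _ _ (fun r => Binomial.C k r * gamma_tilde gamma (k - r) *
      (ln (x + 1) ^ r / (2 * (x + 1)) + ln (2 * x) ^ r / (2 * x * (x + 1))
       - ln x ^ r / (2 * x)))) by reflexivity.
  rewrite <- RtoC_minus, <- RtoC_plus; f_equal; now apply hecke_2_dphi_identity.
Qed.
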